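(* Let $a \in [0,2]$ be such that the quadratic map $q_a(x) = 1 - a x^2$ has positive topological entropy, and let $s > 1$ be defined by $\log s = h_{top}(q_a)$. Let $X_a = \varprojlim([u, 1], q_a)$ be the inverse limit space of $q_a$, where $u = \frac{1}{2a}(-1 - \sqrt{1+4a})$ is the left fixed point of $q_a$, and let $\sigma : X_a \to X_a$ be the shift homeomorphism. If $h : X_a \to X_a$ is a homeomorphism and $R \in \mathbb{Z}$ is such that $h$ is isotopic to $\sigma^R$, then the topological entropy of $h$ is $h_{top}(h) = |R| \log s$.
   Context: The map $q_a$ is considered on the invariant interval $[u, c_1]$, where $c_1 = q_a(0) = 1$ is the critical value (positive entropy forces $a > 0$, so $u$ is well defined). The inverse limit space is the set of all backward orbits $$X_a = \{ x = (\dots, x_{-2}, x_{-1}, x_0) : x_{-i} \in [u,1],\ q_a(x_{-i-1}) = x_{-i} \text{ for all } i \ge 0 \},$$ equipped with the metric $d(x,y) = \sum_{n \le 0} 2^n |x_n - y_n|$; it is a compact metric space. The shift homeomorphism is $$\sigma(\dots, x_{-2}, x_{-1}, x_0) = (\dots, x_{-2}, x_{-1}, x_0, q_a(x_0)).$$ Two homeomorphisms $f, g : X \to X$ are isotopic if there is a continuous map $H : X \times [0,1] \to X$ with $H(\cdot,0) = f$, $H(\cdot,1) = g$ and $H(\cdot,t)$ a homeomorphism of $X$ for every $t \in [0,1]$. Topological entropy $h_{top}$ is the usual one (e.g. defined by Bowen's $(n,\varepsilon)$-separated sets). It is known from earlier work that for every homeomorphism $h : X_a \to X_a$ an integer $R$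 with $h$ isotopic to $\sigma^R$ exists. *)

(* Defs.v *)
From HB Require Import structures.
From mathcomp Require Import all_boot all_order all_algebra.
From mathcomp Require Import finmap.
From mathcomp Require Import all_classical all_reals all_analysis.
From mathcomp Require Import ring lra.
Set Implicit Arguments.
Unset Strict Implicit.
Unset Printing Implicit Defensive.
Import Order.TTheory GRing.Theory Num.Theory.
Import numFieldNormedType.Exports.
Local Open Scope classical_set_scope.
Local Open Scope ring_scope.

Section Entropy.
Context {R : realType} {T : metricType R}.
Implicit Types (f : T -> T) (K : set T).

Definition orbit_separated f (n : nat) (e : R) (E : set T) : Prop :=
  forall x y, E x -> E y -> x <> y ->
    exists2 k, (k < n)%N & e < mdist (iter k f x) (iter k f y).

Definition max_separated f K (n : nat) (e : R) : \bar R :=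
  ereal_sup [set (#|` E|%:R)%:E | E in
    [set E : {fset T} | [set` E] `<=` K /\ orbit_separated f n e [set` E]]].

(* Bowen's entropy of f on K; if f maps K into itself, this only depends on
   the restriction of f to K and is the entropy of that restriction. *)
Definition htop f K : \bar R :=
  lim (limn_esup (fun n : nat =>
    ((n%:R^-1)%:E * lne (max_separated f K n e))%E) @[e --> 0^'+]).

End Entropy.

Definition homeomorphism {X Y : topologicalType} (f : X -> Y) : Prop :=
  continuous f /\
  exists g : Y -> X, [/\ continuous g, cancel f g & cancel g f].

Definition isotopic (R : realType) {X : topologicalType} (f g : X -> X) : Prop :=
  exists H : X * R -> X,
    [/\ {within [set: X] `*` `[0, 1]%classic, continuous H},
        forall x, H (x, 0) = f x,
        forall x, H (x, 1) = g x &
        forall t, 0 <= t <= 1 -> homeomorphism (fun x => H (x, t))].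

Section InverseLimit.
Context {R : realType}.
Implicit Type a : R.

Definition quad a (x : R) : R := 1 - a * x ^+ 2.

Definition left_fix a : R := (2 * a)^-1 * (- 1 - Num.sqrt (1 + 4 * a)).

(* Topological entropy of the restriction of quad a to the invariant interval. *)
Definition quad_entropy a : \bar R :=
  htop (T := R^o) (quad a) `[left_fix a, 1].

(* The entry of index n is the coordinate x_{-n} of the backward orbit. *)
Record invlim a := Invlim {
  coord : nat -> R;
  coord_itv : forall n, left_fix a <= coord n <= 1;
  coord_orbit : forall n, quad a (coord n.+1) = coord n }.

HB.instance Definition _ a := gen_eqMixin (invlim a).
HB.instance Definition _ a := gen_choiceMixin (invlim a).

Lemma invlim_eq a (x y : invlim a) : coord x =1 coord y -> x = y.
Proof.
case: x y => [x xi xo] [y yi yo] /= /funext xy; subst y.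
by rewrite (Prop_irrelevance xi yi) (Prop_irrelevance xo yo).
Qed.

Definition invlim_term a (x y : invlim a) : R^nat :=
  fun n => 2 ^- n * `|coord x n - coord y n|.

Definition invlim_dist a (x y : invlim a) : R :=
  limn (series (invlim_term x y)).

Lemma invlim_term_ge0 a (x y : invlim a) n : 0 <= invlim_term x y n.
Proof. by rewrite mulr_ge0// invr_ge0 exprn_ge0. Qed.

Lemma cvg_invlim_term a (x y : invlim a) : cvgn (series (invlim_term x y)).
Proof.
apply: (@series_le_cvg _ _ (geometric (1 - left_fix a) 2^-1)).
- exact: invlim_term_ge0.
- move=> n /=; have := coord_itv x 0; move=> /andP[ux x1].
  by rewrite mulr_ge0 ?exprn_ge0 ?invr_ge0// subr_ge0 (le_trans ux).
- move=> n /=; rewrite /invlim_term mulrC exprVn ler_wpM2r ?invr_ge0 ?exprn_ge0//.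
  have := coord_itv x n; have := coord_itv y n.
  move=> /andP[? ?] /andP[? ?].
  by rewrite ler_norml; apply/andP; split; lra.
- by apply: is_cvg_geometric_series; rewrite ger0_norm ?invr_ge0//; lra.
Qed.

Lemma invlim_dist_xx a (x : invlim a) : invlim_dist x x = 0.
Proof.
rewrite /invlim_dist (_ : series _ = cst 0) ?lim_cst//.
apply/funext => n; rewrite /series /= big1 // => i _.
by rewrite /invlim_term subrr normr0 mulr0.
Qed.

Lemma invlim_dist_positivity a (x y : invlim a) : invlim_dist x y = 0 -> x = y.
Proof.
move=> d0; apply: invlim_eq => n; apply/eqP; rewrite -subr_eq0 -normr_eq0.
have t0 : invlim_term x y n <= 0.
  have nd : nondecreasing_seq (series (invlim_term x y)).
    by apply: nondecreasing_series => i _ _; exact: invlim_term_ge0.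
  have := nondecreasing_cvgn_le nd (@cvg_invlim_term _ x y) n.+1.
  rewrite -/(invlim_dist x y) d0; apply: le_trans.
  rewrite /series /= big_nat_recr //= lerDr.
  by apply: sumr_ge0 => i _; exact: invlim_term_ge0.
have /eqP : invlim_term x y n = 0.
  by apply/eqP; rewrite eq_le t0 invlim_term_ge0.
by rewrite mulf_eq0 invr_eq0 expf_eq0 pnatr_eq0 andbF.
Qed.

Lemma invlim_dist_sym a (x y : invlim a) : invlim_dist x y = invlim_dist y x.
Proof.
rewrite /invlim_dist; congr (limn (series _)); apply/funext => n.
by rewrite /invlim_term distrC.
Qed.

Lemma invlim_dist_triangle a (y x z : invlim a) :
  invlim_dist x z <= invlim_dist x y + invlim_dist y z.
Proof.
rewrite /invlim_dist.
rewrite -(lim_seriesD (@cvg_invlim_term _ x y) (@cvg_invlim_term _ y z)).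
apply: lim_series_le; first exact: cvg_invlim_term.
  exact: (is_cvg_seriesD (@cvg_invlim_term _ x y) (@cvg_invlim_term _ y z)).
move=> n; rewrite /= /invlim_term -mulrDr ler_wpM2l ?invr_ge0 ?exprn_ge0//.
exact: ler_distD.
Qed.

HB.instance Definition _ a := @isMetric.Build R (invlim a) (@invlim_dist a)
  (@invlim_dist_xx a) (@invlim_dist_positivity a) (@invlim_dist_sym a)
  (@invlim_dist_triangle a).

Lemma quad_itv a x : 0 <= a <= 2 ->
  left_fix a <= x <= 1 -> left_fix a <= quad a x <= 1.
Proof.
move=> /andP[a0 a2] /andP[ux x1].
apply/andP; split; last by rewrite /quad gerBl mulr_ge0 ?sqr_ge0.
have [->|an0] := eqVneq a 0.
  by rewrite /left_fix /quad mulr0 invr0 !mul0r subr0.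
have {an0}a_gt0 : 0 < a by rewrite lt_neqAle eq_sym an0.
set u := left_fix a in ux *; set r := Num.sqrt (1 + 4 * a).
have rr : r ^+ 2 = 1 + 4 * a by rewrite sqr_sqrtr//; lra.
have r0 : 0 <= r by exact: sqrtr_ge0.
have au : 2 * a * u = - 1 - r by rewrite /u /left_fix mulrA divff ?mul1r//; lra.
have fixu : 1 - a * u ^+ 2 = u.
  have a4 : 4 * a != 0 by lra.
  apply: (mulfI a4).
  have -> : 4 * a * (1 - a * u ^+ 2) = 4 * a - (2 * a * u) ^+ 2 by ring.
  have -> : 4 * a * u = 2 * (2 * a * u) by ring.
  by rewrite au; nra.
have u1 : u <= -1.
  have a2_gt0 : 0 < 2 * a by lra.
  by rewrite -(ler_pM2l a2_gt0) au; nra.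
rewrite -{1}fixu /quad lerD2l lerN2 ler_wpM2l//; nra.
Qed.

Definition shift_coord a (x : invlim a) (n : nat) : R :=
  if n is m.+1 then coord x m else quad a (coord x 0).

Lemma shift_coord_itv a (ha : 0 <= a <= 2) (x : invlim a) n :
  left_fix a <= shift_coord x n <= 1.
Proof.
by case: n => [|n]; [apply: quad_itv ha _|]; exact: coord_itv.
Qed.

Lemma shift_coord_orbit a (x : invlim a) n :
  quad a (shift_coord x n.+1) = shift_coord x n.
Proof. by case: n => [|n] //; exact: coord_orbit. Qed.

Definition shift a (ha : 0 <= a <= 2) (x : invlim a) : invlim a :=
  Invlim (shift_coord_itv ha x) (shift_coord_orbit x).

Definition unshift a (x : invlim a) : invlim a :=
  Invlim (fun n => coord_itv x n.+1) (fun n => coord_orbit x n.+1).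

Lemma shiftK a (ha : 0 <= a <= 2) : cancel (shift ha) (@unshift a).
Proof. by move=> x; apply: invlim_eq. Qed.

Lemma unshiftK a (ha : 0 <= a <= 2) : cancel (@unshift a) (shift ha).
Proof.
by move=> x; apply: invlim_eq => -[|n] //=; exact: coord_orbit.
Qed.

Definition shift_pow a (ha : 0 <= a <= 2) (k : int) : invlim a -> invlim a :=
  match k with (* Negz n is -(n + 1) *)
  | Posz n => iter n (shift ha)
  | Negz n => iter n.+1 (@unshift a)
  end.

End InverseLimit.

(* Main.v *)
(* Let b be the growth rate of the number of laps of the iterates of q. Counting
   laps with weight e^(-b k) gives a semiconjugacy Lam from q to the tent map of
   slope e^b, whence h_top(q) = b.

   Lower bound. Let f be homotopic to sigma^n, n > 0. Seen through Lam, the tracks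
   of a homotopy are backward orbits of paths under the tent map, and those
   contract exponentially with the depth of the coordinate. Hence the coordinates
   of f^j x and of sigma^(nj) x have the same image by Lam up to an exponentially
   small error, and f separates as many points as the n-th iterate of the tent map.

   Upper bound. A homeomorphism and its inverse have the same entropy, so it is
   enough to bound the entropy of a homeomorphism g homotopic to sigma^(-r). The
   map Lam is replaced by integer labels of the points of [u, 1], counting
   consecutive intervals all of whose late images under q stay large; a homotopy
   displaces them by a bounded amount. The labels along N steps of g are therefore
   determined, up to polynomially many choices, by an itinerary of length r N, for
   which there are about e^(r N b) possibilities. Points with the same labels are
   close to backward orbits whose coordinates span intervals that q eventually
   contracts. If no such interval folds back over the turning point, injectivity of
   g makes the coordinates monotone along families of such points, and they account
   for linearly many orbits only. Otherwise the turning point is attracted to a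
   periodic orbit, an interval contracted by q contains a bounded number of large
   oscillations at every time, and finer labels can be used. *)

Require Import Defs.
From HB Require Import structures.
From mathcomp Require Import all_boot all_order all_algebra.
From mathcomp Require Import finmap.
From mathcomp Require Import all_classical all_reals all_analysis.
From mathcomp Require Import ring lra zify.
Set Implicit Arguments.
Unset Strict Implicit.
Unset Printing Implicit Defensive.
Import Order.TTheory GRing.Theory Num.Theory.
Import numFieldNormedType.Exports.
Local Open Scope classical_set_scope.
Local Open Scope ring_scope.

(** * Counting *)

(** The semiconjugacy [Lam] does not suffice for the upper bound: it may be constant on intervals on
    which q still has dynamics, for instance with a slower growth of laps. Points of one fibre of
    [Lam] cannot be told apart through the tent map, yet g may separate them. Labels distinguish the
    ends of every interval whose images stay large. The displacement by a homotopy is bounded per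
    step, so that after N steps the error J N does not improve. Time is therefore cut into blocks of
    fixed length N: a block costs e^(r N b) times a polynomial in N, and the growth rate of
    (polynomial in N)^(n/N) tends to 0 as N grows. The negative power of the shift gives this
    direction its use: after N steps of g the coordinate of index M is compared with the initial
    coordinate of index M + r N, whose image under r N steps of q is the initial coordinate of index
    M. An itinerary of length r N links their labels. Wherever compactness is needed, limits are
    taken coordinatewise along a nonprincipal ultrafilter. *)

Definition btw {R : realType} (x y z : R) := (x <= y <= z) || (z <= y <= x).

(** Counting through duplicate-free lists applies to infinite P and to relations that are neither
    decidable nor equivalences. With [f x <> f y] as relation it bounds the number of values of f on
    P, with a separation relation the size of separated sets. *)
Definition at_most (A : eqType) (rel : A -> A -> Prop) (P : A -> Prop) (c : nat) :=
  forall E : seq A, uniq E -> (forall x, x \in E -> P x) ->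
  (forall x y, x \in E -> y \in E -> x != y -> rel x y) -> (size E <= c)%N.

Lemma at_mostW (A : eqType) (rel rel' : A -> A -> Prop) (P P' : A -> Prop) (c c' : nat) :
  at_most rel' P' c' -> (forall x y, P x -> P y -> x != y -> rel x y -> rel' x y) ->
  (forall x, P x -> P' x) -> (c' <= c)%N -> at_most rel P c.
Proof.
move=> H hr hP hc E uE EP Er; apply: leq_trans hc; apply: H => //.
  by move=> x xE; apply/hP/EP.
by move=> x y xE yE xy; apply: hr => //; [exact: EP|exact: EP|exact: Er].
Qed.

Lemma at_most_image (A B : eqType) (f : A -> B) (E : seq A) (S : seq B) :
  (forall x, x \in E -> f x \in S) ->
  at_most (fun x y => f x <> f y) (fun x => x \in E) (size S).
Proof.
move=> fS E' uE' E'E inj; rewrite -(size_map f); apply: uniq_leq_size.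
  rewrite map_inj_in_uniq// => x y xE yE fxy; apply/eqP/negPn/negP => xy.
  exact: (inj x y xE yE xy).
by move=> _ /mapP[x xE ->]; apply/fS/E'E.
Qed.

(** Product rule. The fibre of the head of the list is removed; the other elements miss one value of
    f, so the induction goes on with c1 - 1. *)
Lemma at_most_fiber (A B : eqType) (f : A -> B) (rel : A -> A -> Prop)
    (P : A -> Prop) (c1 c2 : nat) :
  at_most (fun x y => f x <> f y) P c1 ->
  (forall v, at_most rel (fun x => P x /\ f x = v) c2) ->
  at_most (fun x y => f x = f y -> rel x y) P (c1 * c2).
Proof.
move=> H1 H2 E uE EP Er.
have {}H1 : at_most (fun x y => f x <> f y) (fun x => x \in E) c1.
  by apply: at_mostW H1 _ _ _.
have {}H2 : forall v, at_most rel (fun x => x \in E /\ f x = v) c2.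
  by move=> v; apply: at_mostW (H2 v) _ _ _ => // x [/EP].
elim: {E}(size E) {-2}E (leqnn (size E)) c1 H1 uE EP Er H2 => [|k IH] E.
  by rewrite leqn0 size_eq0 => /eqP ->.
case: E => [//|x E'] sE c1; set E := x :: E' => H1 uE EP Er H2.
have xE : x \in E by rewrite mem_head.
have c1_gt0 : (0 < c1)%N.
  apply: (H1 [:: x]) => //; first by move=> y; rewrite inE => /eqP ->.
  by move=> y z; rewrite !inE => /eqP -> /eqP ->; rewrite eqxx.
pose E1 := [seq y <- E | f y == f x].
pose E2 := [seq y <- E | f y != f x].
have s12 : (size E = size E1 + size E2)%N by rewrite !size_filter count_predC.
have s1 : (size E1 <= c2)%N.
  apply: (H2 (f x)); first exact: filter_uniq.
    by move=> y; rewrite mem_filter => /andP[/eqP -> ->].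
  move=> y z; rewrite !mem_filter => /andP[/eqP fy yE] /andP[/eqP fz zE] yz.
  by apply: Er => //; rewrite fy fz.
have s2 : (size E2 <= c1.-1 * c2)%N.
  apply: IH.
  - have : (0 < size E1)%N by rewrite size_filter -has_count /= eqxx.
    by move: sE; rewrite s12; lia.
  - move=> S uS SE Sf; rewrite -ltnS prednK//; apply: (H1 (x :: S)).
    + rewrite /= uS andbT; apply/negP => /SE.
      by rewrite mem_filter eqxx.
    + move=> y; rewrite inE => /orP[/eqP -> //|/SE].
      by rewrite mem_filter => /andP[].
    + move=> y z; rewrite !inE => /orP[/eqP ->|yS] /orP[/eqP ->|zS].
      * by rewrite eqxx.
      * by move: (SE _ zS); rewrite mem_filter => /andP[/eqP fz _] _ e; apply: fz.
      * by move: (SE _ yS); rewrite mem_filter => /andP[/eqP fz _] _ e; apply: fz.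
      * exact: Sf.
  - exact: filter_uniq.
  - by move=> y; rewrite mem_filter => /andP[_ /EP].
  - move=> y z; rewrite !mem_filter => /andP[_ yE] /andP[_ zE]; exact: Er.
  - by move=> v; apply: at_mostW (H2 v) _ _ _ => // y [+ ->]; rewrite mem_filter => /andP[].
by rewrite s12 -[c1]prednK// mulSn leq_add.
Qed.

Lemma maximal_separated (A : eqType) (rel : A -> A -> Prop) (E : seq A) :
  (forall x y, rel x y -> rel y x) ->
  exists S : seq A, [/\ uniq S, {subset S <= E},
    forall x y, x \in S -> y \in S -> x != y -> rel x y &
    forall x, x \in E -> exists2 y, y \in S & x != y -> ~ rel x y].
Proof.
move=> rsym; elim: E => [|x E [S [uS SE Sr ES]]]; first by exists [::].
have [h|h] := pselect (exists2 y, y \in S & x != y -> ~ rel x y).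
  exists S; split=> //; first by move=> y /SE yE; rewrite inE yE orbT.
  by move=> y; rewrite inE => /orP[/eqP -> //|/ES].
have xr y : y \in S -> x != y /\ rel x y.
  move=> yS; split; last by apply: contrapT => nr; apply: h; exists y.
  by apply/negP => /eqP xy; apply: h; exists y => //; rewrite xy eqxx.
exists (x :: S); split.
- by rewrite /= uS andbT; apply/negP => /xr[]; rewrite eqxx.
- by move=> y; rewrite !inE => /orP[-> //|/SE ->]; rewrite orbT.
- move=> y z; rewrite !inE => /orP[/eqP ->|yS] /orP[/eqP ->|zS].
  + by rewrite eqxx.
  + by move=> _; case: (xr z zS).
  + by move=> _; apply/rsym; case: (xr y yS).
  + exact: Sr.
- move=> y; rewrite inE => /orP[/eqP ->|/ES[z zS h2]].
    by exists x; rewrite ?inE eqxx.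
  by exists z => //; rewrite inE zS orbT.
Qed.

(** Turns a bound on balls into a large separated set: every element of E is close to some element
    of a maximal separated S, and at most c elements are attached to each. *)
Lemma many_separated (A : eqType) (rel : A -> A -> Prop) (E : seq A) (c : nat) :
  (forall x y, rel x y -> rel y x) -> uniq E ->
  (forall x, x \in E ->
    at_most (fun _ _ => True) (fun y => y \in E /\ (y != x -> ~ rel y x)) c) ->
  exists S : seq A, [/\ uniq S, {subset S <= E},
    forall x y, x \in S -> y \in S -> x != y -> rel x y &
    (size E <= size S * c)%N].
Proof.
move=> rsym uE Ec; have [S [uS SE Sr ES]] := maximal_separated E rsym.
exists S; split=> //.
have /choice[f fP] : forall x, exists y, x \in E -> y \in S /\ (x != y -> ~ rel x y).
  move=> x; have [/ES[y yS h]|nx] := boolP (x \in E); first by exists y.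
  by exists x.
have H := @at_most_fiber _ _ f (fun _ _ => True) (fun x => x \in E) (size S) c.
apply: H => //.
  by apply: at_most_image => x /fP[].
move=> v; have [vS|vS] := boolP (v \in S).
  apply: at_mostW (Ec v (SE _ vS)) _ _ _ => // x [xE fx]; split => //.
  by rewrite -fx; case: (fP x xE).
move=> [//|x E0] _ h _; have [xE fx] := h x (mem_head _ _).
by move: vS; rewrite -fx; case: (fP x xE) => ->.
Qed.

(** The relation says that at some time x and y are too far apart for any z to be close to both.
    Send each x to a nearby member of a maximal separated set at the last time, of size at most c:
    two elements with the same target are not told apart at that time, so the earlier times
    remain. *)
Lemma at_most_join (A : eqType) (rel2 : nat -> A -> A -> Prop)
    (P : A -> Prop) (c B : nat) :
  (forall j x y, rel2 j x y -> rel2 j y x) -> (forall j x, ~ rel2 j x x) ->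
  (forall j, (j < B)%N -> at_most (rel2 j) P c) ->
  at_most (fun x y => exists2 j, (j < B)%N & forall z, rel2 j x z \/ rel2 j y z) P (c ^ B).
Proof.
move=> rsym rirr; elim: B P => [|B IH] P H E uE EP Er.
  case: E uE EP Er => [//|x [//|y E]] /= /andP[xyE _] _ /(_ x y).
  rewrite !inE !eqxx orbT => /(_ erefl erefl).
  have -> : x != y by apply: contraNN xyE => /eqP ->; rewrite mem_head.
  by case.
have [S [uS SE Sr ES]] := maximal_separated E (rsym B).
have sS : (size S <= c)%N by apply: (H B) => // x /SE/EP.
have /choice[f fP] : forall x, exists y, x \in E -> y \in S /\ ~ rel2 B x y.
  move=> x; have [/ES[y yS h]|nx] := boolP (x \in E); last by exists x.
  exists y => _; split => //; have [->|/h//] := eqVneq x y; exact: rirr.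
rewrite expnS; apply: leq_trans (leq_mul sS (leqnn _)).
apply: (at_most_fiber (A:=A) (f:=f) (P:=fun x => x \in E)
    (rel:=fun x y => exists2 j, (j < B)%N & forall z, rel2 j x z \/ rel2 j y z)) => //.
- by apply: at_most_image => x /fP[].
- move=> v; apply: at_mostW (IH (fun x => x \in E) _) _ _ _ => //.
    by move=> j jB; apply: at_mostW (H j _) _ _ _ => //; exact: ltnW.
  by move=> x [].
- move=> x y xE yE xy fxy; have [j jB hj] := Er x y xE yE xy.
  exists j => //; move: jB; rewrite ltnS leq_eqVlt => /orP[/eqP jE|//].
  have [_ nx] := fP x xE; have [_ ny] := fP y yE.
  by exfalso; case: (hj (f x)) => [|]; rewrite jE => // ; rewrite fxy.
Qed.

Section Variation.
Context {R : realType}.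
Implicit Types (phi : nat -> nat -> R).

Lemma variation_count (L n : nat) (eps : R) (D : nat -> R) phi :
  (forall i, (i < L)%N -> exists2 k, (k < n)%N & eps <= `|phi k i.+1 - phi k i|) ->
  (forall k, (k < n)%N -> \sum_(i < L) `|phi k i.+1 - phi k i| <= D k) ->
  L%:R * eps <= \sum_(k < n) D k.
Proof.
move=> h1 h2; apply: (@le_trans _ _ (\sum_(k < n) \sum_(i < L) `|phi k i.+1 - phi k i|)).
  rewrite exchange_big /= mulr_natl -[X in _ *+ X]card_ord -sumr_const.
  apply: ler_sum => i _; have [k kn hk] := h1 i (ltn_ord i).
  rewrite (bigD1 (Ordinal kn))//= (le_trans hk)// lerDl.
  by apply: sumr_ge0 => *.
by apply: ler_sum => k _; apply: h2.
Qed.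

Lemma btw_dist (x y z : R) : btw x y z -> `|y - x| + `|z - y| = `|z - x|.
Proof.
case/orP => /andP[h1 h2].
  by rewrite !ger0_norm ?subr_ge0 ?(le_trans h1)//; ring.
by rewrite !ler0_norm ?subr_le0 ?(le_trans h1)//; ring.
Qed.

Lemma btw_sum (v : nat -> R) (L : nat) :
  (forall i, (i < L)%N -> btw (v 0%N) (v i) (v i.+1)) ->
  \sum_(i < L) `|v i.+1 - v i| = `|v L - v 0%N|.
Proof.
elim: L => [|L IH] h; first by rewrite big_ord0 subrr normr0.
rewrite big_ord_recr /= IH; last by move=> i iL; apply: h; exact: ltnW.
exact/btw_dist/h.
Qed.

(** Each observable is monotone in the key, so its variation along the list sorted by key telescopes
    to at most D k, while each consecutive pair contributes eps to some observable. With bounded D k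
    the count is linear in n. *)
Lemma monotone_count (A : eqType) (P : A -> Prop) (key : A -> R) (n : nat) (eps : R)
    (phi : nat -> A -> R) (D : nat -> R) (E : seq A) :
  (forall k, (k < n)%N -> 0 <= D k) ->
  uniq E -> (forall x, x \in E -> P x) ->
  (forall x y, x \in E -> y \in E -> x != y ->
     exists2 k, (k < n)%N & eps <= `|phi k x - phi k y|) ->
  (forall k x y z, (k < n)%N -> P x -> P y -> P z -> key x <= key y -> key y <= key z ->
     btw (phi k x) (phi k y) (phi k z)) ->
  (forall k x y, (k < n)%N -> P x -> P y -> `|phi k x - phi k y| <= D k) ->
  (size E).-1%:R * eps <= \sum_(k < n) D k.
Proof.
move=> D0 uE EP sep mono rng.
pose S := sort (fun x y => key x <= key y) E.
have sS : sorted (fun x y => key x <= key y) S.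
  by apply: sort_sorted => x y; exact: le_total.
have SE x : (x \in S) = (x \in E) by rewrite mem_sort.
have szS : size S = size E by rewrite size_sort.
have uS : uniq S by rewrite sort_uniq.
case: E => [|x0 E0] in uE EP sep S sS SE szS uS *.
  by rewrite mul0r; apply: sumr_ge0 => k _; exact: D0.
have inS i : (i < size S)%N -> nth x0 S i \in x0 :: E0 by move=> iS; rewrite -SE mem_nth.
have Sle i j : (i <= j)%N -> (j < size S)%N -> key (nth x0 S i) <= key (nth x0 S j).
  move=> ij jS; apply: (sorted_leq_nth _ _ x0 sS) => //.
  - by move=> x y z; exact: le_trans.
  - exact: (leq_ltn_trans ij jS).
apply: (variation_count (phi := fun k i => phi k (nth x0 S i))).
  move=> i; rewrite /= => iE.
  have [|||k kn hk] := sep (nth x0 S i.+1) (nth x0 S i).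
  - by apply: inS; rewrite szS.
  - by apply: inS; rewrite szS ltnW.
  - by rewrite nth_uniq ?szS//= ?ltnS 1?ltnW// neq_ltn ltnSn orbT.
  by exists k.
move=> k kn; rewrite (btw_sum (v := fun i => phi k (nth x0 S i))).
  by apply: rng => //; apply/EP/inS; rewrite szS.
move=> i iE; apply: mono => //; try (by apply/EP/inS; rewrite szS/= ?ltnS// ltnW).
- by apply: Sle => //; rewrite szS/= ltnS ltnW.
- by apply: Sle => //; rewrite szS/= ltnS.
Qed.
End Variation.

(** * Bounds on the topological entropy *)

Section EntropyBounds.
Context {R : realType}.

Lemma growth_esup_le (M : nat -> \bar R) (A c : R) : 0 < A ->
  (forall n, M n <= (A * expR (n%:R * c))%:E)%E ->
  (limn_esup (fun n => (n%:R^-1)%:E * lne (M n)) <= c%:E)%E.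
Proof.
move=> A0 hM; apply/lee_addgt0Pr => e e0; rewrite -EFinD.
(* From n0 on, [|ln A| <= e * n], so that e absorbs the constant A. *)
pose n0 := (Num.truncn (`|ln A| / e)).+1.
rewrite /limn_esup /limf_esup; apply: ereal_inf_le; eexists.
  exists [set n | (n0 <= n)%N]; first by exists n0.
  by reflexivity.
apply: ge_ereal_sup => _ [n /= nn0 <-].
have n_gt0 : 0 < n%:R :> R by rewrite ltr0n (leq_trans _ nn0).
have [Mn0|Mn0] := leP (M n) 0%E.
  by rewrite le0_lneNy// gt0_muleNy ?leNye// lte_fin invr_gt0.
have MnF : M n \is a fin_num.
  by rewrite gt0_fin_numE// (le_lt_trans (hM n))// ltry.
rewrite -(fineK MnF) lne_EFin; last by rewrite fine_gt0// Mn0 -ge0_fin_numE ?ltW.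
rewrite -EFinM lee_fin mulrC ler_pdivrMr//.
have h : fine (M n) <= A * expR (n%:R * c) by rewrite -lee_fin fineK.
apply: (@le_trans _ _ (ln (A * expR (n%:R * c)))).
  by rewrite ler_ln ?posrE ?mulr_gt0 ?expR_gt0// fine_gt0// Mn0 -ge0_fin_numE ?ltW.
rewrite lnM ?posrE ?expR_gt0// expRK addrC mulrDl mulrC lerD2l.
apply: le_trans (ler_norm _) _; rewrite -ler_pdivrMl// mulrC.
apply: le_trans (ltW _) _; first exact: truncnS_gt.
by rewrite ler_nat.
Qed.

Lemma growth_esup_ge (M : nat -> \bar R) (A c : R) : 0 < A ->
  (forall n, (A * expR (n%:R * c))%:E <= M n)%E ->
  (c%:E <= limn_esup (fun n => (n%:R^-1)%:E * lne (M n)))%E.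
Proof.
move=> A0 hM; apply/lee_subgt0Pr => e e0; rewrite -EFinB.
pose n0 := (Num.truncn (`|ln A| / e)).+1.
rewrite /limn_esup /limf_esup; apply: le_ereal_inf_tmp => _ [V [n1 _ Vn1] <-].
pose n := maxn n0 n1.
apply: le_ereal_sup_tmp; exists ((n%:R^-1)%:E * lne (M n))%E.
  by exists n => //; apply: Vn1; rewrite /= leq_maxr.
have n_gt0 : 0 < n%:R :> R by rewrite ltr0n (leq_trans _ (leq_maxl _ _)).
apply: (@le_trans _ _ ((n%:R^-1)%:E * lne (A * expR (n%:R * c))%:E)%E); last first.
  rewrite lee_pmul2l ?lte_fin ?invr_gt0// lee_lne//.
    by rewrite in_itv/= leey andbT lee_fin mulr_ge0 ?expR_ge0 ?ltW.
  rewrite in_itv/= leey andbT; apply: le_trans (hM n).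
  by rewrite lee_fin mulr_ge0 ?expR_ge0 ?ltW.
rewrite lne_EFin ?mulr_gt0 ?expR_gt0// -EFinM lee_fin mulrC ler_pdivlMr//.
rewrite lnM ?posrE ?expR_gt0// expRK mulrBl (mulrC c).
suff : - ln A <= e * n%:R by lra.
apply: le_trans (ler_norm _) _; rewrite normrN -ler_pdivrMl// mulrC.
apply: le_trans (ltW _) _; first exact: truncnS_gt.
by rewrite ler_nat leq_maxl.
Qed.

Section Htop.
Context {T : metricType R}.
Implicit Types (f : T -> T) (K : set T).

Lemma max_separated_homo f K n (e e' : R) : e <= e' ->
  (max_separated f K n e' <= max_separated f K n e)%E.
Proof.
move=> ee; apply: ereal_sup_le => _ [E [EK sE] <-]; exists E => //; split => //.
by move=> x y Ex Ey xy; have [k kn h] := sE x y Ex Ey xy; exists k => //; exact: le_lt_trans h.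
Qed.

(** Separated sets grow as e decreases, so the limit at 0 is a supremum and each e can be treated
    separately. *)
Lemma htopE f K : htop f K = ereal_sup [set limn_esup (fun n : nat =>
    ((n%:R^-1)%:E * lne (max_separated f K n e))%E) | e in `]0, +oo[%classic].
Proof.
rewrite /htop; apply/cvg_lim => //.
apply: (@nonincreasing_at_right_cvge R _ 0 +oo%O) => // e e' _ _ ee.
rewrite /limn_esup /limf_esup; apply: le_ereal_inf_tmp => _ [V Vo <-].
apply: ereal_inf_le; eexists; first by exists V.
apply: ge_ereal_sup => _ [n Vn <-]; apply: le_ereal_sup_tmp.
eexists; first by exists n.
apply: lee_wpmul2l; first by rewrite lee_fin.
have sep0 e1 : (0 <= max_separated f K n e1)%E.
  apply: le_ereal_sup_tmp; exists 0%E => //; exists fset0; last by rewrite cardfs0.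
  by split => [x|x y]; rewrite /= inE.
by rewrite lee_lne ?in_itv/= ?sep0 ?leey// max_separated_homo.
Qed.

Lemma htop_le f K (c : R) :
  (forall e eta : R, 0 < e -> 0 < eta -> exists2 A : R, 0 < A & forall n,
     forall E : seq T, uniq E -> (forall x, x \in E -> K x) ->
     (forall x y, x \in E -> y \in E -> x != y ->
       exists2 k, (k < n)%N & e < mdist (iter k f x) (iter k f y)) ->
     (size E)%:R <= A * expR (n%:R * (c + eta))) ->
  (htop f K <= c%:E)%E.
Proof.
move=> h; rewrite htopE; apply: ge_ereal_sup => _ [e ei <-]; have e0 : 0 < e by move: ei; rewrite /= in_itv/= andbT.
apply/lee_addgt0Pr => eta eta0; rewrite -EFinD.
have [A A0 hA] := h e eta e0 eta0; apply: (growth_esup_le A0) => n.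
apply: ge_ereal_sup => _ [E [EK sE] <-]; rewrite lee_fin; apply: hA.
- exact: fset_uniq.
- by move=> x xE; apply: EK.
- by move=> x y xE yE xy; apply: sE => //; apply/eqP.
Qed.

Lemma htop_ge f K (c : R) :
  (forall eta : R, 0 < eta -> exists e A : R, [/\ 0 < e, 0 < A & forall n,
     exists E : seq T, [/\ uniq E, forall x, x \in E -> K x,
     forall x y, x \in E -> y \in E -> x != y ->
       exists2 k, (k < n)%N & e < mdist (iter k f x) (iter k f y) &
     A * expR (n%:R * (c - eta)) <= (size E)%:R]]) ->
  (c%:E <= htop f K)%E.
Proof.
move=> h; apply/lee_subgt0Pr => eta eta0; rewrite -EFinB htopE.
have [e [A [e0 A0 hA]]] := h eta eta0.
apply: le_ereal_sup_tmp.
exists (limn_esup (fun n : nat => ((n%:R^-1)%:E * lne (max_separated f K n e))%E)).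
  by exists e; rewrite //= in_itv/= e0.
apply: (growth_esup_ge A0) => n; have [E [uE EK Es hE]] := hA n.
apply: le_ereal_sup_tmp; exists (size E)%:R%:E; last by rewrite lee_fin.
exists [fset x in E]%fset; last first.
  by rewrite cardfE; congr (_%:R%:E); rewrite -cardfE card_fseq undup_id.
split; first by move=> x; rewrite /= !inE => /EK.
by move=> x y; rewrite /= !inE => xE yE /eqP xy; exact: Es.
Qed.

End Htop.
End EntropyBounds.

(** * Laps of the quadratic map *)

Section QuadBasics.
Context {R : realType}.
Variable a : R.
Hypotheses (a0 : 0 < a) (a2 : a <= 2).
Local Notation q := (quad a).
Local Notation u := (left_fix a).

Lemma mdist_regular (x y : R^o) : mdist x y = `|x - y|.
Proof. by rewrite distrC. Qed.

Lemma sqrt_fix : [/\ 2 * a * u = - 1 - Num.sqrt (1 + 4 * a),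
  Num.sqrt (1 + 4 * a) ^+ 2 = 1 + 4 * a & 1 <= Num.sqrt (1 + 4 * a)].
Proof.
have A0 := a0; split; last by rewrite -[leLHS]sqrtr1 ler_sqrt; lra.
  by rewrite /left_fix mulrA divff ?mul1r//; apply/eqP; lra.
by rewrite sqr_sqrtr//; lra.
Qed.

Lemma left_fixP : 1 - a * u ^+ 2 = u.
Proof.
have [h1 h2 _] := sqrt_fix.
have a4 : 4 * a != 0 by rewrite mulf_neq0// gt_eqF.
apply: (mulfI a4).
have -> : 4 * a * (1 - a * u ^+ 2) = 4 * a - (2 * a * u) ^+ 2 by ring.
have -> : 4 * a * u = 2 * (2 * a * u) by ring.
by rewrite h1; move: h2; set r := Num.sqrt _ => h2; have A0 := a0; nra.
Qed.

Lemma left_fix_leN1 : u <= -1.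
Proof.
have [h1 h2 h3] := sqrt_fix.
have A0 := a0; have A2 := a2; have a2_gt0 : 0 < 2 * a by lra.
rewrite -(ler_pM2l a2_gt0) h1; move: h2 h3; set r := Num.sqrt _ => h2 h3.
by nra.
Qed.

Lemma quad_u : q u = u. Proof. exact: left_fixP. Qed.

Lemma quad0 : q 0 = 1. Proof. by rewrite /quad expr0n/= mulr0 subr0. Qed.

Lemma quadN x : q (- x) = q x. Proof. by rewrite /quad sqrrN. Qed.

Lemma quad_norm x : q `|x| = q x.
Proof. by rewrite /quad real_normK// num_real. Qed.

Lemma quad_itvu x : u <= x <= 1 -> u <= q x <= 1.
Proof. by apply: quad_itv; rewrite a2 ltW. Qed.

Lemma quad_itvN x : u <= x <= - u -> u <= q x <= 1.
Proof.
move=> /andP[ux xu]; have [x0|x0] := lerP x 1; first by apply: quad_itvu; rewrite ux.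
by rewrite -quadN; apply: quad_itvu; lra.
Qed.

Lemma iter_quad_itv n x : u <= x <= 1 -> u <= iter n q x <= 1.
Proof. by move=> h; elim: n => //= n; exact: quad_itvu. Qed.

Lemma quad_sub x y : q x - q y = a * ((y - x) * (y + x)).
Proof. by rewrite /quad; ring. Qed.

Lemma quad_incr x y : y <= 0 -> x <= y -> q x <= q y.
Proof.
move=> y0 xy; rewrite -subr_ge0 quad_sub; apply: mulr_ge0; first exact: ltW.
by rewrite -mulrNN; apply: mulr_ge0; lra.
Qed.

Lemma quad_decr x y : 0 <= x -> x <= y -> q y <= q x.
Proof.
move=> y0 xy; rewrite -subr_ge0 quad_sub; apply: mulr_ge0; first exact: ltW.
by apply: mulr_ge0; lra.
Qed.

Lemma quad_sincr x y : y <= 0 -> x < y -> q x < q y.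
Proof.
move=> y0 xy; rewrite -subr_gt0 quad_sub; apply: mulr_gt0 => //.
by rewrite -mulrNN; apply: mulr_gt0; lra.
Qed.

Lemma quad_sdecr x y : 0 <= x -> x < y -> q y < q x.
Proof.
move=> y0 xy; rewrite -subr_gt0 quad_sub; apply: mulr_gt0 => //.
by apply: mulr_gt0; lra.
Qed.

Lemma continuous_quad : continuous q.
Proof.
by move=> x; apply: cvgB; [exact: cvg_cst|apply: cvgM; [exact: cvg_cst|exact: exprn_continuous]].
Qed.

Lemma continuous_iter_quad n : continuous (iter n q).
Proof.
elim: n => [|n IH] x; first exact: cvg_id.
by apply: (@continuous_comp _ _ _ (iter n q) q); [exact: IH|exact: continuous_quad].
Qed.

(** The maximum of |q'| on [u, -u]. This symmetric interval contains [u, 1] and allows points to be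
    reflected through the turning point. *)
Definition quad_lip : R := - (2 * a * u).

Lemma quad_lip_ge1 : 1 <= quad_lip.
Proof. by rewrite /quad_lip; have [-> _] := sqrt_fix; lra. Qed.

Lemma quad_dist x y : u <= x <= - u -> u <= y <= - u ->
  `|q x - q y| <= quad_lip * `|x - y|.
Proof.
move=> /andP[x1 x2] /andP[y1 y2].
have -> : q x - q y = (a * (y + x)) * (y - x) by rewrite /quad; ring.
rewrite (distrC x) normrM ler_wpM2r// normrM gtr0_norm// /quad_lip.
have -> : - (2 * a * u) = a * (- (2 * u)) by ring.
by rewrite ler_pM2l// ler_norml; apply/andP; split; lra.
Qed.

Lemma itvN x : u <= x <= 1 -> u <= x <= - u.
Proof. by move=> /andP[-> x1]; have := left_fix_leN1; lra. Qed.

Lemma iter_quad_dist n x y : u <= x <= - u -> u <= y <= - u ->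
  `|iter n q x - iter n q y| <= quad_lip ^+ n * `|x - y|.
Proof.
elim: n x y => [|n IH] x y hx hy; first by rewrite expr0 mul1r.
rewrite !iterSr exprSr -mulrA.
apply: (le_trans (IH (q x) (q y) (itvN (quad_itvN hx)) (itvN (quad_itvN hy)))).
rewrite ler_wpM2l ?exprn_ge0 ?(le_trans _ quad_lip_ge1)//.
exact: quad_dist.
Qed.

(* [lapc n x] counts the points of [u, x) sent to the critical point by the
   n-th iterate, up to the convention adopted at the endpoints. *)
Fixpoint lapc (n : nat) (x : R) : int :=
  if n is m.+1 then
    if (x <= 0)%R then lapc m (q x) else (lapc m 1%R *+ 2 - lapc m (q x))%R
  else Posz (0 < x)%R.

Lemma lapc_le n x y : u <= x -> x <= y -> y <= 1 -> lapc n x <= lapc n y.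
Proof.
elim: n x y => [|n IH] x y ux xy y1 /=.
  by case: (ltP 0 x) => x0; case: (ltP 0 y) => y0 //; exfalso; lra.
have qy : u <= q y <= 1 by apply: quad_itvu; lra.
have qx : u <= q x <= 1 by apply: quad_itvu; lra.
have h1 : lapc n (q x) <= lapc n 1 by apply: IH; lra.
have h2 : lapc n (q y) <= lapc n 1 by apply: IH; lra.
case: (lerP x 0) => x0; case: (lerP y 0) => y0.
- by apply: IH; [lra|exact: quad_incr|lra].
- by rewrite lerBrDr mulr2n lerD.
- exfalso; lra.
- by rewrite lerB//; apply: IH; [lra|apply: quad_decr; lra|lra].
Qed.

Lemma lapc_u n : lapc n u = 0.
Proof.
have u1 := left_fix_leN1; elim: n => [|n IH] /=.
  by rewrite ltNge (_ : u <= 0)//; lra.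
by rewrite quad_u IH (_ : u <= 0)//; lra.
Qed.

Lemma lapc_ge0 n x : u <= x <= 1 -> 0 <= lapc n x.
Proof. by move=> /andP[ux x1]; rewrite -(lapc_u n); apply: lapc_le. Qed.

Lemma lapc_le1 n x : u <= x <= 1 -> lapc n x <= lapc n 1.
Proof. by move=> /andP[ux x1]; apply: lapc_le. Qed.

Definition ell (n : nat) : nat := (\sum_(k < n) `|lapc k 1%R|%N).+1.

(** The factor in parentheses counts the laps of the m-th iterate on [y, x], and each lap carries at
    most [lapc n 1] points that n more steps send to 0. The induction peels off the first
    application of q; when 0 separates y from x, the images of both pieces end at 1. *)
Lemma lapcD (n m : nat) (x y : R) : u <= y -> y <= x -> x <= 1 ->
  lapc (n + m) x - lapc (n + m) y <=
  (1 + \sum_(k < m) (lapc k x - lapc k y)) * lapc n 1.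
Proof.
have u1 := left_fix_leN1.
elim: m x y => [|m IH] x y uy yx x1.
  rewrite addn0 big_ord0 addr0 mul1r.
  have := @lapc_ge0 n y; have := @lapc_le1 n x.
  by rewrite uy x1 (le_trans uy yx) (le_trans yx x1) => /(_ isT) ? /(_ isT) ?; lia.
have qy : u <= q y <= 1 by apply: quad_itvu; lra.
have qx : u <= q x <= 1 by apply: quad_itvu; lra.
have n1 : 0 <= lapc n 1 by apply: lapc_ge0; lra.
rewrite addnS /= big_ord_recl /=.
case: (lerP x 0) => x0; case: (lerP y 0) => y0; rewrite /= ?subr0 ?add0r ?subrr ?add0r.
- by apply: IH; [lra|exact: quad_incr|lra].
- exfalso; lra.
- have /andP[qx1 qx2] := qx; have /andP[qy1 qy2] := qy.
  have := IH 1 (q x) qx1 qx2 (lexx _); have := IH 1 (q y) qy1 qy2 (lexx _).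
  move=> h1 h2.
  have -> : \sum_(i < m) (lapc i 1 *+ 2 - lapc i (q x) - lapc i (q y)) =
      \sum_(k < m) (lapc k 1 - lapc k (q x)) + \sum_(k < m) (lapc k 1 - lapc k (q y)).
    by rewrite -big_split/=; apply: eq_bigr => i _; ring.
  by move: h1 h2; set s1 := \sum_(k < m) _; set s2 := \sum_(k < m) _; clear; lra.
- have -> : lapc (n + m) 1 *+ 2 - lapc (n + m) (q x) - (lapc (n + m) 1 *+ 2 - lapc (n + m) (q y)) =
    lapc (n + m) (q y) - lapc (n + m) (q x) by ring.
  have -> : \sum_(i < m) (lapc i 1 *+ 2 - lapc i (q x) - (lapc i 1 *+ 2 - lapc i (q y))) =
      \sum_(k < m) (lapc k (q y) - lapc k (q x)) by apply: eq_bigr => i _; ring.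
  by apply: IH; [lra|apply: quad_decr; lra|lra].
Qed.

Lemma ellS n : ell n.+1 = (ell n + `|lapc n 1%R|)%N.
Proof. by rewrite /ell big_ord_recr/= addSn. Qed.

Lemma lapc_ell n m : (`|lapc (n + m) 1%R| <= ell m * `|lapc n 1%R|)%N.
Proof.
have u1 := left_fix_leN1.
have g0 k : 0 <= lapc k 1 by apply: lapc_ge0; lra.
have := @lapcD n m 1 u (lexx _) _ (lexx _).
rewrite !lapc_u subr0 => h; have {}h := h ltac:(lra).
have e : \sum_(k < m) (lapc k 1 - lapc k u) = Posz (\sum_(k < m) `|lapc k 1%R|)%N.
  by rewrite (big_morph Posz PoszD (erefl _)); apply: eq_bigr => i _; rewrite lapc_u subr0 gez0_abs.
by move: h; rewrite e /ell; have := g0 (n + m)%N; have := g0 n; nia.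
Qed.

Lemma ellD n m : (ell (n + m) <= ell n * ell m)%N.
Proof.
elim: n => [|n IH]; first by rewrite add0n {2}/ell big_ord0 mul1n.
rewrite addSn !ellS mulnDl leq_add// mulnC; exact: lapc_ell.
Qed.

Definition itin (n : nat) (x : R) : seq bool := [seq 0 < iter k q x | k <- iota 0 n].

Lemma itinS n x : itin n.+1 x = (0 < x) :: itin n (q x).
Proof.
rewrite /itin /= -[1%N]/(1 + 0)%N iotaDl -map_comp; congr (_ :: _).
by apply: eq_map => k; rewrite /= -iterSr.
Qed.

Lemma itin_lapc n x y : (forall k, (k < n)%N -> lapc k x = lapc k y) ->
  itin n x = itin n y.
Proof.
elim: n x y => [//|n IH] x y h; rewrite !itinS.
have h0 : (0 < x) = (0 < y).
  by have /= := h 0%N isT; case: ltP => _; case: ltP.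
congr (_ :: _) => //; apply: IH => k kn.
by have /= := h k.+1 kn; rewrite !leNgt h0; case: (0 < y) => //= /addrI/oppr_inj.
Qed.

Lemma btw_quad x y z : (0 < x) = (0 < z) -> btw x y z ->
  btw (q x) (q y) (q z) /\ (0 < y) = (0 < z).
Proof.
move=> xz /orP h; split; last by case: h xz => /andP[? ?]; case: ltP => ?; case: ltP => ?; case: ltP => //; lra.
move: xz; case: ltP => x0; case: ltP => z0 // _; apply/orP.
  by case: h => /andP[? ?]; [right|left]; apply/andP; split; apply: quad_decr; lra.
by case: h => /andP[? ?]; [left|right]; apply/andP; split; apply: quad_incr; lra.
Qed.

Lemma itin_btw n x y z k : itin n x = itin n z -> btw x y z -> (k <= n)%N ->
  btw (iter k q x) (iter k q y) (iter k q z).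
Proof.
elim: n x y z k => [|n IH] x y z [|k] //; rewrite !itinS => -[xz h] b kn.
have [b' _] := btw_quad xz b.
by rewrite !iterSr; apply: IH.
Qed.

Lemma itin_count n : at_most (fun x y => itin n x <> itin n y)
  (fun x => u <= x <= 1) (ell n).
Proof.
move=> E uE EP sep.
have h : (size E).-1%:R * (1 : R) <= \sum_(k < n) (`|lapc k 1%R|%N)%:R.
  apply: (@monotone_count R _ (fun x => u <= x <= 1) id n 1
     (fun k x => (lapc k x)%:~R) (fun k => (`|lapc k 1%R|%N)%:R)) => //.
  - move=> x y xE yE xy; apply: contrapT => nh; apply: (sep x y xE yE xy).
    apply: itin_lapc => k kn; apply: contrapT => kxy; apply: nh; exists k => //.
    rewrite -rmorphB /= -intr_norm ler1z.
    by move: kxy; lia.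
  - move=> k x y z _ /andP[x1 _] /andP[y1 _] /andP[_ z1] xy yz.
    by apply/orP; left; rewrite !ler_int; apply/andP; split; apply: lapc_le => //; lra.
  - move=> k x y _ hx hy; rewrite -rmorphB /= -intr_norm pmulrn ler_int.
    have := lapc_ge0 k hx; have := lapc_ge0 k hy; have := lapc_le1 k hx; have := lapc_le1 k hy.
    lia.
by move: h; rewrite mulr1 -natr_sum ler_nat /ell; case: (size E).
Qed.

End QuadBasics.

Section ExpLemmas.
Context {R : realType}.

Lemma affine_expR (c d eta : R) : 0 <= c -> 0 < d -> 0 < eta ->
  exists2 A : R, 0 < A & forall n, c * n%:R + d <= A * expR (n%:R * eta).
Proof.
move=> c0 d0 eta0; exists (c / eta + d).
  by rewrite ltr_wpDl// divr_ge0// ltW.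
move=> n; apply: (@le_trans _ _ ((c / eta + d) * (1 + n%:R * eta))).
  rewrite mulrDr mulr1 mulrDl (mulrC n%:R) !mulrA divfK ?gt_eqF//.
  have : 0 <= c / eta by rewrite divr_ge0// ltW.
  have : 0 <= d * eta * n%:R by rewrite !mulr_ge0// ltW.
  by set z := d * eta * _; lra.
have h0 : 0 <= c / eta + d by rewrite addr_ge0 ?divr_ge0// ltW.
by rewrite (ler_wpM2l h0)// expR_ge1Dx.
Qed.

(** Along one ultrafilter all bounded sequences converge at once, so that no subsequence has to be
    extracted. *)
Lemma ultra_limit (U : set_system nat) (v : nat -> R) (lo hi : R) :
  UltraFilter U -> (forall j, lo <= v j <= hi) ->
  exists2 l, lo <= l <= hi & forall e, 0 < e -> U [set j | `|v j - l| < e].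
Proof.
move=> UU vb.
have PU := @ultra_proper _ U UU.
have PF : ProperFilter (v @ U) := fmap_proper_filter v PU.
have hv : (v @ U) `[lo, hi]%classic.
  apply: (@filterS _ U _ setT) => [j _ /=|]; [rewrite in_itv/=; exact: vb|exact: filterT].
have [l [/= lI cl]] := @segment_compact R lo hi (v @ U) PF hv.
exists l; first by move: lI; rewrite in_itv/=.
move=> e e0; have [//|h] := in_ultra_setVsetC [set j | `|v j - l| < e] UU.
exfalso; have [||x []] := cl [set x | ~ `|x - l| < e] (ball l e).
- exact: (@filterS _ U _ _ _ _ h).
- exact: nbhsx_ballx.
- by rewrite /ball/= distrC.
Qed.

Lemma nat_ultra : exists2 U : set_system nat, UltraFilter U &
  forall n, U [set j | (n <= j)%N].
Proof.
have [U [UU oU]] := @ultraFilterLemma nat \oo _.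
by exists U => // n; apply: oU; exists n.
Qed.

End ExpLemmas.

Section LapGrowth.
Context {R : realType}.
Variable a : R.
Hypotheses (a0 : 0 < a) (a2 : a <= 2).
Local Notation q := (quad a).
Local Notation u := (left_fix a).
Local Notation lapc := (lapc a).
Local Notation ell := (ell a).

(* Up to bounded factors, [ell n] is the number of laps of the n-th iterate. *)
Definition lap_rate : R := inf [set ln (ell n.+1)%:R / n.+1%:R | n in [set: nat]].
Local Notation b := lap_rate.

Lemma ell_gt0 n : 0 < (ell n)%:R :> R. Proof. by rewrite ltr0n. Qed.

Lemma ell_le n m : (n <= m)%N -> (ell n <= ell m)%N.
Proof.
move=> nm; rewrite -(subnK nm) addnC; elim: (m - n)%N => [|k IH]; first by rewrite addn0.
by rewrite addnS ellS (leq_trans IH)// leq_addr.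
Qed.

Lemma lap_rate_set_ge0 (x : R) : [set ln (ell n.+1)%:R / n.+1%:R | n in [set: nat]] x -> 0 <= x.
Proof. by move=> [n _ <-]; rewrite divr_ge0// ln_ge0// ler1n. Qed.

Lemma lap_rate_ge0 : 0 <= b.
Proof.
apply: lb_le_inf; first by exists (ln (ell 1)%:R / 1%:R); exists 0%N.
exact: lap_rate_set_ge0.
Qed.

Lemma ell_ge n : expR (n%:R * b) <= (ell n)%:R.
Proof.
case: n => [|n]; first by rewrite mul0r expR0 ler1n.
rewrite -[leRHS]lnK ?posrE ?ell_gt0// ler_expR mulrC -ler_pdivlMr//.
apply: ge_inf; last by exists n.
by exists 0 => x; exact: lap_rate_set_ge0.
Qed.

(** Fekete's argument: [ell] is submultiplicative, N' almost attains the infimum, and n is divided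
    by N' with remainder. *)
Lemma ell_upper eta : 0 < eta ->
  exists2 A : R, 0 < A & forall n, (ell n)%:R <= A * expR (n%:R * (b + eta)).
Proof.
move=> eta0.
have [|_ [N _ <-] hN] := @inf_adherent R [set ln (ell n.+1)%:R / n.+1%:R | n in [set: nat]] eta eta0.
  split; first by exists (ln (ell 1)%:R / 1%:R); exists 0%N.
  by exists 0 => x; exact: lap_rate_set_ge0.
rewrite -/b in hN; set N' := N.+1 in hN.
have hb : 0 <= b + eta by rewrite addr_ge0 ?lap_rate_ge0 ?ltW.
exists (ell N')%:R => [|n]; first exact: ell_gt0.
have h1 k : (ell (k * N'))%:R <= expR (k%:R * (N'%:R * (b + eta))).
  elim: k => [|k IH]; first by rewrite mul0n mul0r expR0 /ell big_ord0.
  rewrite mulSn -addn1 natrD mulrDl mul1r expRD mulrC.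
  apply: (@le_trans _ _ ((ell N')%:R * (ell (k * N'))%:R)).
    by rewrite -natrM ler_nat; exact: ellD.
  apply: ler_pM => //; rewrite -[leLHS]lnK ?posrE ?ell_gt0// ler_expR mulrC -ler_pdivrMr//.
  exact: ltW.
rewrite {1}(divn_eq n N'); apply: (@le_trans _ _ ((ell (n %/ N' * N'))%:R * (ell (n %% N'))%:R)).
  by rewrite -natrM ler_nat; exact: ellD.
rewrite mulrC; apply: ler_pM => //.
  by rewrite ler_nat; apply: ell_le; rewrite ltnW// ltn_mod.
apply: le_trans (h1 _) _; rewrite ler_expR mulrA -natrM ler_wpM2r// ler_nat.
exact: leq_trunc_div.
Qed.

(** Between points with a common itinerary the iterates are monotone, so only linearly many of them
    are separated; there are at most [ell n] itineraries. Each factor takes half of eta. *)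
Lemma quad_entropy_le : (quad_entropy a <= b%:E)%E.
Proof.
have u1 := left_fix_leN1 a0 a2.
apply: htop_le => e eta e0 eta0.
have [A A0 hA] := @ell_upper (eta / 2) ltac:(lra).
have [|||B B0 hB] := @affine_expR R ((1 - u) / e) 2 (eta / 2).
- by rewrite divr_ge0//; lra.
- by [].
- lra.
exists (A * B); first exact: mulr_gt0.
move=> n E uE EK sep.
pose c2 := (Num.truncn (n%:R * (1 - u) / e)).+2.
pose rel (x y : R) := exists2 k, (k < n)%N & e <= `|iter k q x - iter k q y|.
have h2 : 0 <= n%:R * (1 - u) / e by rewrite divr_ge0 ?mulr_ge0//; lra.
have H2 v : at_most rel (fun x => (u <= x <= 1) /\ itin a n x = v) c2.
  move=> E' uE' E'v sep'.
  have /= := @monotone_count R _ (fun x => (u <= x <= 1) /\ itin a n x = v) id n e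
     (fun k x => iter k q x) (fun => 1 - u) E' _ uE' E'v sep' _ _.
  rewrite sumr_const card_ord => h.
  have {}h : (size E').-1%:R * e <= (1 - u) *+ n.
    apply: h.
    + by move=> k _; lra.
    + move=> k x y z kn [hx ix] [hy iy] [hz iz] xy yz.
      by apply: (itin_btw a0 (n := n)) => //; [rewrite ix iz|rewrite /btw xy yz|exact: ltnW].
    + move=> k x y kn [hx _] [hy _].
      have := iter_quad_itv a0 a2 k hx; have := iter_quad_itv a0 a2 k hy.
      by rewrite ler_norml => /andP[? ?] /andP[? ?]; apply/andP; split; lra.
  have : (size E').-1%:R < (Num.truncn (n%:R * (1 - u) / e)).+1%:R :> R.
    apply: le_lt_trans (truncnS_gt _); rewrite ler_pdivlMr//.
    by rewrite (le_trans h)// mulrC mulr_natr.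
  by rewrite ltr_nat /c2; case: (size E') => //= m; exact: leqW.
have sE : (size E <= ell n * c2)%N.
  apply: (at_most_fiber (@itin_count _ _ a0 a2 n) H2 uE).
    by move=> x xE; have := EK x xE; rewrite /= in_itv.
  move=> x y xE yE xy _; have [k kn hk] := sep x y xE yE xy.
  by exists k => //; move: hk; rewrite mdist_regular => /ltW.
apply: (@le_trans _ _ ((ell n)%:R * c2%:R)); first by rewrite -natrM ler_nat.
have -> : n%:R * (b + eta) = n%:R * (b + eta / 2) + n%:R * (eta / 2).
  by rewrite -mulrDr; congr (_ * _); rewrite -addrA -splitr.
rewrite expRD mulrACA; apply: ler_pM; [by []|by []|exact: hA|].
apply: (le_trans _ (hB n)).
rewrite /c2 -addn2 natrD lerD2r.
have -> : (1 - u) / e * n%:R = n%:R * (1 - u) / e by rewrite mulrC mulrA.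
by rewrite truncn_le.
Qed.

Local Notation beta := (expR b).

(** The weight is the critical one: for b > 0 the series diverges at 1, and the semiconjugacy is a
    limit of the quotients [lap_sum n x / lap_sum n 1]. *)
Definition lap_sum (n : nat) (x : R) : R := \sum_(k < n) beta ^- k * (lapc k x)%:~R.
Local Notation D n := (lap_sum n 1).

Lemma one_itv : u <= (1 : R) <= 1.
Proof. by rewrite lexx andbT; have := left_fix_leN1 a0 a2; lra. Qed.

Lemma lap_term_ge0 k x : u <= x <= 1 -> 0 <= beta ^- k * (lapc k x)%:~R.
Proof.
by move=> hx; rewrite mulr_ge0 ?invr_ge0 ?exprn_ge0 ?expR_ge0// ler0z lapc_ge0.
Qed.

Lemma lap_sumS n x : lap_sum n.+1 x = lap_sum n x + beta ^- n * (lapc n x)%:~R.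
Proof. by rewrite /lap_sum big_ord_recr. Qed.

Lemma lap_sum_le n m x : (n <= m)%N -> u <= x <= 1 -> lap_sum n x <= lap_sum m x.
Proof.
move=> nm hx; rewrite -(subnK nm) addnC; elim: (m - n)%N => [|k IH]; first by rewrite addn0.
by rewrite addnS lap_sumS (le_trans IH)// lerDl lap_term_ge0.
Qed.

Lemma lap_sum_ge1 n : 1 <= D n.+1.
Proof.
apply: (@le_trans _ _ (D 1)); last by apply: lap_sum_le => //; exact: one_itv.
by rewrite /lap_sum big_ord1 expr0 invr1 mul1r /= ltr01.
Qed.

Hypothesis b_gt0 : 0 < b.

(** If the sums were bounded, their tail after some K would be at most 1/2, whence [ell (K + m) <=
    ell K + beta ^+ (K + m) / 2]. By [ell_ge] then [beta ^+ (K + m)] is at most twice [ell K] for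
    all m, which b > 0 forbids. *)
Lemma lap_sum_unbounded (B : R) : exists n, B < D n.
Proof.
apply: contrapT => nB.
have DB n : D n <= B by rewrite leNgt; apply/negP => h; apply: nB; exists n.
have hs : has_sup [set D n | n in [set: nat]].
  split; first by exists (D 0); exists 0%N.
  by exists B => _ [n _ <-].
have [_ [K _ <-] hK] := @sup_adherent R [set D n | n in [set: nat]] (2^-1) ltac:(lra) hs.
have hKn n : D n <= D K + 2^-1.
  have : D n <= sup [set D n | n in [set: nat]] by apply: ub_le_sup; [exact: (proj2 hs)|exists n].
  lra.
have key m : (ell (K + m))%:R <= (ell K)%:R + beta ^+ (K + m) * (D (K + m) - D K).
  elim: m => [|m IH]; first by rewrite addn0 subrr mulr0 addr0.
  rewrite addnS ellS natrD lap_sumS.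
  have d0 : 0 <= lapc (K + m) 1 by apply: lapc_ge0 => //; exact: one_itv.
  have e : (`|lapc (K + m) 1%R|%N)%:R = beta ^+ (K + m) * (beta ^- (K + m) * (lapc (K + m) 1)%:~R) :> R.
    rewrite mulrA mulfV ?expf_neq0 ?gt_eqF ?expR_gt0// mul1r.
    by rewrite -[in RHS](gez0_abs d0).
  rewrite e; set t := beta ^- _ * _ in e *; set p := beta ^+ (K + m) in IH e *.
  have -> : beta ^+ (K + m).+1 = beta * p by rewrite exprS.
  have b1 : 1 <= beta by rewrite -expR0 ler_expR ltW.
  have p0 : 0 <= p by rewrite exprn_ge0 ?expR_ge0.
  have t0 : 0 <= t by apply: lap_term_ge0; exact: one_itv.
  have DD : 0 <= D (K + m) - D K by rewrite subr_ge0 lap_sum_le ?leq_addr//; exact: one_itv.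
  have : p * (D (K + m) + t - D K) <= beta * p * (D (K + m) + t - D K).
    apply: ler_wpM2r; first by lra.
    by rewrite ler_peMl.
  lra.
have {}key m : (K + m)%:R * b <= 2 * (ell K)%:R.
  have h1 := ell_ge (K + m); have h2 := key m; have h3 := hKn (K + m)%N.
  have h4 := expR_ge1Dx ((K + m)%:R * b).
  have e : expR ((K + m)%:R * b) = beta ^+ (K + m) by rewrite -expRM_natl mulr_natl.
  have p0 : 0 <= beta ^+ (K + m) by rewrite exprn_ge0 ?expR_ge0.
  have : beta ^+ (K + m) * (D (K + m) - D K) <= beta ^+ (K + m) * 2^-1.
    by apply: ler_wpM2l => //; lra.
  by move: h1 h2 h4; rewrite e; lra.
have := key (Num.truncn (2 * (ell K)%:R / b)).+1.
apply/negP; rewrite -ltNge -ltr_pdivrMr//.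
by apply: lt_le_trans (truncnS_gt _) _; rewrite ler_nat leq_addl.
Qed.

(** The last term of the sum is an error in its functional equation. If it always exceeded the
    fraction c of the sum, the sums would grow like (1 + c)^n, and [lapc n 1] faster than
    [ell_upper] permits. *)
Lemma lap_sum_ratio (c : R) (n0 : nat) : 0 < c ->
  exists2 n, (n0 <= n)%N & beta ^- n * (lapc n 1)%:~R <= c * D n.
Proof.
move=> c0; apply: contrapT => h.
have {}h n : (n0 <= n)%N -> c * D n < beta ^- n * (lapc n 1)%:~R.
  by move=> nn; rewrite ltNge; apply/negP => hn; apply: h; exists n.
pose n1 := n0.+1; pose g := ln (1 + c).
have g0 : 0 < g by apply: ln_gt0; lra.
have Dg m : expR (m%:R * g) <= D (n1 + m).
  elim: m => [|m IH]; first by rewrite addn0 mul0r expR0 lap_sum_ge1.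
  have := h (n1 + m)%N ltac:(rewrite /n1; lia).
  rewrite addnS lap_sumS -addn1 natrD mulrDl mul1r expRD lnK ?posrE; last by lra.
  by nra.
have [A A0 hA] := @ell_upper (g / 2) ltac:(lra).
have [B B0 hB] := @affine_expR R 1 1 (g / 2) ler01 ltr01 ltac:(lra).
pose C := A * expR (b + g / 2) * expR (n1%:R * (g / 2)) / c.
have key m : expR (m%:R * (g / 2)) <= C.
  have h1 := Dg m; have h2 := h (n1 + m)%N ltac:(rewrite /n1; lia).
  have h3 := hA (n1 + m).+1.
  have h4 : (lapc (n1 + m) 1)%:~R <= (ell (n1 + m).+1)%:R :> R.
    by rewrite ellS pmulrn ler_int PoszD -[leLHS]add0r lerD// abszE ler_norm.
  have {h4}h5 : beta ^- (n1 + m) * (lapc (n1 + m) 1)%:~R <=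
      beta ^- (n1 + m) * (A * expR ((n1 + m).+1%:R * (b + g / 2))).
    by apply: ler_wpM2l; [rewrite invr_ge0 exprn_ge0 ?expR_ge0|exact: le_trans h4 h3].
  have e1 : beta ^- (n1 + m) * (A * expR ((n1 + m).+1%:R * (b + g / 2))) =
     A * expR (b + g / 2) * expR (n1%:R * (g / 2)) * expR (m%:R * (g / 2)).
    rewrite -expRM_natl -expRN mulrCA -!mulrA -!expRD; congr (_ * expR _).
    by rewrite -addn1 !natrD; ring.
  have e2 : expR (m%:R * g) = expR (m%:R * (g / 2)) * expR (m%:R * (g / 2)).
    by rewrite -expRD -mulrDr -splitr.
  rewrite /C ler_pdivlMr//.
  have E0 : 0 < expR (m%:R * (g / 2)) by exact: expR_gt0.
  rewrite -(ler_pM2r E0) -e1; apply: (le_trans _ h5); apply: (le_trans _ (ltW h2)).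
  by rewrite -mulrA mulrCA -e2 ler_pM2l.
have := key (Num.truncn (C / (g / 2))).+1.
apply/negP; rewrite -ltNge; apply: lt_le_trans (expR_ge1Dx _).
rewrite -[ltLHS]add0r ltr_leD// -ler_pdivrMr; last by lra.
by apply: ltW; exact: truncnS_gt.
Qed.
End LapGrowth.

Lemma heine (R : realType) (f : R -> R) (lo hi : R) :
  (forall x e, lo <= x <= hi -> 0 < e -> exists2 d, 0 < d &
    forall y, lo <= y <= hi -> `|y - x| < d -> `|f y - f x| < e) ->
  forall e, 0 < e -> exists2 d, 0 < d & forall x y, lo <= x <= hi -> lo <= y <= hi ->
    `|x - y| < d -> `|f x - f y| < e.
Proof.
move=> fc e e0; apply: contrapT => nh.
have /choice[p hp] : forall j : nat, exists p : R * R, [/\ lo <= p.1 <= hi, lo <= p.2 <= hi,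
    `|p.1 - p.2| < j.+1%:R^-1 & e <= `|f p.1 - f p.2|].
  move=> j; apply: contrapT => nj; apply: nh; exists j.+1%:R^-1; first by rewrite invr_gt0.
  by move=> x y hx hy xy; rewrite ltNge; apply/negP => he; apply: nj; exists (x, y).
have [U UU Uoo] := nat_ultra.
have [l hl Ul] := @ultra_limit R U (fun j => (p j).1) lo hi UU (fun j => let: And4 h _ _ _ := hp j in h).
have e20 : 0 < e / 2 by rewrite divr_gt0.
have [d d0 hd] := fc l (e / 2) hl e20.
have d20 : 0 < d / 2 by rewrite divr_gt0.
have [n nd] : exists n : nat, n.+1%:R^-1 < d / 2.
  exists (Num.truncn (d / 2)^-1); rewrite invf_plt ?posrE ?divr_gt0//; exact: truncnS_gt.
have PU := @ultra_proper _ U UU.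
have [j [/= h1 h2]] := filter_ex (filterI (Ul (d / 2) d20) (Uoo n)).
have [p1 p2 p12 pe] := hp j.
have jd : j.+1%:R^-1 <= n.+1%:R^-1 :> R by rewrite lef_pV2 ?posrE// ler_nat ltnS.
have p12' : `|(p j).1 - (p j).2| < d / 2 by apply: (lt_trans p12); exact: le_lt_trans jd nd.
have q1 : `|(p j).1 - l| < d by lra.
have q2 : `|(p j).2 - l| < d.
  by have := ler_distD (p j).1 (p j).2 l; rewrite (distrC (p j).2 (p j).1); lra.
have r1 := hd _ p1 q1; have r2 := hd _ p2 q2.
have := ler_distD (f l) (f (p j).1) (f (p j).2).
rewrite (distrC (f l)); lra.
Qed.

(** * Tent maps and the semiconjugacy *)

Section Tent.
Context {R : realType}.
Variable be : R.
Hypothesis be1 : 1 < be.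

(** Normalised with fixed point 0, maximum 1 and turning point 1/be, which will be the images of the
    points u, 1 and 0 of the quadratic map. *)
Definition tent (z : R) : R := 1 - be * `|z - be^-1|.
Local Notation T := tent.
Local Notation gam := (be^-1).

Lemma tent_gt0 : 0 < be. Proof. by apply: lt_trans be1. Qed.

Lemma tent_dist x y : `|T x - T y| <= be * `|x - y|.
Proof.
rewrite /tent opprB addrC addrA subrK -mulrBr normrM gtr0_norm ?tent_gt0//.
rewrite ler_pM2l ?tent_gt0//; apply: le_trans (ler_dist_dist _ _) _.
by rewrite distrC opprB addrA subrK.
Qed.

Lemma iter_tent_dist n x y : `|iter n T x - iter n T y| <= be ^+ n * `|x - y|.
Proof.
elim: n => [|n IH]; first by rewrite expr0 mul1r.
rewrite !iterS exprS -mulrA; apply: le_trans (tent_dist _ _) _.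
by rewrite ler_pM2l ?tent_gt0.
Qed.

Lemma tent_side x y : (x <= gam) = (y <= gam) -> `|T x - T y| = be * `|x - y|.
Proof.
move=> xy; rewrite /tent opprB addrC addrA subrK -mulrBr normrM gtr0_norm ?tent_gt0//.
congr (_ * _); case: (lerP x gam) xy => hx; case: (lerP y gam) => hy // _.
  by congr `|_|; ring.
by rewrite distrC; congr `|_|; ring.
Qed.

(* Near the turning point the iterates of the tent map are folded once and then
   affine, so that two returns in a short time cannot fold twice. *)
Lemma tent_local (K : nat) : exists2 r : R, 0 < r & forall i, (0 < i <= K)%N ->
  exists2 s : R, `|s| = 1 & forall z, `|z - gam| < r ->
    iter i T z = iter i T gam + s * (be ^+ i * `|z - gam|).
Proof.
have b0 := tent_gt0; elim: K => [|K [r r0 IH]].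
  by exists 1 => // i hi; exfalso; lia.
case: K IH => [|K] IH.
  exists r => // i; have [->|i1] := eqVneq i 1%N; last by lia.
  move=> _; exists (-1); first by rewrite normrN normr1.
  by move=> z _; rewrite /= /tent subrr normr0 mulr0 subr0 expr1 mulN1r.
have [s s1 hs] := IH K.+1 ltac:(lia).
set t := iter K.+1 T gam in hs.
have [tg|tg] := eqVneq t gam.
  exists r => // i /andP[i0]; rewrite leq_eqVlt => /orP[/eqP ->|iK]; last by apply: IH; lia.
  exists (-1); first by rewrite normrN normr1.
  move=> z zr; rewrite [in LHS]iterS [in RHS]iterS hs// -/t tg /tent.
  have -> : gam + s * (be ^+ K.+1 * `|z - gam|) - gam = s * (be ^+ K.+1 * `|z - gam|) by ring.
  rewrite subrr normr0 mulr0 subr0 normrM s1 mul1r ger0_norm; last first.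
    by rewrite mulr_ge0// exprn_ge0// ltW.
  by rewrite [in RHS]exprS mulN1r mulrA.
pose r' := Num.min r (`|t - gam| / be ^+ K.+1).
have bK : 0 < be ^+ K.+1 by rewrite exprn_gt0.
exists r'; first by rewrite lt_min r0 divr_gt0// normr_gt0 subr_eq0.
move=> i /andP[i0]; rewrite leq_eqVlt => /orP[/eqP ->|iK]; last first.
  have [s' s1' hs'] := IH i ltac:(lia); exists s' => // z.
  by rewrite lt_min => /andP[zr _]; apply: hs'.
exists (- (Num.sg (t - gam)) * s).
  by rewrite normrM s1 mulr1 normrN normr_sg subr_eq0 tg.
move=> z; rewrite lt_min => /andP[zr zt]; rewrite [in LHS]iterS [in RHS]iterS hs// -/t.
set y := be ^+ K.+1 * `|z - gam|.
have y0 : 0 <= y by rewrite mulr_ge0// ltW.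
have yt : y < `|t - gam| by rewrite /y mulrC -ltr_pdivlMr.
have -> : be ^+ K.+2 * `|z - gam| = be * y by rewrite exprS mulrA.
have sy : `|s * y| < `|t - gam| by rewrite normrM s1 mul1r ger0_norm.
rewrite /tent; have [tl|tl|/eqP] := ltgtP t gam; last by rewrite (negPf tg).
  rewrite ltr0_sg ?subr_lt0//; move: sy; rewrite ltr_norml (ltr0_norm (x := t - gam)) ?subr_lt0//.
  by move=> /andP[h1 h2]; rewrite ltr0_norm; [ring|lra].
rewrite gtr0_sg ?subr_gt0//; move: sy; rewrite ltr_norml (gtr0_norm (x := t - gam)) ?subr_gt0//.
by move=> /andP[h1 h2]; rewrite gtr0_norm; [ring|lra].
Qed.

(** The side of w at the first time below K when z passes within e of the turning point. Without
    such a time [find] returns K, and the code is just one of the same three values. *)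
Definition side_code (K : nat) (e z w : R) : nat :=
  let v := iter (find (fun k => `|iter k T z - gam| <= e) (iota 0 K)) T w in
  if v < gam then 0%N else if v == gam then 1%N else 2%N.

(** Before z comes near the turning point, w and w' are on the side of z. Afterwards [tent_local]
    expresses their iterates by their distance to the turning point alone: if the turning point is
    not back, both are on the side of its orbit; if it is exactly back, the sign s decides for both.
    One code per block is enough. *)
Lemma side_code_block (K : nat) : exists2 e : R, 0 < e & forall z w w',
  (forall k, (k < K)%N -> `|iter k T w - iter k T z| <= e) ->
  (forall k, (k < K)%N -> `|iter k T w' - iter k T z| <= e) ->
  side_code K e z w = side_code K e z w' ->
  forall k, (k < K)%N -> (iter k T w <= gam) = (iter k T w' <= gam).
Proof.
have b0 := tent_gt0; have [r r0 hr] := tent_local K.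
(* Within 2 * e1 of the turning point, a point follows its orbit closely enough to be on the same
   side at each time j < K when that orbit is not at gam. *)
have [e1 e10 he1] : exists2 e1 : R, 0 < e1 & forall j, (j < K)%N -> iter j T gam <> gam ->
    2 * e1 * be ^+ j < `|iter j T gam - gam|.
  elim: (K) => [|k [e1 e10 he1]]; first by exists 1.
  have [h|h] := eqVneq (iter k T gam) gam.
    exists e1 => // j; rewrite ltnS leq_eqVlt => /orP[/eqP -> //|]; exact: he1.
  have bk : 0 < be ^+ k by rewrite exprn_gt0.
  pose e2 := `|iter k T gam - gam| / be ^+ k / 4.
  have e20 : 0 < e2 by rewrite !divr_gt0// normr_gt0 subr_eq0.
  exists (Num.min e1 e2); first by rewrite lt_min e10.
  move=> j; rewrite ltnS leq_eqVlt => /orP[/eqP -> _|jk hj].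
    have e2k : e2 * be ^+ k = `|iter k T gam - gam| / 4.
      by rewrite /e2 mulrAC divfK ?gt_eqF.
    have : 2 * Num.min e1 e2 * be ^+ k <= 2 * e2 * be ^+ k.
      by rewrite ler_pM2r// ler_pM2l// ge_min lexx orbT.
    rewrite -(mulrA 2 e2) e2k => h1; apply: (le_lt_trans h1).
    have : 0 < `|iter k T gam - gam| by rewrite normr_gt0 subr_eq0.
    lra.
  apply: le_lt_trans (he1 j jk hj); rewrite ler_pM2r ?exprn_gt0// ler_pM2l//.
  by rewrite ge_min lexx.
pose e := Num.min e1 (r / 3); have e0 : 0 < e by rewrite lt_min e10 divr_gt0.
have ee1 : e <= e1 by rewrite ge_min lexx.
have er : 2 * e < r.
  have : e <= r / 3 by rewrite ge_min lexx orbT.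
  lra.
exists e => // z w w' hw hw' + k kK.
rewrite /side_code; set k0 := find _ _ => hc.
have near j x : (j < K)%N -> (forall k, (k < K)%N -> `|iter k T x - iter k T z| <= e) ->
    e < `|iter j T z - gam| -> (iter j T x <= gam) = (iter j T z <= gam).
  move=> jK /(_ j jK); rewrite ler_norml => /andP[x1 x2].
  have [zl|zl] := lerP (iter j T z) gam.
    by move=> ?; apply/idP; lra.
  by move=> ?; apply/negbTE; rewrite -ltNge; lra.
have k0P j : (j < k0)%N -> (j < K)%N -> e < `|iter j T z - gam|.
  move=> jk jK; have := before_find 0%N jk; rewrite nth_iota// add0n.
  by rewrite ltNge => ->.
have [kk|kk] := ltnP k k0; first by rewrite !near// k0P.
have k0K : (k0 < K)%N by apply: leq_ltn_trans kk kK.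
have zk0 : `|iter k0 T z - gam| <= e.
  have : has (fun k => `|iter k T z - gam| <= e) (iota 0 K) by rewrite has_find size_iota.
  by move=> /(nth_find 0%N); rewrite -/k0 nth_iota// add0n.
have cl x : (forall k, (k < K)%N -> `|iter k T x - iter k T z| <= e) -> `|iter k0 T x - gam| <= 2 * e.
  by move=> /(_ k0 k0K) hx; have := ler_distD (iter k0 T z) (iter k0 T x) gam; lra.
have {}cl0 := cl w hw; have {cl}cl0' := cl w' hw'.
have ck : ((iter k0 T w < gam) = (iter k0 T w' < gam)) * ((iter k0 T w == gam) = (iter k0 T w' == gam)).
  move: hc; case: (ltgtP (iter k0 T w) gam) => // h1; case: (ltgtP (iter k0 T w') gam) => // h2;
  by rewrite ?h1 ?h2 ?eqxx ?ltxx ?(lt_eqF h1) ?(lt_eqF h2) ?(gt_eqF h1) ?(gt_eqF h2).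
have [j jk] : exists j, k = (j + k0)%N by exists (k - k0)%N; rewrite subnK.
subst k; rewrite !iterD; case: j kK kk => [|j] jK _; first by rewrite !le_eqVlt !ck.
have jK' : (0 < j.+1 <= K)%N by rewrite (leq_trans _ (ltnW jK))// leq_addr.
have [s s1 hs] := hr j.+1 jK'.
have jb : 0 < be ^+ j.+1 by rewrite exprn_gt0.
have c1 := le_lt_trans cl0 er; have c1' := le_lt_trans cl0' er.
rewrite (hs _ c1) (hs _ c1') => {hs hr near k0P hw hw' hc}.
have [tg|/eqP tg] := eqVneq (iter j.+1 T gam) gam; last first.
  have hj := he1 j.+1 (leq_ltn_trans (leq_addr k0 j.+1) jK) tg.
  have E (x : R) : `|x| <= 2 * e -> `|s * (be ^+ j.+1 * `|x|)| < `|iter j.+1 T gam - gam|.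
    move=> xe; rewrite !normrM s1 mul1r normr_id (gtr0_norm jb); apply: le_lt_trans hj.
    by rewrite mulrC ler_pM2r//; lra.
  have := E _ cl0; have := E _ cl0'.
  set A := s * _; set B := s * _; set C := iter _ _ _.
  rewrite !ltr_norml; have [hC|hC] := lerP C gam.
    by move=> /andP[? ?] /andP[? ?]; apply/idP/idP => _; lra.
  by move=> /andP[? ?] /andP[? ?]; apply/idP/idP => ?; exfalso; lra.
rewrite tg; have [s1'|s1'] : s = 1 \/ s = -1.
    by case: (lerP 0 s) s1 => s0; [rewrite ger0_norm//; left|rewrite ltr0_norm// => h; right; lra].
  rewrite s1' !mul1r !gerDl !pmulr_rle0// !normr_le0 !subr_eq0; exact: ck.2.
by rewrite s1' !mulN1r !gerBl !pmulr_rge0// !normr_ge0.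
Qed.

(** In a small ball of the orbit distance the sequences of sides grow at rate ln 3 / K only, and K
    is arbitrary: the tent map has no local entropy. *)
Lemma side_count (K : nat) : exists2 e : R, 0 < e & forall m z,
  at_most (fun w w' => exists2 k, (k < K * m)%N & (iter k T w <= gam) <> (iter k T w' <= gam))
    (fun w => forall k, (k < K * m)%N -> `|iter k T w - iter k T z| <= e) (3 ^ m).
Proof.
have [e e0 he] := side_code_block K; exists e => // m z.
elim: m => [|m IH].
  rewrite muln0 expn0 => -[//|x [//|y E]] /= /andP[xyE _] _ /(_ x y).
  rewrite !inE !eqxx orbT => /(_ erefl erefl).
  have -> : x != y by apply: contraNN xyE => /eqP ->; rewrite mem_head.
  by case.
pose P m := fun w => forall k, (k < K * m)%N -> `|iter k T w - iter k T z| <= e.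
pose f w := side_code K e (iter (K * m) T z) (iter (K * m) T w).
rewrite expnS; have := @at_most_fiber _ _ f (fun w w' =>
  exists2 k, (k < K * m)%N & (iter k T w <= gam) <> (iter k T w' <= gam)) (P m.+1) 3 (3 ^ m).
move=> H; apply: at_mostW (H _ _) _ _ _ => //.
- move=> E uE EP; refine (@at_most_image _ _ f E [:: 0%N; 1%N; 2%N] _ E uE (fun _ h => h)) => x _.
  by rewrite /f /side_code; case: ifP => // _; case: ifP.
- move=> v; apply: at_mostW IH _ _ _ => // x [h _] k km; apply: h.
  by apply: leq_trans km _; rewrite leq_mul2l leqnSn orbT.
- move=> x y Px Py _ [k km hk] fxy; have [kk|kk] := ltnP k (K * m); first by exists k.
  exfalso; apply: hk; have := he _ _ _ _ _ fxy (k - K * m)%N.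
  have hh j w : P m.+1 w -> (j < K)%N ->
      `|iter j T (iter (K * m) T w) - iter j T (iter (K * m) T z)| <= e.
    by move=> Pw jK; rewrite -!iterD; apply: Pw; rewrite mulnS ltn_add2r.
  rewrite -!iterD subnK//; apply; try by move=> j jK; apply: hh.
  by move: km; rewrite mulnS; lia.
Qed.

End Tent.

Lemma natr_dist_ge1 (R : realType) (i j : nat) : i != j -> 1 <= `|i%:R - j%:R| :> R.
Proof. by move=> ij; rewrite !pmulrn -intrB -intr_norm ler1z; move: ij; lia. Qed.

Lemma dist01 (R : realType) (x y : R) : 0 <= x <= 1 -> 0 <= y <= 1 -> `|x - y| <= 1.
Proof. by move=> /andP[? ?] /andP[? ?]; rewrite ler_norml; apply/andP; split; lra. Qed.

Section TentFactor.
Context {R : realType}.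
Variable be : R.
Hypothesis be1 : 1 < be.
Local Notation T := (tent be).
Local Notation gam := (be^-1).

Lemma iter_tent_side n x y :
  (forall k, (k < n)%N -> (iter k T x <= gam) = (iter k T y <= gam)) ->
  `|iter n T x - iter n T y| = be ^+ n * `|x - y|.
Proof.
elim: n => [|n IH] h; first by rewrite expr0 mul1r.
rewrite !iterS (tent_side be1) ?h// IH ?mulrA ?exprS// => k kn.
by apply: h; exact: ltnW.
Qed.

Context {Y : metricType R}.
Variables (f : Y -> Y) (K : set Y) (Phi : Y -> R) (r : nat) (z0 z1 : R).
Hypotheses (z01 : z0 < z1) (fK : forall x, K x -> K (f x))
  (Phi01 : forall x, K x -> 0 <= Phi x <= 1)
  (Phif : forall x, K x -> Phi (f x) = iter r T (Phi x))
  (Phi_unif : forall eta, 0 < eta -> exists2 e, 0 < e &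
     forall x y, K x -> K y -> mdist x y <= e -> `|Phi x - Phi y| <= eta)
  (Phi_onto : forall z, z0 <= z <= z1 -> exists2 x, K x & Phi x = z).

Let fK_iter n x : K x -> K (iter n f x).
Proof. by move=> Kx; elim: n => //= n; exact: fK. Qed.

Let Phi_iter n x : K x -> Phi (iter n f x) = iter (r * n) T (Phi x).
Proof.
move=> Kx; elim: n => [|n IH]; first by rewrite muln0.
by rewrite iterS Phif ?IH ?mulnS ?iterD//; exact: fK_iter.
Qed.

(** Points with images 2 / be^N apart differ in side before time N, otherwise their images would end
    up 2 apart in [0, 1]. There are of order be^N of them, and at most 3^m in a ball of the orbit
    distance, so of order be^N / 3^m are separated. *)
Lemma htop_tent_factor : ((r%:R * ln be)%:E <= htop f K)%E.
Proof.
have b0 := tent_gt0 be1; apply: htop_ge => eta eta0.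
(* With blocks of K1 steps of f the loss 3^m is at most e^(n eta). *)
pose K1 := (Num.truncn (ln 3 / eta)).+1.
have K1eta : ln 3 <= eta * K1%:R.
  by rewrite mulrC -ler_pdivrMr// ltW// truncnS_gt.
have [es es0 hes] := side_count be1 (r * K1).
have br0 : 0 < be ^+ r by rewrite exprn_gt0.
(* One step of f is r steps of the tent map; the division by be^r controls the steps in between. *)
have [e e0 he] := Phi_unif (divr_gt0 es0 br0).
exists e, ((z1 - z0) / 2 / be ^+ (r * K1)); split=> //.
  by rewrite !divr_gt0 ?exprn_gt0// subr_gt0.
move=> n; pose m := (n %/ K1)%N; pose N := (r * K1 * m)%N.
have bN : 0 < be ^+ N by rewrite exprn_gt0.
have e2 : 0 < 2 / be ^+ N by rewrite divr_gt0.
have z2 : 0 < (z1 - z0) / 2 * be ^+ N by rewrite mulr_gt0// divr_gt0// subr_gt0.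
pose L := Num.truncn ((z1 - z0) / 2 * be ^+ N).
pose w (i : nat) := z0 + i%:R * (2 / be ^+ N).
have wP i : (i <= L)%N -> z0 <= w i <= z1.
  move=> iL; apply/andP; split; first by rewrite lerDl mulr_ge0// ltW.
  rewrite -lerBrDl mulrA ler_pdivrMr// -ler_pdivlMr// mulrAC.
  apply: (@le_trans _ _ L%:R); first by rewrite ler_nat.
  by rewrite truncn_le ltW.
have /choice[x xP] : forall i, exists x, (i <= L)%N -> K x /\ Phi x = w i.
  move=> i; have [iL|_] := leqP i L; last first.
    by have [x _ _] := Phi_onto (wP 0%N isT); exists x.
  by have [x Kx xw] := Phi_onto (wP i iL); exists x.
have winj i j : i != j -> 2 / be ^+ N <= `|w i - w j|.
  move=> ij; rewrite /w opprD addrACA subrr add0r -mulrBl normrM (gtr0_norm e2).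
  by rewrite ler_peMl ?(ltW e2)// natr_dist_ge1.
pose E := [seq x i | i <- iota 0 L.+1].
have EP y : y \in E -> exists i, [/\ (i <= L)%N, y = x i, K y & Phi y = w i].
  move=> /mapP[i]; rewrite mem_iota add0n ltnS => /andP[_ iL] ->.
  by have [? ?] := xP i iL; exists i.
pose rel y y' := exists2 k, (k < n)%N & e < mdist (iter k f y) (iter k f y').
have uE : uniq E.
  rewrite map_inj_in_uniq ?iota_uniq// => i j; rewrite !mem_iota !add0n !ltnS /= => iL jL xij.
  apply/eqP/negPn/negP => /winj; apply/negP; rewrite -ltNge.
  have [_ <-] := xP i iL; have [_ <-] := xP j jL; rewrite xij subrr normr0.
  by rewrite divr_gt0.
have [|//||S [uS SE Srel hS]] := @many_separated _ rel E (3 ^ m).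
- by move=> y y' [k kn h]; exists k => //; rewrite metric_sym.
- move=> y /EP[i [iL yx Ky yw]] E' uE' E'P _.
  have := hes m (Phi y) [seq Phi y' | y' <- E'].
  rewrite size_map; apply.
  + rewrite map_inj_in_uniq// => y1 y2 /E'P[/EP[i1 [_ -> _ w1]] _] /E'P[/EP[i2 [_ -> _ w2]] _].
    rewrite w1 w2 => h; have [-> //|/winj] := eqVneq i1 i2.
    by rewrite h subrr normr0 leNgt divr_gt0.
  + move=> _ /mapP[y' /E'P[/EP[i' [_ _ Ky' _]] hr] ->] k kN.
    case: (posnP r) => [r0|r_gt0]; first by move: kN; rewrite r0 !mul0n.
    pose j := (k %/ r)%N.
    have jm : (j < K1 * m)%N by rewrite ltn_divLR// mulnC mulnA.
    have jn : (j < n)%N by apply: (leq_trans jm); rewrite mulnC leq_trunc_div.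
    have ek v : iter k T v = iter (k %% r) T (iter (r * j) T v).
      by rewrite -iterD addnC mulnC -divn_eq.
    rewrite !ek -!Phi_iter//.
    apply: (le_trans (iter_tent_dist be1 _ _ _)).
    apply: (@le_trans _ _ (be ^+ r * (es / be ^+ r))); last first.
      by rewrite mulrC divfK ?gt_eqF.
    apply: ler_pM; [by rewrite exprn_ge0// ltW|by []| |].
      by rewrite ler_weXn2l ?(ltW be1)// ltnW// ltn_mod.
    apply: he; try exact: fK_iter.
    have [->|y'y] := eqVneq y' y; first by rewrite mdistxx ltW.
    by rewrite leNgt; apply/negP => h; apply: (hr y'y); exists j.
  + move=> _ _ /mapP[y1 y1E ->] /mapP[y2 y2E ->] h.
    have [/EP[i1 [_ y1x Ky1 w1]] _] := E'P _ y1E; have [/EP[i2 [_ y2x Ky2 w2]] _] := E'P _ y2E.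
    apply: contrapT => nh.
    have : `|iter N T (Phi y1) - iter N T (Phi y2)| = be ^+ N * `|Phi y1 - Phi y2|.
      apply: iter_tent_side => k kN; apply/eqP/negPn/negP => /eqP hk; apply: nh.
      by exists k.
    have eN : N = (r * (K1 * m))%N by rewrite /N mulnA.
    rewrite {1 2}eN -!Phi_iter// => he2.
    have := Phi01 (fK_iter (K1 * m) Ky1); have := Phi01 (fK_iter (K1 * m) Ky2).
    move=> h2 h1; have {h1 h2} := dist01 h1 h2.
    have : 2 <= be ^+ N * `|Phi y1 - Phi y2|.
      rewrite mulrC -ler_pdivrMr// w1 w2; apply: winj.
      by apply: contra_neq h => ii; rewrite w1 w2 ii.
    by rewrite -he2 => h2 /(le_trans h2); rewrite (ler_nat _ 2 1).
exists S; split=> //; first by move=> y /SE/EP[i []].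
have m3 : 3 ^+ m <= expR (n%:R * eta).
  rewrite -[leLHS]lnK ?posrE ?exprn_gt0// ler_expR lnXn// -(mulr_natl (ln 3)).
  apply: (@le_trans _ _ (m%:R * (eta * K1%:R))); first by rewrite ler_wpM2l.
  rewrite mulrCA mulrA (mulrC eta) -mulrA (mulrC eta) mulrA -natrM.
  rewrite ler_wpM2r ?(ltW eta0)// ler_nat; exact: leq_trunc_div.
have hL : (z1 - z0) / 2 * be ^+ N <= (size S)%:R * 3 ^+ m.
  apply: (@le_trans _ _ L.+1%:R); first by rewrite ltW// truncnS_gt.
  by rewrite -natrX -natrM ler_nat; move: hS; rewrite size_map size_iota.
have nN : expR (n%:R * (r%:R * ln be)) <= be ^+ N * be ^+ (r * K1).
  rewrite mulrA -natrM -exprD -[in leRHS](lnK (x := be)) ?posrE// -expRM_natl ler_expR.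
  apply: ler_wpM2r; first by rewrite ln_ge0// ltW.
  rewrite ler_nat /N -mulnA -mulnDr [leqLHS]mulnC leq_mul2l.
  by rewrite addnC -mulnS mulnC ltnW ?orbT// ltn_ceil.
rewrite mulrBr expRB mulrA ler_pdivrMr ?expR_gt0//.
apply: (@le_trans _ _ ((z1 - z0) / 2 * be ^+ N)).
  rewrite mulrAC ler_pdivrMr ?exprn_gt0// -[leRHS]mulrA ler_wpM2l// divr_ge0// subr_ge0 ltW//.
by apply: (le_trans hL); rewrite ler_wpM2l.
Qed.

End TentFactor.

Lemma ivt_unif (R : realType) (f : R -> R) (lo hi z : R) : lo <= hi ->
  (forall e, 0 < e -> exists2 d, 0 < d & forall x y, lo <= x <= hi -> lo <= y <= hi ->
    `|x - y| < d -> `|f x - f y| < e) ->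
  btw (f lo) z (f hi) -> exists2 x, lo <= x <= hi & f x = z.
Proof.
move=> lohi fc fz; have [||x hx xz] := @IVT R f lo hi z lohi.
- apply/subspace_continuousP => x; rewrite /= in_itv/= => hx.
  apply/cvgrPdist_lt => e e0; have [d d0 hd] := fc e e0.
  by exists d => //= y yx; rewrite /= in_itv/= => hy; apply: hd.
- by rewrite ge_min le_max; move: fz => /orP[/andP[-> ->]|/andP[-> ->]]; rewrite ?orbT.
- by exists x => //; move: hx; rewrite in_itv.
Qed.

Section Semiconjugacy.
Context {R : realType}.
Variable a : R.
Hypotheses (a0 : 0 < a) (a2 : a <= 2).
Local Notation q := (quad a).
Local Notation u := (left_fix a).
Local Notation b := (lap_rate a).
Hypothesis b0 : 0 < b.
Local Notation beta := (expR b).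

(** The equation of the tent map up to two errors, the last term of the sum and [lapc 0 x]; both
    become negligible after division by [lap_sum n 1]. *)
Lemma lap_sum_quad n x : u <= x <= 1 ->
  lap_sum a n (q x) = (if x <= 0 then 0 else lap_sum a n 1 *+ 2) +
    (if x <= 0 then beta else - beta) *
      (lap_sum a n x + beta ^- n * (lapc a n x)%:~R - (lapc a 0 x)%:~R).
Proof.
move=> hx; rewrite -lap_sumS.
have -> : lap_sum a n.+1 x - (lapc a 0 x)%:~R = \sum_(k < n) beta ^- k.+1 * (lapc a k.+1 x)%:~R.
  by rewrite /lap_sum big_ord_recl expr0 invr1 mul1r addrAC subrr add0r.
have e k : beta * (beta ^- k.+1 * (lapc a k.+1 x)%:~R) = beta ^- k * (lapc a k.+1 x)%:~R.
  by rewrite mulrA exprS invfM mulrA mulfV ?mul1r// gt_eqF// expR_gt0.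
rewrite /lap_sum; case: ifP => x0.
  rewrite add0r mulr_sumr; apply: eq_bigr => i _; rewrite e /=.
  by rewrite x0.
rewrite mulNr mulr_sumr -(mulr_natr _ 2) mulr_suml -sumrB; apply: eq_bigr => i _; rewrite e /= x0.
rewrite -mulrA -mulrBr; congr (_ * _).
by rewrite rmorphB rmorphMn/= mulr_natr opprB addrCA subrr addr0.
Qed.

Lemma semiconjugacy_pre : exists Lam : R -> R,
  [/\ forall x y, u <= x -> x <= y -> y <= 1 -> Lam x <= Lam y,
    Lam u = 0, Lam 1 = 1 &
    forall x, u <= x <= 1 ->
      (x <= 0 -> Lam (q x) = beta * Lam x) /\ (0 < x -> Lam (q x) = 2 - beta * Lam x)].
Proof.
have u1 := left_fix_leN1 a0 a2; have one := one_itv a0 a2.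
have fixi : u <= u <= 1 by rewrite lexx/=; lra.
have be0 : 0 < beta by exact: expR_gt0.
pose D n := lap_sum a n 1.
(* Along [N j] each error of [lap_sum_quad] is at most the fraction 1 / (j + 1) of D. *)
have /choice[N hN] : forall j : nat, exists n : nat,
    j.+1%:R <= D n /\ beta ^- n * (lapc a n 1)%:~R <= j.+1%:R^-1 * D n.
  move=> j; have [n0 h0] := lap_sum_unbounded a0 a2 b0 j.+1%:R.
  have [|n n0n hn] := @lap_sum_ratio _ _ a0 a2 b0 j.+1%:R^-1 n0; first by rewrite invr_gt0.
  exists n; split=> //; apply: (le_trans (ltW h0)); exact: lap_sum_le.
have D0 j : 0 < D (N j) by have [h _] := hN j; apply: lt_le_trans h.
have [U UU Uoo] := @nat_ultra.
pose v x j := lap_sum a (N j) x / D (N j).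
have vmono j x y : u <= x -> x <= y -> y <= 1 -> v x j <= v y j.
  move=> ux xy y1; rewrite /v ler_pM2r ?invr_gt0//; apply: ler_sum => k _.
  by rewrite ler_wpM2l ?invr_ge0 ?exprn_ge0 ?(ltW be0)// ler_int; exact: lapc_le.
have vu j : v u j = 0.
  rewrite /v /lap_sum big1 ?mul0r// => k _; by rewrite lapc_u// mulr0.
have v1 j : v 1 j = 1 by rewrite /v divff// gt_eqF//; exact: D0.
have vb x : u <= x <= 1 -> forall j, 0 <= v x j <= 1.
  move=> /andP[ux x1] j; have := vmono j u x (lexx _) ux x1; have := vmono j x 1 ux x1 (lexx _).
  by rewrite vu v1 => -> ->.
have /choice[Lam hL] : forall x, exists l, u <= x <= 1 -> forall e, 0 < e -> U [set j | `|v x j - l| < e].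
  move=> x; have [hx|hx] := boolP (u <= x <= 1); last by exists 0.
  by have [l _ h] := ultra_limit UU (vb x hx); exists l.
have PU := @ultra_proper _ U UU.
exists Lam.
have lim_eq x l : u <= x <= 1 -> (forall j, v x j = l) -> Lam x = l.
  move=> hx vl; apply/eqP; rewrite -subr_eq0 -normr_le0; apply/ler_addgt0Pr => e e0.
  have [j] := filter_ex (hL x hx e e0); rewrite /= vl distrC add0r; exact: ltW.
split.
- move=> x y ux xy y1; apply/ler_addgt0Pr => e e0.
  have e20 : 0 < e / 2 by rewrite divr_gt0.
  have hx : u <= x <= 1 by rewrite ux (le_trans xy).
  have hy : u <= y <= 1 by rewrite y1 (le_trans ux).
  have [j [/= h1 h2]] := filter_ex (filterI (hL x hx _ e20) (hL y hy _ e20)).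
  move: h1 h2 (vmono j x y ux xy y1); rewrite !ltr_norml.
  move: (v x j) (v y j) (Lam x) (Lam y); clear => A B C F /andP[? ?] /andP[? ?] ?; lra.
- by apply: lim_eq.
- by apply: lim_eq.
- move=> x hx; have hqx := quad_itvu a0 a2 hx.
  have err j : `|v (q x) j - ((if x <= 0 then 0 else 2) + (if x <= 0 then beta else - beta) * v x j)|
      <= beta * (2 / j.+1%:R).
    rewrite {1}/v lap_sum_quad// -/(D _).
    set s1 := if _ then beta else _; set w := _ + _ - _.
    have -> : (if x <= 0 then 0 else D (N j) *+ 2) = (if x <= 0 then 0 else 2) * D (N j).
      by case: ifP => _; rewrite ?mul0r// mulr_natl.
    rewrite mulrDl mulfK ?gt_eqF// [X in X - _]addrC addrKA -mulrA -mulrBr normrM.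
    have -> : `|s1| = beta by rewrite /s1; case: ifP => _; rewrite ?normrN gtr0_norm.
    rewrite ler_pM2l// /v -mulrBl normrM normfV (gtr0_norm (D0 j)) ler_pdivrMr// /w.
    set A := lap_sum _ _ _; set B := _ * _; set C := _%:~R.
    have -> : A + B - C - A = B - C by ring.
    have [hD hd] := hN j; have j0 : 0 < j.+1%:R :> R by [].
    have B0 : 0 <= B by rewrite mulr_ge0 ?invr_ge0 ?exprn_ge0 ?(ltW be0)// ler0z lapc_ge0.
    have B1 : B <= j.+1%:R^-1 * D (N j).
      apply: le_trans hd; rewrite ler_wpM2l ?invr_ge0 ?exprn_ge0 ?(ltW be0)// ler_int.
      exact: lapc_le1.
    have C0 : 0 <= C by rewrite ler0z.
    have C1 : C <= j.+1%:R^-1 * D (N j).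
      apply: (@le_trans _ _ 1); first by rewrite /C /=; case: (0 < x).
      by rewrite mulrC ler_pdivlMr// mul1r.
    rewrite -mulrA mulrDl mul1r; move: B0 B1 C0 C1; set t := _^-1 * _.
    by clear => ? ? ? ?; rewrite ler_norml; apply/andP; split; lra.
  suff key : Lam (q x) = (if x <= 0 then 0 else 2) + (if x <= 0 then beta else - beta) * Lam x.
    split=> [x0|x0]; first by rewrite key x0 add0r.
    by rewrite key leNgt x0 /= mulNr.
  apply/eqP; rewrite -subr_eq0 -normr_le0; apply/ler_addgt0Pr => e e0; rewrite add0r.
  set c := if _ then 0 else 2; set s1 := if _ then beta else _.
  have [n hn] : exists n : nat, beta * (2 / n.+1%:R) < e / 3.
    exists (Num.truncn ((e / 3)^-1 * (beta * 2))); rewrite mulrA ltr_pdivrMr// -ltr_pdivrMl ?divr_gt0//.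
    exact: truncnS_gt.
  have e30 : 0 < e / 3 by rewrite divr_gt0.
  have eb0 : 0 < e / 3 / beta by rewrite divr_gt0.
  have [j [/= [h1 h2] h3]] := filter_ex (filterI (filterI (hL x hx _ eb0) (hL _ hqx _ e30)) (Uoo n)).
  have h4 := err j.
  have h5 : beta * (2 / j.+1%:R) <= beta * (2 / n.+1%:R).
    by rewrite ler_pM2l// ler_pM2l// lef_pV2 ?posrE// ler_nat ltnS.
  have h6 : `|s1 * (v x j - Lam x)| < e / 3.
    rewrite normrM (_ : `|s1| = beta) -?ltr_pdivlMl//; last first.
      by rewrite /s1; case: ifP => _; rewrite ?normrN gtr0_norm.
    by rewrite mulrC.
  move: h2 h4 h6; rewrite -/c -/s1.
  have := le_lt_trans h5 hn.
  set E := beta * _; move: (v (q x) j) (Lam (q x)) (v x j) (Lam x).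
  clear => A B C F h0; rewrite !ltr_norml !ler_norml => /andP[? ?] /andP[? ?].
  by rewrite mulrBr => /andP[? ?]; apply/andP; split; lra.
Qed.

Definition semiconj (Lam : R -> R) : Prop :=
  [/\ forall x y, u <= x -> x <= y -> y <= 1 -> Lam x <= Lam y,
    Lam u = 0, Lam 1 = 1,
    forall x, u <= x <= 1 -> Lam (q x) = tent beta (Lam x) &
    forall e, 0 < e -> exists2 d, 0 < d & forall x y, u <= x <= 1 -> u <= y <= 1 ->
      `|x - y| < d -> `|Lam x - Lam y| < e].

Lemma beta_gt1 : 1 < beta. Proof. by rewrite expR_gt1. Qed.

(** Continuity comes from expansion: for two points on one side of 0, [Lam] differs beta times more
    after q. An oscillation at most beta^-n near q x thus gives one at most beta^-(n+1) near x. *)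
Lemma semiconjugacy : exists Lam, semiconj Lam.
Proof.
have [Lam [mono Lu L1 Lq]] := semiconjugacy_pre; exists Lam.
have u1 := left_fix_leN1 a0 a2; have be1 := beta_gt1.
have be0 : 0 < beta by exact: lt_trans be1.
have hz : u <= (0 : R) <= 1 by apply/andP; split; lra.
have L0 : Lam 0 = beta^-1.
  have [h _] := Lq 0 hz; move: (h (lexx _)); rewrite quad0 L1 => /esym h1.
  have bn0 : beta != 0 by rewrite gt_eqF.
  by apply: (mulfI bn0); rewrite h1 mulfV.
have Lq2 x : u <= x <= 1 -> 0 <= x -> Lam (q x) = 2 - beta * Lam x.
  move=> hx; rewrite le_eqVlt => /orP[/eqP <-|x0]; last by have [_ ->] := Lq x hx.
  by rewrite quad0 L0 L1 mulfV ?gt_eqF//; lra.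
have Lb x : u <= x <= 1 -> 0 <= Lam x <= 1.
  by move=> /andP[ux x1]; rewrite -{1}Lu -L1; apply/andP; split; apply: mono => //; lra.
split=> //.
- move=> x hx; rewrite /tent.
  have E z : beta * (z - beta^-1) = beta * z - 1 by rewrite mulrBr mulfV// gt_eqF.
  have [x0|x0] := lerP x 0.
    rewrite ler0_norm ?subr_le0; last by rewrite -L0; apply: mono; lra.
    by rewrite mulrN E; have [-> // _] := Lq x hx; ring.
  rewrite ger0_norm ?subr_ge0; last by rewrite -L0; apply: mono; lra.
  by rewrite E (Lq2 _ hx (ltW x0)); ring.
- have local n : forall x, u <= x <= 1 -> exists2 d, 0 < d &
      forall y, u <= y <= 1 -> `|y - x| < d -> `|Lam y - Lam x| <= beta ^- n.
    elim: n => [|n IH] x hx.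
      exists 1 => // y hy _; rewrite expr0 invr1; apply: dist01; exact: Lb.
    have hqx := quad_itvu a0 a2 hx.
    have [d d0 hd] := IH (q x) hqx.
    have l0 : 0 < quad_lip a by apply: lt_le_trans (quad_lip_ge1 a0).
    (* Either x is the turning point, which belongs to both branches, or y is kept on the side of
       x. *)
    pose d' := if x == 0 then d / quad_lip a else Num.min `|x| (d / quad_lip a).
    have dd : d' <= d / quad_lip a by rewrite /d'; case: ifP => _ //; rewrite ge_min lexx orbT.
    exists d'.
      by rewrite /d'; case: ifPn => x0; rewrite ?lt_min ?normr_gt0 ?x0 divr_gt0.
    move=> y hy yd; have hqy := quad_itvu a0 a2 hy.
    have h1 : `|Lam (q y) - Lam (q x)| <= beta ^- n.
      apply: hd => //; apply: le_lt_trans (quad_dist a0 (itvN a0 a2 hy) (itvN a0 a2 hx)) _.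
      by rewrite mulrC -ltr_pdivlMr//; exact: lt_le_trans dd.
    have h2 : `|Lam (q y) - Lam (q x)| = beta * `|Lam y - Lam x|.
      have bn : `|beta| = beta by rewrite gtr0_norm.
      have neg : x <= 0 -> y <= 0 -> `|Lam (q y) - Lam (q x)| = beta * `|Lam y - Lam x|.
        move=> x0 y0; have [-> // _] := Lq x hx; have [-> // _] := Lq y hy.
        by rewrite -mulrBr normrM bn.
      have pos : 0 <= x -> 0 <= y -> `|Lam (q y) - Lam (q x)| = beta * `|Lam y - Lam x|.
        move=> x0 y0; rewrite !Lq2// -[in RHS]bn -normrM -[RHS]normrN; congr `|_|; ring.
      move: yd; rewrite /d'; have [x0|x0] := eqVneq x 0.
        move=> _; case: (lerP y 0) => y0; first by apply: neg; rewrite ?x0.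
        by apply: pos; [rewrite x0|exact: ltW].
      rewrite lt_min => /andP[yx _]; have [hx0|hx0] := lerP 0 x.
        apply: pos => //; move: yx; rewrite (ger0_norm hx0) ltr_norml => /andP[+ _].
        by move: (x) (y) => x' y' ?; lra.
      apply: neg; first exact: ltW.
      move: yx; rewrite (ltr0_norm hx0) ltr_norml => /andP[_].
      by move: (x) (y) => x' y' ?; lra.
    move: h1; rewrite h2 -ler_pdivlMl// => h1; apply: (le_trans h1).
    by rewrite exprS invfM.
  apply: heine => x e hx e0.
  have [n hn] : exists n : nat, beta ^- n < e.
    have [A A0 hA] := @affine_expR R 1 1 1 ler01 ltr01 ltr01.
    have hb : 0 < ln beta by rewrite ln_gt0.
    exists (Num.truncn (e^-1 / b)).+1; rewrite invf_plt ?posrE ?exprn_gt0//.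
    rewrite -expRM_natl; apply: lt_le_trans (expR_ge1Dx _).
    by rewrite -[ltLHS]add0r ltr_leD// -ler_pdivrMr// ltW// truncnS_gt.
  have [d d0 hd] := local n x hx; exists d => // y hy yx.
  by apply: le_lt_trans hn; apply: hd.
Qed.

End Semiconjugacy.

Section EntropyValue.
Context {R : realType}.
Variable a : R.
Hypotheses (a0 : 0 < a) (a2 : a <= 2).

Lemma semiconj_itv Lam x : semiconj a Lam -> left_fix a <= x <= 1 -> 0 <= Lam x <= 1.
Proof.
move=> [mono Lu L1 _ _] /andP[ux x1]; rewrite -{1}Lu -L1; have := left_fix_leN1 a0 a2 => ?.
by apply/andP; split; apply: mono => //; lra.
Qed.

Lemma quad_entropyE : 0 < lap_rate a -> quad_entropy a = (lap_rate a)%:E.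
Proof.
move=> b0; apply/eqP; rewrite eq_le (quad_entropy_le a0 a2)/=.
have u1 := left_fix_leN1 a0 a2.
have [Lam sc] := semiconjugacy a0 a2 b0; have [mono Lu L1 Lq Lc] := sc.
have -> : (lap_rate a)%:E = (1%:R * ln (expR (lap_rate a)))%:E by rewrite expRK mul1r.
apply: (@htop_tent_factor R _ (beta_gt1 b0) R^o (quad a) _ Lam 1 0 1) => //.
- by move=> x; rewrite /= !in_itv/=; exact: quad_itvu.
- by move=> x; rewrite /= in_itv/=; exact: semiconj_itv.
- move=> eta eta0; have [d d0 hd] := Lc eta eta0; exists (d / 2); first by rewrite divr_gt0.
  move=> x y; rewrite /= !in_itv/= => hx hy; rewrite mdist_regular => xy; apply: ltW.
  by apply: hd => //; apply: (le_lt_trans xy); lra.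
- move=> z z01; have [|||x hx xz] := @ivt_unif R Lam (left_fix a) 1 z => //.
  + by lra.
  + by rewrite /btw Lu L1 z01.
  + by exists x => //; rewrite /= in_itv.
Qed.

End EntropyValue.

(** * Contraction of lifted paths under the tent map *)

Section TentPath.
Context {R : realType}.
Variable be : R.
Hypothesis be1 : 1 < be.
Local Notation T := (tent be).
Local Notation gam := (be^-1).

Lemma expn_large (B : R) : exists n : nat, B < be ^+ n.
Proof.
have b0 : 0 < be by exact: lt_trans be1.
have hb : 0 < ln be by rewrite ln_gt0.
have [n hn] : exists n : nat, B / ln be < n%:R.
  by exists (Num.truncn (B / ln be)).+1; exact: truncnS_gt.
exists n; rewrite -[be in ltRHS]lnK ?posrE// -expRM_natl; apply: lt_le_trans (expR_ge1Dx _).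
by rewrite -[ltLHS]add0r ltr_leD// -ler_pdivrMr// ltW.
Qed.

(** The path of depth m is the image of the path of depth m + 1. Continuity in the parameter enters
    as the intermediate value property at the turning point. *)
Definition tent_path (I : Type) (z : nat -> I -> R) : Prop :=
  (forall m i, T (z m.+1 i) = z m i) /\
  (forall m i j, z m i <= gam -> gam <= z m j -> exists c, z m c = gam).

(* At the deepest level where the path crosses the turning point, all the
   earlier folds are seen as a single one by [tent_local]. *)
Lemma tent_path_block (K : nat) : exists2 r : R, 0 < r &
  forall (I : Type) (z : nat -> I -> R) (rho : R), tent_path z -> rho <= r ->
    (forall i j, `|z 0%N i - z 0%N j| <= rho) ->
    forall m, (m <= K)%N -> forall i j, `|z m i - z m j| <= 2 * be ^- m * rho.
Proof.
have b0 := tent_gt0 be1; have [r r0 hr] := tent_local be1 K.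
exists (r / 4); first by rewrite divr_gt0.
move=> I z rho [zT zc] rhor h0.
have small w y x : x <= y -> w <= 2 * rho -> y <= w -> x < r by move=> ? ? ?; lra.
elim=> [|m IH] mK i j.
  have rho0 : 0 <= rho by apply: le_trans (h0 i j).
  by rewrite expr0 invr1 mulr1; apply: (le_trans (h0 i j)); lra.
have {}IH := IH (ltnW mK).
have rho0 : 0 <= rho by apply: le_trans (h0 i j).
have zmT n i' : iter n T (z n i') = z 0%N i'.
  by elim: n => // n; rewrite iterSr zT.
have [[c zcg]|nc] := pselect (exists c, z m.+1 c = gam); last first.
  have side : (z m.+1 i <= gam) = (z m.+1 j <= gam).
    case: (lerP (z m.+1 i) gam) => hi; case: (lerP (z m.+1 j) gam) => hj //; exfalso; apply: nc.
      exact: (zc _ _ _ hi (ltW hj)).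
    exact: (zc _ _ _ hj (ltW hi)).
  have := tent_side be1 side; rewrite !zT => h; have := IH i j; rewrite h.
  rewrite -ler_pdivlMl// => {}h; apply: (le_trans h).
  by rewrite exprS invfM (_ : _^-1 * _ = 2 * (be^-1 * be ^- m) * rho)//; ring.
have bm : 0 < be ^+ m.+1 by rewrite exprn_gt0.
(* If the path meets the turning point at c, distances to c at depth m + 1 are compared with depth 0
   at once. The factor 2 arises from adding two of them and does not accumulate with m. *)
have half k : be ^+ m.+1 * `|z m.+1 k - gam| <= rho.
  have [s s1 hs] := hr m.+1 mK.
  have : `|z m.+1 k - gam| < r.
    have [cl|cl] := leP (z m.+1 k) gam.
      have side : (z m.+1 k <= gam) = (z m.+1 c <= gam) by rewrite cl zcg lexx.
      have := tent_side be1 side; rewrite !zT zcg => h.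
      have {h} : be * `|z m.+1 k - gam| <= 2 * be ^- m * rho by rewrite -h; exact: IH.
      have bm1 : be ^- m <= 1 by rewrite invf_le1 ?exprn_gt0// exprn_ege1// ltW.
      have : 2 * be ^- m * rho <= 2 * rho.
        by rewrite -mulrA ler_pM2l// ler_piMl.
      have : `|z m.+1 k - gam| <= be * `|z m.+1 k - gam| by rewrite ler_peMl// ltW.
      exact: small.
    have : `|z m k - z m c| = be * `|z m.+1 k - gam|.
      rewrite -(zT m k) -(zT m c) zcg /tent subrr normr0 mulr0 subr0 addrAC subrr add0r normrN.
      by rewrite normrM normr_id gtr0_norm.
    move=> h.
    have {h} : be * `|z m.+1 k - gam| <= 2 * be ^- m * rho by rewrite -h; exact: IH.
    have bm1 : be ^- m <= 1 by rewrite invf_le1 ?exprn_gt0// exprn_ege1// ltW.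
    have : 2 * be ^- m * rho <= 2 * rho.
      by rewrite -mulrA ler_pM2l// ler_piMl.
    have : `|z m.+1 k - gam| <= be * `|z m.+1 k - gam| by rewrite ler_peMl// ltW.
    exact: small.
  move=> /hs; have := h0 k c; rewrite -(zmT m.+1 k) -(zmT m.+1 c) zcg => + e.
  rewrite e addrAC subrr add0r normrM s1 mul1r ger0_norm// mulr_ge0// ltW//.
apply: (le_trans (ler_distD gam _ _)); rewrite (distrC gam).
have -> : 2 * be ^- m.+1 * rho = be ^- m.+1 * rho + be ^- m.+1 * rho by ring.
by apply: lerD; rewrite ler_pdivlMl.
Qed.

(** Over K levels the diameter is at least halved, so the block estimate can be restarted, with lam
    = 2^(-1/K). The constant 4 is the 2 within a block times the 2 lost in rounding m to a multiple
    of K. *)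
Lemma tent_path_contract : exists r lam : R, [/\ 0 < r, 0 < lam, lam < 1 &
  forall (I : Type) (z : nat -> I -> R) (rho : R), tent_path z -> rho <= r ->
    (forall i j, `|z 0%N i - z 0%N j| <= rho) ->
    forall m i j, `|z m i - z m j| <= 4 * lam ^+ m * rho].
Proof.
have b0 := tent_gt0 be1; have [K' hK] := expn_large 4.
pose K := K'.+1; have [r r0 hr] := tent_path_block K.
have K4 : 2 * be ^- K <= 2^-1.
  have : be ^- K <= 4^-1.
    rewrite lef_pV2 ?posrE ?exprn_gt0// (le_trans (ltW hK))//.
    by rewrite ler_weXn2l// ltW.
  by lra.
pose lam : R := expR (- (ln 2 / K%:R)).
have K0 : 0 < K%:R :> R by [].
exists r, lam; split=> //; first exact: expR_gt0.
  by rewrite expR_lt1 oppr_lt0 divr_gt0// ln_gt0// ltr1n.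
move=> I z rho zp rhor h0 m i j.
have rho0 : 0 <= rho by apply: le_trans (h0 i j).
have shift p : tent_path (fun n => z (p + n)%N).
  case: zp => zT zc; split=> [n k|n k l]; last exact: zc.
  by rewrite addnS zT.
have half p : 2 ^- p * rho <= rho.
  by rewrite ler_piMl// invf_le1 ?exprn_gt0// exprn_ege1// ler1n.
have blocks p k l : `|z (p * K)%N k - z (p * K)%N l| <= 2 ^- p * rho.
  elim: p k l => [|p IH] k l; first by rewrite mul0n expr0 invr1 mul1r.
  have := hr I _ (2 ^- p * rho) (shift (p * K)%N) (le_trans (half p) rhor) _ K (leqnn _) k l.
  rewrite [X in (X * K)%N]/= mulSn (addnC K) => h; apply: (le_trans (h _)) => [k' l'|].
    by rewrite addn0.
  by rewrite mulrA ler_wpM2r// exprS invfM ler_wpM2r// invr_ge0 exprn_ge0.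
have := hr I _ (2 ^- (m %/ K) * rho) (shift (m %/ K * K)%N) (le_trans (half _) rhor) _ (m %% K)%N.
move=> /(_ _ _ i j); rewrite -divn_eq => h; apply: (le_trans (h _ _)) => [k l||].
- by rewrite addn0.
- by rewrite ltnW// ltn_mod.
have -> : 2 * be ^- (m %% K) * (2 ^- (m %/ K) * rho) = be ^- (m %% K) * (2 * 2 ^- (m %/ K) * rho) by ring.
apply: (@le_trans _ _ (2 * 2 ^- (m %/ K) * rho)).
  apply: ler_piMl; first by rewrite !mulr_ge0// invr_ge0 exprn_ge0.
  by rewrite invf_le1 ?exprn_gt0// exprn_ege1// ltW.
rewrite ler_wpM2r//.
suff : 2 ^- (m %/ K) <= 2 * lam ^+ m by clear; lra.
rewrite -[2 ^- _](@lnK R) ?posrE ?invr_gt0 ?exprn_gt0// lnV ?posrE ?exprn_gt0// lnXn//.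
rewrite -[X in X * lam ^+ m](@lnK R) ?posrE// /lam -expRM_natl -expRD ler_expR.
have l2 : 0 < ln 2 :> R by rewrite ln_gt0// ltr1n.
have : m%:R * (ln 2 / K%:R) <= (m %/ K).+1%:R * ln 2 :> R.
  rewrite mulrA ler_pdivrMr// mulrAC ler_pM2r// -natrM ler_nat.
  by rewrite ltnW// ltn_ceil.
rewrite -[(m %/ K).+1]addn1 natrD mulrDl mul1r mulrN !mulr_natl.
by move: (ln 2 *+ _) (_ / _ *+ _) => x y ?; lra.
Qed.

End TentPath.

(** * Coordinates on the inverse limit *)

Section InvlimCoord.
Context {R : realType}.
Variable a : R.
Hypotheses (a0 : 0 < a) (a2 : a <= 2).
Local Notation q := (quad a).
Local Notation u := (left_fix a).
Local Notation X := (invlim a).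
Local Notation coord := Defs.coord.
Local Notation shift := Defs.shift.
Implicit Types x y : X.

Lemma coord_iter x m n : iter n q (coord x (m + n)) = coord x m.
Proof. by elim: n => [|n IH]; rewrite ?addn0// addnS iterSr coord_orbit. Qed.

Lemma coord_iterV x m n : (m <= n)%N -> iter (n - m) q (coord x n) = coord x m.
Proof. by move=> mn; rewrite -(coord_iter x m (n - m)) subnKC. Qed.

Lemma coord_lip x y m n : (m <= n)%N ->
  `|coord x m - coord y m| <= quad_lip a ^+ (n - m) * `|coord x n - coord y n|.
Proof.
move=> mn; rewrite -(coord_iterV x mn) -(coord_iterV y mn).
by apply: iter_quad_dist => //; apply: itvN => //; exact: coord_itv.
Qed.

Lemma coord_dist x y m : `|coord x m - coord y m| <= 2 ^+ m * mdist x y.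
Proof.
rewrite -ler_pdivrMl ?exprn_gt0//.
have nd : nondecreasing_seq (series (invlim_term x y)).
  by apply: nondecreasing_series => i _ _; exact: invlim_term_ge0.
have := nondecreasing_cvgn_le nd (@cvg_invlim_term _ _ x y) m.+1.
apply: le_trans; rewrite /series /= big_nat_recr //= lerDr.
by apply: sumr_ge0 => i _; exact: invlim_term_ge0.
Qed.

Lemma coord_width x y m : `|coord x m - coord y m| <= 1 - u.
Proof.
have /andP[? ?] := coord_itv x m; have /andP[? ?] := coord_itv y m.
by rewrite ler_norml; apply/andP; split; lra.
Qed.

Lemma invlim_dist_le x y (M : nat) (A : R) :
  (forall i, (i <= M)%N -> `|coord x i - coord y i| <= A) ->
  mdist x y <= 2 * A + 2 ^- M * (1 - u).
Proof.
move=> h; have u1 := left_fix_leN1 a0 a2.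
have A0 : 0 <= A by apply: le_trans (h 0%N isT).
have p0 n : 0 < (2 ^- n : R) by rewrite invr_gt0 exprn_gt0.
have half n : 2 ^- n.+1 = 2^-1 * 2 ^- n :> R by rewrite exprS invfM.
(* The coefficients are the sums of 2^-i over i < n and over M < i < n. *)
have part n : series (invlim_term x y) n <= 2 * (1 - 2 ^- n) * A + (2 ^- M - 2 * 2 ^- (maxn M.+1 n)) * (1 - u).
  elim: n => [|n IH].
    rewrite maxn0 exprS invfM mulrA mulfV ?mul1r ?subrr ?mul0r; last by rewrite pnatr_eq0.
    by rewrite expr0 invr1 subrr mulr0 mul0r addr0 /series /= big_geq.
  rewrite seriesS; have [nM|nM] := leqP n.+1 M.+1.
    have e2 : maxn M.+1 n = M.+1 by apply/maxn_idPl; exact: ltnW.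
    move: IH; rewrite e2 => IH.
    have := h n nM; rewrite -(ler_pM2l (p0 n)) -/(invlim_term x y n) => h1.
    have := lerD h1 IH; rewrite (half n) => h2; apply: (le_trans h2).
    by move: (2 ^- n) (2 ^- M.+1) (2 ^- M) => v w w'; lra.
  have e2 : maxn M.+1 n = n by apply/maxn_idPr.
  move: IH; rewrite e2 => IH.
  have := coord_width x y n; rewrite -(ler_pM2l (p0 n)) -/(invlim_term x y n) => h1.
  have := lerD h1 IH; rewrite (half n) => h2; apply: (le_trans h2).
  have := mulr_ge0 (ltW (p0 n)) A0.
  by move: (2 ^- n) (2 ^- M) => v w; lra.
apply: limr_le; first exact: cvg_invlim_term.
near=> n; apply: (le_trans (part n)); apply: lerD.
  by rewrite ler_wpM2r// ler_piMr// gerBl ltW.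
by rewrite ler_wpM2r ?gerBl ?mulr_ge0 ?(ltW (p0 _))//; lra.
Unshelve. all: by end_near. Qed.

(** A coordinate determines those of smaller index through q, so a single deep one controls the
    distance. *)
Lemma coord_close (e : R) : 0 < e -> exists M : nat, exists2 eta : R, 0 < eta &
  forall x y, `|coord x M - coord y M| <= eta -> mdist x y < e.
Proof.
move=> e0; have u1 := left_fix_leN1 a0 a2.
have [M hM] := @expn_large R 2 ltac:(by rewrite ltr1n) ((1 - u) / (e / 2)).
have L1 := quad_lip_ge1 a0; have L0 : 0 < quad_lip a by apply: lt_le_trans L1.
exists M, (e / 5 / quad_lip a ^+ M); first by rewrite !divr_gt0// exprn_gt0.
move=> x y xy; have := @invlim_dist_le x y M (e / 5).
have tail : 2 ^- M * (1 - u) < e / 2.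
  by rewrite ltr_pdivrMl ?exprn_gt0// -ltr_pdivrMr// divr_gt0.
move=> h; apply: le_lt_trans (h _) _; last first.
  by move: tail; set t := _ * _; lra.
move=> i iM; apply: (le_trans (coord_lip x y iM)).
apply: (@le_trans _ _ (quad_lip a ^+ M * (e / 5 / quad_lip a ^+ M))); last first.
  by rewrite mulrC divfK// gt_eqF// exprn_gt0.
apply: ler_pM => //; first by rewrite exprn_ge0// ltW.
by rewrite ler_weXn2l// leq_subr.
Qed.

(** Compactness of the inverse limit: a coordinatewise limit of backward orbits is a backward orbit,
    as q is Lipschitz. *)
Lemma ultra_coord (U : set_system nat) (y : nat -> X) : UltraFilter U ->
  exists l : X, forall m e, 0 < e -> U [set j | `|coord (y j) m - coord l m| < e].
Proof.
move=> UU; have PU := @ultra_proper _ U UU.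
have /choice[l hl] : forall m, exists l, u <= l <= 1 /\
    forall e, 0 < e -> U [set j | `|coord (y j) m - l| < e].
  move=> m; have [l li lU] := ultra_limit UU (fun j => coord_itv (y j) m); exists l; split => //.
have lq m : q (l m.+1) = l m.
  apply/eqP; rewrite -subr_eq0 -normr_le0; apply/ler_addgt0Pr => e e0; rewrite add0r.
  have L0 : 0 < quad_lip a by apply: lt_le_trans (quad_lip_ge1 a0).
  have e20 : 0 < e / 2 by rewrite divr_gt0.
  have eL0 : 0 < e / 2 / quad_lip a by rewrite divr_gt0.
  have [l1 h1] := hl m; have [l2 h2] := hl m.+1.
  have [j [/= j1 j2]] := filter_ex (filterI (h1 _ e20) (h2 _ eL0)).
  have := quad_dist a0 (itvN a0 a2 l2) (itvN a0 a2 (coord_itv (y j) m.+1)).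
  rewrite coord_orbit => j3.
  have {j2}j4 : quad_lip a * `|l m.+1 - coord (y j) m.+1| < e / 2.
    by rewrite mulrC -ltr_pdivlMr// distrC.
  apply: le_trans (ler_distD (coord (y j) m) _ _) _.
  by rewrite (splitr e); apply: lerD; [apply/ltW/(le_lt_trans j3)|exact: ltW].
exists (Invlim (fun m => (hl m).1) lq) => m e e0 /=; exact: (hl m).2.
Qed.

(* Uniform continuity, expressed with the coordinates of index M only. *)
Definition ctrl (f : X -> X) : Prop := forall m e, 0 < e ->
  exists M : nat, exists2 eta : R, 0 < eta &
    forall x y, `|coord x M - coord y M| < eta -> `|coord (f x) m - coord (f y) m| < e.

Lemma continuous_coord (f : X -> X) : continuous f -> forall m e l, 0 < e ->
  exists2 d, 0 < d & forall y, mdist l y < d -> `|coord (f y) m - coord (f l) m| < e.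
Proof.
move=> fc m e l e0; have em : 0 < e / 2 ^+ m by rewrite divr_gt0// exprn_gt0.
have /nbhs_ballP[d /= d0 hd] := fc l (ball (f l) (e / 2 ^+ m)) (nbhsx_ballx _ _ em).
exists d => // y ly; have : ball (f l) (e / 2 ^+ m) (f y).
  by apply: hd; rewrite ballEmdist.
rewrite ballEmdist /= => h; apply: le_lt_trans (coord_dist _ _ _) _.
by rewrite mulrC -ltr_pdivlMr// metric_sym.
Qed.

Lemma continuous_ctrl (f : X -> X) : continuous f -> ctrl f.
Proof.
move=> fc m e e0; apply: contrapT => nh.
have hj (j : nat) : exists p : X * X, mdist p.1 p.2 < j.+1%:R^-1 /\ e <= `|coord (f p.1) m - coord (f p.2) m|.
  have [|M [eta eta0 hM]] := @coord_close j.+1%:R^-1; first by rewrite invr_gt0.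
  apply: contrapT => nj; apply: nh; exists M, eta => // x y xy.
  rewrite ltNge; apply/negP => h; apply: nj; exists (x, y); split=> //=.
  by apply: hM; exact: ltW.
have {hj}/choice[p hp] := hj.
have [U UU Uoo] := nat_ultra.
have PU := @ultra_proper _ U UU.
have [l hl] := ultra_coord (fun j => (p j).1) UU.
have e20 : 0 < e / 2 by rewrite divr_gt0.
have [d d0 hd] := continuous_coord fc m l e20.
have d20 : 0 < d / 2 by rewrite divr_gt0.
have [M [eta eta0 hM]] := coord_close d20.
have [n hn] : exists n : nat, n.+1%:R^-1 < d / 2.
  by exists (Num.truncn (d / 2)^-1); rewrite invf_plt ?posrE ?divr_gt0//; exact: truncnS_gt.
have [j [/= j1 nj]] := filter_ex (filterI (hl M eta eta0) (Uoo n)).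
have [p12 he] := hp j.
have lp1 : mdist l (p j).1 < d / 2 by rewrite metric_sym; apply: hM; exact: ltW.
have jn : j.+1%:R^-1 <= n.+1%:R^-1 :> R by rewrite lef_pV2 ?posrE// ler_nat ltnS.
have lp2 : mdist l (p j).2 < d.
  apply: le_lt_trans (metric_triangle l (p j).1 (p j).2) _; rewrite (splitr d); apply: ltrD => //.
  by apply: (lt_trans p12); exact: le_lt_trans hn.
have lp1' : mdist l (p j).1 < d by apply: (lt_trans lp1); rewrite [ltRHS]splitr ltrDl.
have h1 := hd _ lp1'; have h2 := hd _ lp2.
move: he; apply/negP; rewrite -ltNge.
apply: le_lt_trans (ler_distD (coord (f l) m) _ _) _.
by rewrite (splitr e); apply: ltrD => //; rewrite distrC.
Qed.

(** The tracks of all points are equicontinuous, so they can be cut into the same number of short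
    pieces; the condition is stable under composition on both sides. *)
Definition homotopic (f f' : X -> X) : Prop := exists K : X -> R -> X,
  [/\ forall y, K y 0 = f y, forall y, K y 1 = f' y &
    forall m e, 0 < e -> exists2 d, 0 < d & forall y s t, 0 <= s <= 1 -> 0 <= t <= 1 ->
      `|s - t| < d -> `|coord (K y s) m - coord (K y t) m| < e].

Lemma isotopic_homotopic (f f' : X -> X) : isotopic R f f' -> homotopic f f'.
Proof.
case=> H [Hc H0 H1 _]; exists (fun y t => H (y, t)); split=> // m e e0; apply: contrapT => nh.
have hj (j : nat) : exists p : X * (R * R), [/\ 0 <= p.2.1 <= 1, 0 <= p.2.2 <= 1,
    `|p.2.1 - p.2.2| < j.+1%:R^-1 & e <= `|coord (H (p.1, p.2.1)) m - coord (H (p.1, p.2.2)) m|].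
  apply: contrapT => nj; apply: nh; exists j.+1%:R^-1; first by rewrite invr_gt0.
  move=> y s t hs ht st; rewrite ltNge; apply/negP => h; apply: nj.
  by exists (y, (s, t)).
have {hj}/choice[p hp] := hj.
have [U UU Uoo] := nat_ultra.
have PU := @ultra_proper _ U UU.
have [l hl] := ultra_coord (fun j => (p j).1) UU.
have s01 j : 0 <= (p j).2.1 <= 1 by case: (hp j).
have [s0 hs0 hs] := ultra_limit UU s01.
have e20 : 0 < e / 2 / 2 ^+ m by rewrite !divr_gt0// exprn_gt0.
have ls : ([set: X] `*` `[0, 1]%classic) (l, s0) by split=> //=; rewrite in_itv.
have [[P Q] /= [/nbhs_ballP[d1 /= d10 hP] /nbhs_ballP[d2 /= d20 hQ]] PQ] :=
  (subspace_continuousP _ _).1 Hc (l, s0) ls _ (nbhsx_ballx _ _ e20).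
have near_H j (v : R) : 0 <= v <= 1 -> mdist l (p j).1 < d1 -> `|s0 - v| < d2 ->
    `|coord (H (l, s0)) m - coord (H ((p j).1, v)) m| < e / 2.
  move=> hv h1 h2; apply: le_lt_trans (coord_dist _ _ _) _.
  rewrite mulrC -ltr_pdivlMr ?exprn_gt0//.
  have : ball (H (l, s0)) (e / 2 / 2 ^+ m) (H ((p j).1, v)).
    apply: (PQ ((p j).1, v)); first by split; [apply: hP; rewrite ballEmdist|exact: hQ].
    by split=> //=; rewrite in_itv.
  by rewrite ballEmdist.
have [M [eta eta0 hM]] := coord_close d10.
have d20' : 0 < d2 / 2 by rewrite divr_gt0.
have [n hn] : exists n : nat, n.+1%:R^-1 < d2 / 2.
  by exists (Num.truncn (d2 / 2)^-1); rewrite invf_plt ?posrE ?divr_gt0//; exact: truncnS_gt.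
have [j [/= [j1 j2] nj]] := filter_ex (filterI (filterI (hl M eta eta0) (hs _ d20')) (Uoo n)).
have [p1 p2 p12 he] := hp j.
have jn : j.+1%:R^-1 <= n.+1%:R^-1 :> R by rewrite lef_pV2 ?posrE// ler_nat ltnS.
have lp1 : mdist l (p j).1 < d1 by rewrite metric_sym; apply: hM; exact: ltW.
have s1 : `|s0 - (p j).2.1| < d2 / 2 by rewrite distrC.
have s2 : `|s0 - (p j).2.2| < d2.
  apply: le_lt_trans (ler_distD (p j).2.1 _ _) _; rewrite (splitr d2); apply: ltrD => //.
  by apply: (lt_trans p12); exact: le_lt_trans hn.
have s1' : `|s0 - (p j).2.1| < d2 by apply: (lt_trans s1); rewrite [ltRHS]splitr ltrDl.
have h1 := near_H j _ p1 lp1 s1'.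
have h2 := near_H j _ p2 lp1 s2.
move: he; apply/negP; rewrite -ltNge.
apply: le_lt_trans (ler_distD (coord (H (l, s0)) m) _ _) _.
by rewrite (splitr e); apply: ltrD => //; rewrite distrC.
Qed.

Lemma homotopic_ext (f f' g g' : X -> X) : f =1 g -> f' =1 g' -> homotopic f f' -> homotopic g g'.
Proof.
by move=> fg fg' [K [K0 K1 Kc]]; exists K; split=> // y; rewrite ?K0 ?K1.
Qed.

Lemma homotopic_sym (f f' : X -> X) : homotopic f f' -> homotopic f' f.
Proof.
case=> K [K0 K1 Kc]; exists (fun y t => K y (1 - t)); split=> [y|y|m e e0].
- by rewrite subr0.
- by rewrite subrr.
have [d d0 hd] := Kc m e e0; exists d => // y s t /andP[? ?] /andP[? ?] st; apply: hd.
- by apply/andP; split; lra.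
- by apply/andP; split; lra.
- by rewrite opprB addrC addrA subrK distrC.
Qed.

Lemma homotopic_compr (f f' g : X -> X) : homotopic f f' -> homotopic (f \o g) (f' \o g).
Proof.
case=> K [K0 K1 Kc]; exists (fun y t => K (g y) t); split=> [y|y|m e e0].
- by rewrite K0.
- by rewrite K1.
by have [d d0 hd] := Kc m e e0; exists d => // y s t *; exact: hd.
Qed.

Lemma homotopic_compl (f f' g : X -> X) : ctrl g -> homotopic f f' -> homotopic (g \o f) (g \o f').
Proof.
move=> gc [K [K0 K1 Kc]]; exists (fun y t => g (K y t)); split=> [y|y|m e e0].
- by rewrite K0.
- by rewrite K1.
have [M [eta eta0 hM]] := gc m e e0; have [d d0 hd] := Kc M eta eta0.
by exists d => // y s t hs ht st; apply: hM; exact: hd.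
Qed.

Lemma ctrl_comp (f g : X -> X) : ctrl f -> ctrl g -> ctrl (f \o g).
Proof.
move=> fc gc m e e0; have [M [eta eta0 hM]] := fc m e e0; have [N [eta' eta0' hN]] := gc M eta eta0.
by exists N, eta' => // x y xy; apply/hM/hN.
Qed.

Lemma ctrl_iter (f : X -> X) n : ctrl f -> ctrl (iter n f).
Proof.
move=> fc; elim: n => [|n IH]; first by move=> m e e0; exists m, e.
exact: (ctrl_comp fc IH).
Qed.

Lemma ctrl_unshift : ctrl (@unshift R a).
Proof. by move=> m e e0; exists m.+1, e. Qed.

Variable ha : 0 <= a <= 2.

Lemma ctrl_shift : ctrl (shift ha).
Proof.
move=> [|m] e e0; last by exists m, e.
have L0 : 0 < quad_lip a by apply: lt_le_trans (quad_lip_ge1 a0).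
exists 0%N, (e / quad_lip a); first by rewrite divr_gt0.
move=> x y xy /=; apply: le_lt_trans (quad_dist a0 _ _) _; rewrite 1?mulrC -?ltr_pdivlMr//;
  by apply: itvN => //; exact: coord_itv.
Qed.

Lemma shift_pow_inv (k : int) x : shift_pow ha (- k) (shift_pow ha k x) = x.
Proof.
have h1 n y : iter n (@unshift R a) (iter n (shift ha) y) = y.
  by elim: n y => // n IH y; rewrite iterS iterSr IH shiftK.
have h2 n y : iter n (shift ha) (iter n (@unshift R a) y) = y.
  by elim: n y => // n IH y; rewrite iterS iterSr IH unshiftK.
by case: k => [[|n]|n] //=; [exact: (h1 n.+1)|exact: (h2 n.+1)].
Qed.

Lemma ctrl_shift_pow (k : int) : ctrl (shift_pow ha k).
Proof.
by case: k => n; [exact: ctrl_iter ctrl_shift|exact: (ctrl_iter n.+1 ctrl_unshift)].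
Qed.

(** Composed with g on the right and sigma^(-k) on the left, the homotopy joins sigma^(-k) to g. *)
Lemma homotopic_inv (k : int) (h g : X -> X) : cancel g h -> homotopic h (shift_pow ha k) ->
  homotopic g (shift_pow ha (- k)).
Proof.
move=> gh hk; have := homotopic_compl (ctrl_shift_pow (- k)) (homotopic_compr g hk).
by move=> /homotopic_sym; apply: homotopic_ext => x /=; rewrite ?gh// shift_pow_inv.
Qed.

Lemma coord_shift_pow (n m : nat) x : coord (shift_pow ha n x) (m + n) = coord x m.
Proof. by elim: n => [|n IH]; rewrite ?addn0// addnS. Qed.

Lemma coord_unshift_pow (n m : nat) x : coord (shift_pow ha (- n%:Z) x) m = coord x (m + n).
Proof.
have h k j : coord (iter k (@unshift R a) x) j = coord x (j + k).
  by elim: k j => [|k IH] j; rewrite ?addn0// iterS /= IH addSnnS.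
by case: n => [|n]; [rewrite addn0|exact: (h n.+1)].
Qed.

End InvlimCoord.

Section LeftBranch.
Context {R : realType}.
Variable a : R.
Hypotheses (a0 : 0 < a) (a2 : a <= 2).
Local Notation q := (quad a).
Local Notation u := (left_fix a).
Local Notation X := (invlim a).
Local Notation coord := Defs.coord.

Definition left_branch (t : R) : R := - Num.sqrt ((1 - t) / a).
Local Notation lb := left_branch.

Lemma left_branchK t : t <= 1 -> q (lb t) = t.
Proof.
move=> t1; rewrite /quad /lb sqrrN sqr_sqrtr ?divr_ge0 ?subr_ge0 ?(ltW a0)//.
by rewrite mulrCA mulfV ?gt_eqF// mulr1 opprB addrC subrK.
Qed.

Lemma left_branch_itv t : u <= t <= 1 -> u <= lb t <= 0.
Proof.
move=> /andP[ut t1]; rewrite /lb oppr_le0 sqrtr_ge0 andbT lerNr.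
have u1 := left_fix_leN1 a0 a2; have u0 : 0 <= - u by lra.
rewrite -[leRHS](ger0_norm u0) -sqrtr_sqr ler_wsqrtr// ler_pdivrMr// sqrrN.
by have := left_fixP a0; lra.
Qed.

Lemma left_branch_itv1 t : u <= t <= 1 -> u <= lb t <= 1.
Proof. by move=> /left_branch_itv/andP[-> h]; rewrite (le_trans h). Qed.

Lemma left_branch_le s t : s <= t -> t <= 1 -> lb s <= lb t.
Proof.
by move=> st t1; rewrite /lb lerN2 ler_wsqrtr// ler_pM2r ?invr_gt0// lerD2l lerN2.
Qed.

Lemma left_branch_unif e : 0 < e -> exists2 d, 0 < d & forall s t, u <= s <= 1 -> u <= t <= 1 ->
  `|s - t| < d -> `|lb s - lb t| < e.
Proof.
move=> e0; exists (a * e ^+ 2); first by rewrite mulr_gt0 ?exprn_gt0.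
have H s t : s <= t -> t <= 1 -> t - s < a * e ^+ 2 -> lb t - lb s < e.
  move=> st t1 h; rewrite /lb opprK addrC ltrBlDr.
  set x := Num.sqrt _; set y := Num.sqrt _.
  have y0 : 0 <= y := sqrtr_ge0 _.
  have x2 : x ^+ 2 = (1 - s) / a by rewrite sqr_sqrtr// divr_ge0 ?(ltW a0)//; lra.
  have y2 : y ^+ 2 = (1 - t) / a by rewrite sqr_sqrtr// divr_ge0 ?(ltW a0)//; lra.
  have : x ^+ 2 < (e + y) ^+ 2.
    apply: (@lt_le_trans _ _ (y ^+ 2 + e ^+ 2)).
      rewrite x2 y2 -ltrBlDl -mulrBl ltr_pdivrMr// mulrC.
      by have -> : 1 - s - (1 - t) = t - s by ring.
    have -> : (e + y) ^+ 2 = y ^+ 2 + e ^+ 2 + 2 * e * y by ring.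
    by rewrite lerDl !mulr_ge0// ltW.
  by rewrite ltr_pXn2r// nnegrE ?sqrtr_ge0// addr_ge0// ltW.
move=> s t /andP[us s1] /andP[ut t1]; have [st|ts] := leP s t.
  have := left_branch_le st t1; rewrite distrC => h1 h2; rewrite distrC ger0_norm ?subr_ge0//.
  by apply: H => //; apply: le_lt_trans h2; exact: ler_norm.
have := left_branch_le (ltW ts) s1 => h1 h2; rewrite ger0_norm ?subr_ge0//.
by apply: H => //; [exact: ltW|apply: le_lt_trans h2; exact: ler_norm].
Qed.

Lemma iter_left_branch_itv n t : u <= t <= 1 -> u <= iter n lb t <= 1.
Proof. by move=> h; elim: n => //= n; exact: left_branch_itv1. Qed.

Lemma iter_left_branch_unif n e : 0 < e ->
  exists2 d, 0 < d & forall s t, u <= s <= 1 -> u <= t <= 1 ->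
  `|s - t| < d -> `|iter n lb s - iter n lb t| < e.
Proof.
elim: n e => [|n IH] e e0; first by exists e.
have [d1 d10 h1] := left_branch_unif e0; have [d d0 h] := IH d1 d10.
by exists d => // s t hs ht st /=; apply: h1; rewrite ?iter_left_branch_itv//; exact: h.
Qed.

(** The backward orbit over t that always takes the left preimage: a section of the coordinate of
    index M whose deep coordinates tend to u, away from the turning point. *)
Lemma section_ex M : exists A : R -> X, forall t, u <= t <= 1 ->
  coord (A t) M = t /\ forall n, coord (A t) (M + n) = iter n lb t.
Proof.
have key t : exists x : X, u <= t <= 1 ->
    coord x M = t /\ forall n, coord x (M + n) = iter n lb t.
  have hp : u <= u <= 1 by have := left_fix_leN1 a0 a2; lra.
  have [ht|ht] := boolP (u <= t <= 1); last first.
    have qu : q u = u := left_fixP a0.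
    by exists (Invlim (fun _ => hp) (fun _ => qu)).
  pose c k := if (k <= M)%N then iter (M - k) q t else iter (k - M) lb t.
  have ci k : u <= c k <= 1.
    by rewrite /c; case: leqP => _; [exact: iter_quad_itv|exact: iter_left_branch_itv].
  have co k : q (c k.+1) = c k.
    rewrite /c; have [kM|kM] := leqP k.+1 M.
      by rewrite (ltnW kM) -iterS subnSK.
    rewrite subSn// iterS left_branchK; last by have /andP[] := iter_left_branch_itv (k - M) ht.
    have [kM'|//] := leqP k M.
    have -> : k = M by apply/eqP; rewrite eqn_leq kM'.
    by rewrite subnn.
  exists (Invlim ci co) => _ /=; split=> [|n]; first by rewrite /c leqnn subnn.
  rewrite /c; case: n => [|n]; first by rewrite addn0 leqnn subnn.
  by rewrite leqNgt -addSnnS leq_addr /= addSnnS addKn.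
by have /choice[A hA] := key; exists A.
Qed.

End LeftBranch.

(** * Lower bound for maps homotopic to a positive power of the shift *)

Section HomotopyContract.
Context {R : realType}.
Variable a : R.
Hypotheses (a0 : 0 < a) (a2 : a <= 2) (b0 : 0 < lap_rate a).
Local Notation u := (left_fix a).
Local Notation X := (invlim a).
Local Notation coord := Defs.coord.
Local Notation beta := (expR (lap_rate a)).
Variable Lam : R -> R.
Hypothesis sc : semiconj a Lam.

Lemma semiconj_coord (x : X) m n : iter n (tent beta) (Lam (coord x (m + n))) = Lam (coord x m).
Proof.
have [_ _ _ Lq _] := sc.
elim: n => [|n IH]; first by rewrite addn0.
by rewrite iterSr addnS -Lq ?coord_itv// coord_orbit.
Qed.

Lemma coord_tent_path (p : R -> X) (s t : R) :
  (forall m e, 0 < e -> exists2 d, 0 < d & forall x y, s <= x <= t -> s <= y <= t ->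
    `|x - y| < d -> `|coord (p x) m - coord (p y) m| < e) ->
  tent_path beta (fun m (i : {x : R | s <= x <= t}) => Lam (coord (p (sval i)) m)).
Proof.
move=> pc; have [_ _ _ Lq Lc] := sc; split=> [m i|m i j hi hj].
  by rewrite -Lq ?coord_itv// coord_orbit.
have Lpc e : 0 < e -> exists2 d, 0 < d & forall x y, s <= x <= t -> s <= y <= t ->
    `|x - y| < d -> `|Lam (coord (p x) m) - Lam (coord (p y) m)| < e.
  move=> e0; have [d1 d10 h1] := Lc e e0; have [d d0 h] := pc m d1 d10.
  by exists d => // x y hx hy xy; apply: h1; rewrite ?coord_itv//; exact: h.
case: i hi => x /= hx hi; case: j hj => y /= hy hj.
have [xy|yx] := leP x y.
  have sub z : x <= z <= y -> s <= z <= t.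
    by move: hx hy => /andP[? _] /andP[_ ?] /andP[? ?]; apply/andP; split; lra.
  have [||c hc <-] := @ivt_unif R (fun z => Lam (coord (p z) m)) x y beta^-1 xy.
  - move=> e /Lpc[d d0 h]; exists d => // z w hz hw; apply: h; exact: sub.
  - by rewrite /btw hi hj.
  - by exists (exist _ c (sub c hc)).
have sub z : y <= z <= x -> s <= z <= t.
  by move: hx hy => /andP[_ ?] /andP[? _] /andP[? ?]; apply/andP; split; lra.
have [||c hc <-] := @ivt_unif R (fun z => Lam (coord (p z) m)) y x beta^-1 (ltW yx).
- move=> e /Lpc[d d0 h]; exists d => // z w hz hw; apply: h; exact: sub.
- by rewrite /btw hi hj orbT.
- by exists (exist _ c (sub c hc)).
Qed.

(** Every track is cut into N pieces, N being the same for all points, along which [Lam] of the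
    zeroth coordinate moves by at most r; [tent_path_contract] applies to each piece. *)
Lemma homotopic_contract (f f' : X -> X) : homotopic f f' -> exists C lam : R,
  [/\ 0 <= C, 0 < lam, lam < 1 &
  forall y m, `|Lam (coord (f y) m) - Lam (coord (f' y) m)| <= C * lam ^+ m].
Proof.
case=> K [K0 K1 Kc]; have [_ _ _ _ Lc] := sc.
have [r [lam [r0 lam0 lam1 hr]]] := tent_path_contract (beta_gt1 b0).
have [e e0 he] := Lc r r0; have [d d0 hd] := Kc 0%N e e0.
pose N := (Num.truncn d^-1).+1; have N0 : 0 < N%:R :> R by [].
have Nd : N%:R^-1 < d by rewrite invf_plt ?posrE//; exact: truncnS_gt.
exists (N%:R * (4 * r)), lam; split=> //; first by rewrite !mulr_ge0// ltW.
move=> y m; pose w (i : nat) := i%:R / N%:R : R.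
have w01 i : (i <= N)%N -> 0 <= w i <= 1.
  by move=> iN; rewrite /w divr_ge0//= ler_pdivrMr// mul1r ler_nat.
have ww i : w i <= w i.+1 by rewrite /w ler_pM2r ?invr_gt0// ler_nat.
have wS i : w i.+1 - w i = N%:R^-1 by rewrite /w -mulrBl -natrB// subSnn mul1r.
have step i : (i < N)%N ->
    `|Lam (coord (K y (w i)) m) - Lam (coord (K y (w i.+1)) m)| <= 4 * lam ^+ m * r.
  move=> iN; have sub z : w i <= z <= w i.+1 -> 0 <= z <= 1.
    have /andP[? _] := w01 i (ltnW iN); have /andP[_ ?] := w01 i.+1 iN.
    by move=> /andP[? ?]; apply/andP; split; lra.
  have pc : forall m e, 0 < e -> exists2 d, 0 < d & forall x z, w i <= x <= w i.+1 -> w i <= z <= w i.+1 ->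
    `|x - z| < d -> `|coord (K y x) m - coord (K y z) m| < e.
    move=> m' e' e0'; have [d' d0' h'] := Kc m' e' e0'; exists d' => // x z hx hz.
    by apply: h'; exact: sub.
  have i1 : w i <= w i <= w i.+1 by rewrite lexx ww.
  have i2 : w i <= w i.+1 <= w i.+1 by rewrite lexx ww.
  have /= h := hr _ _ r (coord_tent_path pc) (lexx _).
  refine (h _ m (exist _ (w i) i1) (exist _ (w i.+1) i2)).
  move=> [x hx] [z hz] /=; apply/ltW/he; rewrite ?coord_itv//; apply: hd; try exact: sub.
  apply: le_lt_trans Nd; rewrite -(wS i) ler_norml.
  by move: hx hz => /andP[? ?] /andP[? ?]; apply/andP; split; lra.
have tel i : (i <= N)%N ->
    `|Lam (coord (K y (w 0%N)) m) - Lam (coord (K y (w i)) m)| <= i%:R * (4 * lam ^+ m * r).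
  elim: i => [|i IH] iN; first by rewrite subrr normr0 mul0r.
  apply: le_trans (ler_distD (Lam (coord (K y (w i)) m)) _ _) _.
  rewrite -addn1 natrD mulrDl mul1r addn1; apply: lerD; [exact: IH (ltnW iN)|exact: step].
have := tel N (leqnn _); rewrite /w mul0r divff ?gt_eqF// K0 K1 => h; apply: (le_trans h).
by rewrite (_ : N%:R * (4 * r) * lam ^+ m = N%:R * (4 * lam ^+ m * r))//; ring.
Qed.

(** The orbit of f is observed at a depth that increases by n at each step, so the errors of
    [homotopic_contract] are summable and [v x j] converges geometrically. The limit Phi is an exact
    semiconjugacy to the n-th iterate of the tent map. *)
Lemma homotopic_shift_htop_ge (ha : 0 <= a <= 2) (f : X -> X) (n : nat) : (0 < n)%N ->
  ctrl f -> homotopic f (shift_pow ha n) ->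
  ((n%:R * lap_rate a)%:E <= htop f [set: X])%E.
Proof.
move=> n0 fc fn; have [mono Lu L1 Lq Lc] := sc.
have u1 := left_fix_leN1 a0 a2; have one := one_itv a0 a2.
have uu : u <= u <= 1 by rewrite lexx; lra.
have [C [lam [C0 lam0 lam1 hC]]] := homotopic_contract fn.
pose D := C / (1 - lam); have D0 : 0 <= D by rewrite divr_ge0// subr_ge0 ltW.
have Cn : forall e, 0 < e -> exists j : nat, lam ^+ j * D < e.
  move=> e e0; have lV : 1 < lam^-1 by rewrite invf_gt1.
  have [j hj] := expn_large lV (D / e).
  exists j; rewrite mulrC -ltr_pdivlMr ?exprn_gt0// -exprVn.
  by rewrite -ltr_pdivrMl// mulrC.
have [M hM] := Cn 4^-1 ltac:(by rewrite invr_gt0).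
have lk k : 0 <= lam ^+ k by rewrite exprn_ge0// ltW.
pose v x j := Lam (coord (iter j f x) (n * j + M)).
have v01 x j : 0 <= v x j <= 1 by apply: (semiconj_itv a0 a2 sc); exact: coord_itv.
have eM j : (n * j.+1 + M = n * j + M + n)%N by rewrite mulnS -addnA addnC.
have step x j : `|v x j.+1 - v x j| <= C * lam ^+ (M + j.+1).
  have := hC (iter j f x) (n * j.+1 + M)%N; rewrite -iterS -/(v x j.+1).
  rewrite {1}eM coord_shift_pow -/(v x j) => h.
  apply: (le_trans h); apply: ler_wpM2l => //; apply: ler_wiXn2l; rewrite ?ltW//.
  by rewrite addnC leq_add2r leq_pmull.
have tel x j k : `|v x (j + k)%N - v x j| <= D * lam ^+ (M + j.+1) * (1 - lam ^+ k).
  elim: k => [|k IH]; first by rewrite addn0 subrr normr0 expr0 subrr mulr0.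
  apply: le_trans (ler_distD (v x (j + k)%N) _ _) _.
  rewrite addnS; apply: (le_trans (lerD (step x (j + k)%N) IH)).
  rewrite -addnS addnA exprD mulrA; set P := lam ^+ (M + j).
  have CD : C = D * (1 - lam) by rewrite /D divfK// gt_eqF// subr_gt0.
  rewrite CD addnS !exprS -/P.
  by rewrite le_eqVlt; apply/orP; left; apply/eqP; ring.
have [U UU Uoo] := nat_ultra; have PU := @ultra_proper _ U UU.
have /choice[Phi hPhi] : forall x, exists l, 0 <= l <= 1 /\ forall j, `|v x j - l| <= D * lam ^+ (M + j.+1).
  move=> x; have [l l01 hl] := ultra_limit UU (v01 x); exists l; split=> // j.
  apply/ler_addgt0Pr => e e0; have [k [/= k1 k2]] := filter_ex (filterI (hl e e0) (Uoo j)).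
  apply: le_trans (ler_distD (v x k) _ _) _; apply: lerD; last exact: ltW.
  rewrite distrC -(subnKC k2); apply: (le_trans (tel _ _ _)).
  by apply: ler_piMr; [exact: mulr_ge0|rewrite gerBl].
have Phi_v x j : `|v x j - Phi x| <= D * lam ^+ (M + j.+1) by have [_] := hPhi x.
have small e : 0 < e -> exists j, D * lam ^+ (M + j.+1) < e.
  move=> /Cn[j hj]; exists j; apply: le_lt_trans hj; rewrite mulrC ler_wpM2r//.
  by apply: ler_wiXn2l; rewrite ?ltW// addnS leqW// leq_addl.
have Phi_unif eta : 0 < eta -> exists2 e, 0 < e &
    forall x y, mdist x y < e -> `|Phi x - Phi y| < eta.
  move=> eta0; have eta4 : 0 < eta / 4 by rewrite divr_gt0.
  have [j hj] := small _ eta4.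
  have [d d0 hd] := Lc _ eta4; have [N [d1 d10 hN]] := ctrl_iter j fc (n * j + M) d0.
  have d2 : 0 < d1 / 2 ^+ N by rewrite divr_gt0// exprn_gt0.
  exists (d1 / 2 ^+ N) => // x y xy.
  have h1 : `|v x j - v y j| < eta / 4.
    apply: hd; rewrite ?coord_itv//; apply: hN; apply: le_lt_trans (coord_dist _ _ _) _.
    by rewrite mulrC -ltr_pdivlMr// exprn_gt0.
  have := Phi_v x j; have := Phi_v y j; move: h1 hj.
  move: (v x j) (v y j) (Phi x) (Phi y) (D * _) => A B A' B' E; clear -eta0.
  rewrite !ltr_norml !ler_norml => /andP[? ?] ? /andP[? ?] /andP[? ?]; apply/andP; split; lra.
have -> : n%:R * lap_rate a = n%:R * ln beta by rewrite expRK.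
have [A hA] := section_ex a0 a2 M.
have PhiA t : u <= t <= 1 -> `|Phi (A t) - Lam t| <= 4^-1.
  move=> ht; have := Phi_v (A t) 0%N; rewrite /v muln0 add0n /= (hA t ht).1 distrC => h.
  apply: (le_trans h); apply/ltW; apply: le_lt_trans hM; rewrite mulrC ler_wpM2r//.
  by apply: ler_wiXn2l; rewrite ?ltW// leq_addr.
apply: (@htop_tent_factor R _ (beta_gt1 b0) X f _ Phi n 4^-1 (3 / 4)) => //.
- by lra.
- by move=> x _; have [] := hPhi x.
- move=> x _; apply/eqP; rewrite -subr_eq0 -normr_le0; apply/ler_addgt0Pr => e e0; rewrite add0r.
  have bn0 : 0 < beta ^+ n by rewrite exprn_gt0 ?expR_gt0.
  have e20 : 0 < e / 2 by rewrite divr_gt0.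
  have e2b0 : 0 < e / 2 / beta ^+ n by rewrite divr_gt0.
  have [j1 hj1] := small _ e20; have [j2 hj2] := small _ e2b0; pose j := maxn j1 j2.
  have mon j' : (j' <= j)%N -> D * lam ^+ (M + j.+1) <= D * lam ^+ (M + j'.+1).
    by move=> jj; apply: ler_wpM2l => //; apply: ler_wiXn2l; rewrite ?ltW// leq_add2l ltnS.
  (* The point [iter j.+1 f x] is read at depth n * j + M on the left, and n deeper on the right. *)
  have vT : v (f x) j = iter n (tent beta) (v x j.+1).
    by rewrite /v iterSr eM semiconj_coord.
  have h1 := le_lt_trans (mon _ (leq_maxl _ _)) hj1.
  have h2 : D * lam ^+ (M + j.+2) < e / 2 / beta ^+ n.
    apply: le_lt_trans hj2; apply: le_trans (mon _ (leq_maxr _ _)).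
    by apply: ler_wpM2l => //; apply: ler_wiXn2l; rewrite ?ltW// leq_add2l.
  have h3 := iter_tent_dist (beta_gt1 b0) n (v x j.+1) (Phi x).
  have h4 : beta ^+ n * `|v x j.+1 - Phi x| <= e / 2.
    rewrite mulrC -ler_pdivlMr//; apply: (le_trans (Phi_v _ _)); exact: ltW.
  apply: le_trans (ler_distD (v (f x) j) _ _) _; rewrite (splitr e) {2}vT; apply: lerD.
    by rewrite distrC; apply: (le_trans (Phi_v _ _)); exact: ltW.
  exact: le_trans h4.
- move=> eta eta0; have [e e0 he] := Phi_unif eta eta0; exists (e / 2); first by rewrite divr_gt0.
  by move=> x y _ _ xy; apply/ltW/he; apply: (le_lt_trans xy); rewrite [ltRHS]splitr ltrDl divr_gt0.
move=> z hz; have [|||t ht <-] := @ivt_unif R (fun t => Phi (A t)) u 1 z; last by exists (A t).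
- by lra.
- move=> e e0; have [e' e0' he'] := Phi_unif e e0.
  have [N [d1 d10 hN]] := coord_close a0 a2 e0'.
  have [d d0 hd] := iter_left_branch_unif a0 a2 N (divr_gt0 d10 (exprn_gt0 M (lt_le_trans ltr01 (quad_lip_ge1 a0)))).
  exists d => // x y hx hy xy; apply: he'; apply: hN.
  rewrite -(coord_iter (A x) N M) -(coord_iter (A y) N M).
  apply: (le_trans (iter_quad_dist a0 a2 M (itvN a0 a2 (coord_itv _ _)) (itvN a0 a2 (coord_itv _ _)))).
  rewrite addnC (hA x hx).2 (hA y hy).2 mulrC -ler_pdivlMr ?exprn_gt0 ?(lt_le_trans ltr01 (quad_lip_ge1 a0))//.
  by apply/ltW/hd.
have := PhiA u uu; have := PhiA 1 one; rewrite Lu L1 !ler_norml => /andP[h1 h2] /andP[h3 h4].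
apply/orP; left; move: hz => /andP[hz1 hz2]; apply/andP; split; lra.
Qed.

End HomotopyContract.

(** * Labels of intervals *)

Section Labels.
Context {R : realType}.
Variables (B : R -> R -> Prop) (lo hi : R) (K : nat).
Hypothesis Bmono : forall s t s' t', s' <= s -> t <= t' -> B s t -> B s' t'.

Definition chain (s t : R) (m : nat) : Prop := exists x : nat -> R,
  [/\ s <= x 0%N, x m <= t & forall i, (i < m)%N -> x i <= x i.+1 /\ B (x i) (x i.+1)].

Hypothesis chain_bound : forall m, chain lo hi m -> (m <= K)%N.

(** A discrete distance from lo that ignores intervals where B fails; K bounds all chains, so the
    maximum is over a finite range. *)
Definition label (t : R) : nat := \max_(m < K.+1 | `[< chain lo t m >]) m.

Lemma chain_sub s t s' t' m : s' <= s -> t <= t' -> chain s t m -> chain s' t' m.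
Proof.
by move=> ss tt [x [x0 xm xi]]; exists x; split=> //; [exact: le_trans x0|exact: le_trans tt].
Qed.

Lemma chain_nth_le (x : nat -> R) m : (forall i, (i < m)%N -> x i <= x i.+1) ->
  forall i j, (i <= j)%N -> (j <= m)%N -> x i <= x j.
Proof.
move=> xi i j ij jm; rewrite -(subnK ij) addnC.
have : (i + (j - i) <= m)%N by rewrite subnKC.
elim: (j - i)%N => [|k IH] h; first by rewrite addn0.
rewrite addnS; apply: le_trans (IH _) (xi _ _); last by rewrite -addnS.
by apply: leq_trans h; rewrite leq_add2l.
Qed.

Lemma chain1 s t : s <= t -> chain s t 1 <-> B s t.
Proof.
move=> st; split=> [[x [x0 x1 xi]]|Bst]; first by apply: (Bmono x0 x1); exact: (xi 0%N isT).2.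
by exists (fun i => if i is 0%N then s else t); split=> //= -[|].
Qed.

Lemma label_max t m : t <= hi -> chain lo t m -> (m <= label t)%N.
Proof.
move=> thi c; have mK : (m < K.+1)%N by rewrite ltnS; exact: chain_bound (chain_sub (lexx lo) thi c).
exact: (@leq_bigmax_cond _ (fun m : 'I_K.+1 => `[< chain lo t m >]) (fun m => m : nat) (Ordinal mK) (asboolT c)).
Qed.

Lemma label_attained t : lo <= t -> chain lo t (label t).
Proof.
move=> lot; rewrite /label.
have c0 : chain lo t 0 by exists (fun=> lo); split.
have h : (0 < #|[pred m : 'I_K.+1 | `[< chain lo t m >]]|)%N.
  by apply/card_gt0P; exists ord0; rewrite inE.
by have [m /asboolP hm ->] := eq_bigmax_cond (fun m : 'I_K.+1 => nat_of_ord m) h.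
Qed.

Lemma label_le s t : lo <= s -> s <= t -> t <= hi -> (label s <= label t)%N.
Proof.
by move=> ls st thi; apply: label_max => //; apply: chain_sub (label_attained ls).
Qed.

Lemma label_le_bound t : lo <= t -> t <= hi -> (label t <= K)%N.
Proof. by move=> lt th; exact: chain_bound (chain_sub (lexx lo) th (label_attained lt)). Qed.

Lemma label_chain s t m : lo <= s -> t <= hi -> chain s t m -> (label s + m <= label t)%N.
Proof.
move=> ls th [x [x0 xm xi]]; have [y [y0 ym yi]] := label_attained ls.
set l := label s in ym yi *; apply: label_max => //.
case: m => [|m] in xm xi *.
  by rewrite addn0; exists y; split=> //; apply: (le_trans ym); exact: le_trans xm.
(* The end of the first chain and the start of the second are both moved to s, which enlarges the
   adjacent intervals. *)
exists (fun i => if (i < l)%N then y i else if i == l then s else x (i - l)%N); split.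
- by case: (l) y0 => [|k].
- by rewrite ltnNge leq_addr /= -{2}[l]addn0 eqn_add2l /= addKn.
move=> i il; have [ii|ii] := ltnP i l.
  have [y1 y2] := yi i ii; have [i1|i1] := ltnP i.+1 l; first by split.
  have e : i.+1 = l by apply/eqP; rewrite eqn_leq ii.
  have ys : y i.+1 <= s by rewrite e.
  by rewrite e eqxx; split; [exact: le_trans ys|exact: Bmono y2].
have -> : (i.+1 < l)%N = false by rewrite ltnNge (leq_trans ii).
have -> : (i.+1 == l) = false by apply/eqP => e; move: ii; rewrite -e ltnn.
have [il'|il'] := eqVneq i l.
  rewrite il' subSnn; have [h1 h2] := xi 0%N isT.
  by split; [exact: le_trans h1|exact: Bmono h2].
by rewrite subSn//; apply: xi; rewrite ltn_subLR.
Qed.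

(** In an optimal chain of [lo, t] the point of index [label s + 1] lies beyond s, else [lo, s]
    would have too long a chain; what follows is a chain in [s, t]. The interval that straddles s is
    lost. *)
Lemma label_split s t : lo <= s -> s <= t -> t <= hi ->
  chain s t (label t - (label s).+1).
Proof.
move=> ls st th; have [x [x0 xm xi]] := label_attained (le_trans ls st).
have xle := chain_nth_le (fun i h => (xi i h).1).
set l := label t in xm xi xle *.
have [h|h] := leqP l (label s).
  by rewrite (eqP (_ : l - _ == 0)%N); [exists (fun=> s); split|rewrite subn_eq0 ltnW].
exists (fun i => x (i + (label s).+1)%N); split.
- rewrite add0n leNgt; apply/negP => xs.
  have : chain lo s (label s).+1.
    by exists x; split=> // [|i il]; [exact: ltW|apply: xi; exact: leq_trans h].
  by move/(label_max (le_trans st th)); rewrite ltnn.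
- by rewrite subnK.
- by move=> i il; apply: xi; rewrite addnC -ltn_subRL.
Qed.

Lemma label_eqN s t : lo <= s -> s <= t -> t <= hi -> label s = label t -> ~ B s t.
Proof.
move=> ls st th e /(chain1 st) /(label_chain ls th); rewrite e addn1 ltnn//.
Qed.

Lemma label_leSN s t : lo <= s -> s <= t -> t <= hi -> ~ B s t -> (label t <= (label s).+1)%N.
Proof.
move=> ls st th nB; rewrite leqNgt; apply/negP => h; apply: nB.
have := label_split ls st th; rewrite -subn_gt0 in h.
case: (_ - _)%N h => // k _ [x [x0 xk xi]]; have xle := chain_nth_le (fun i h => (xi i h).1).
apply: (@Bmono (x 0%N) (x 1%N)) => //; last exact: (xi 0%N isT).2.
by apply: le_trans xk; apply: xle.
Qed.

End Labels.

Lemma pigeonhole_nat (c : nat -> nat) (m n : nat) : (n < m)%N ->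
  (forall j, (j <= m)%N -> (c j <= n)%N) ->
  exists i j, [/\ (i < j)%N, (j <= m)%N & c i = c j].
Proof.
move=> nm hc; pose s := [seq c j | j <- iota 0 m.+1].
have : ~~ uniq s.
  apply/negP => us; have := uniq_leq_size (s2 := iota 0 n.+1) us.
  rewrite size_map !size_iota ltnS leqNgt nm => /(_ _)/negP; apply=> //.
  by move=> _ /mapP[j + ->]; rewrite !mem_iota !add0n /= !ltnS; exact: hc.
move=> /(uniqPn 0%N)[i [j [ij]]]; rewrite size_map size_iota ltnS => jm.
have im : (i < m.+1)%N by rewrite ltnS ltnW// (leq_trans ij).
rewrite !(nth_map 0%N) ?size_iota ?ltnS// !nth_iota ?ltnS// !add0n => cc.
by exists i, j.
Qed.

Lemma btw_sym (R : realType) (x y z : R) : btw x y z = btw z y x.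
Proof. by rewrite /btw orbC; congr (_ || _); rewrite andbC. Qed.

Lemma btw_dist_le (R : realType) (x y z w : R) : btw x z y -> btw x w y -> `|z - w| <= `|x - y|.
Proof.
wlog xy : x y / x <= y => [H|].
  have [xy|/ltW yx] := leP x y; first exact: H.
  by rewrite (distrC x) !(btw_sym x) => hz hw; exact: H.
rewrite (distrC x) (ger0_norm (x := y - x)) ?subr_ge0// /btw ler_norml.
by move=> /orP[/andP[? ?]|/andP[? ?]] /orP[/andP[? ?]|/andP[? ?]]; apply/andP; split; lra.
Qed.

Lemma btw_mid (R : realType) (x y s t z : R) : btw x s y -> btw x t y -> s <= z -> z <= t ->
  btw x z y.
Proof.
rewrite /btw => /orP[/andP[h1 h2]|/andP[h1 h2]] /orP[/andP[h3 h4]|/andP[h3 h4]] h5 h6.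
- by rewrite (le_trans h1 h5) (le_trans h6 h4).
- by rewrite (le_trans h1 h5) (le_trans h6 (le_trans h4 (le_trans h1 h2))).
- by rewrite (le_trans h1 h5) (le_trans h6 (le_trans h4 (le_trans h1 h2))) orbT.
- by rewrite (le_trans h1 h5) (le_trans h6 h4) orbT.
Qed.

Lemma floor_close (R : realType) (x y c : R) : y < c + 1 -> x < c + 1 -> c <= y -> c <= x ->
  (- 1 < x - y < 1).
Proof. by move=> *; apply/andP; split; lra. Qed.

(** * Labels for the quadratic map and their displacement by a homotopy *)

Section Big.
Context {R : realType}.
Variable a : R.
Hypotheses (a0 : 0 < a) (a2 : a <= 2).
Local Notation q := (quad a).
Local Notation u := (left_fix a).
Local Notation X := (invlim a).
Local Notation coord := Defs.coord.
Local Notation L := (quad_lip a).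

Definition osc (n : nat) (d s t : R) : Prop :=
  exists x y, [/\ s <= x <= t, s <= y <= t & d <= `|iter n q x - iter n q y|].

(* The labels must not see the intervals on which the iterates of q contract:
   an interval counts only if none of its images from time M on is small. *)
Definition big (M : nat) (d s t : R) : Prop := forall n, (M <= n)%N -> osc n d s t.

(** Stated with [btw] because the ends are coordinates of two points, in no particular order. *)
Definition small (n : nat) (d s t : R) : Prop := forall x y,
  btw s x t -> btw s y t -> `|iter n q x - iter n q y| < d.

Lemma small_sym n d s t : small n d s t -> small n d t s.
Proof. by move=> h x y; rewrite !(btw_sym t) => hx hy; apply: h. Qed.

Lemma osc_mono n d s t s' t' : s' <= s -> t <= t' -> osc n d s t -> osc n d s' t'.
Proof.
move=> ss tt [x [y [/andP[h1 h2] /andP[h3 h4] h5]]].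
by exists x, y; split=> //; apply/andP; split; apply: le_trans; eauto.
Qed.

Lemma big_mono M d s t s' t' : s' <= s -> t <= t' -> big M d s t -> big M d s' t'.
Proof. by move=> ss tt h n Mn; exact: osc_mono (h n Mn). Qed.

Lemma big_small M d n s t : s <= t -> (M <= n)%N -> small n d s t -> ~ big M d s t.
Proof.
move=> st Mn sm /(_ n Mn)[x [y [hx hy]]]; apply/negP; rewrite -ltNge.
by apply: sm; rewrite /btw ?hx ?hy.
Qed.

Lemma not_big M d s t : s <= t -> ~ big M d s t -> exists2 n, (M <= n)%N & small n d s t.
Proof.
move=> st nb; apply: contrapT => h; apply: nb => n Mn; apply: contrapT => nxy; apply: h.
exists n => // x y hx hy; rewrite ltNge; apply/negP => dxy; apply: nxy.
have E z : btw s z t -> s <= z <= t.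
  by move=> /orP[//|/andP[h1 h2]]; rewrite (le_trans st h1) (le_trans h2 st).
by exists x, y; split=> //; exact: E.
Qed.

Lemma small_itin n i d s t : itin a i s = itin a i t ->
  small n d (iter i q s) (iter i q t) -> small (n + i) d s t.
Proof.
by move=> it sm x y hx hy; rewrite !iterD; apply: sm; apply: (itin_btw a0 it).
Qed.

Lemma iter_quad_ivt i x y z : btw (iter i q x) z (iter i q y) ->
  exists2 w, btw x w y & iter i q w = z.
Proof.
have H x' y' : x' <= y' -> btw (iter i q x') z (iter i q y') -> exists2 w, btw x' w y' & iter i q w = z.
  move=> xy h; have [||w hw <-] := @IVT R (iter i q) x' y' z xy.
  - by apply: continuous_subspaceT; exact: continuous_iter_quad.
  - by rewrite ge_min le_max; move: h => /orP[/andP[-> ->]|/andP[-> ->]]; rewrite ?orbT.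
  - by exists w => //; rewrite /btw; move: hw; rewrite in_itv/= => ->.
have [xy|yx] := leP x y; first exact: H.
by rewrite btw_sym => /(H _ _ (ltW yx))[w hw <-]; exists w => //; rewrite btw_sym.
Qed.

Lemma small_push n i d s t : (i <= n)%N -> small n d s t ->
  small (n - i) d (iter i q s) (iter i q t).
Proof.
move=> ni sm x y /iter_quad_ivt[x' hx <-] /iter_quad_ivt[y' hy <-].
by rewrite -!iterD subnK//; apply: sm.
Qed.

(** Each interval of a chain takes at least d of the variation available to the M-th iterate, L^M
    times the length 1 - u. *)
Definition big_bound (M : nat) (d : R) : nat := Num.truncn (L ^+ M * (1 - u) / d).

Lemma osc_chain_bound M d m : 0 < d -> chain (osc M d) u 1 m -> (m <= big_bound M d)%N.
Proof.
move=> d0 [x [x0 xm xi]]; have xle := chain_nth_le (fun i h => (xi i h).1).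
have u1 := left_fix_leN1 a0 a2.
have L0 : 0 < L by apply: lt_le_trans (quad_lip_ge1 a0).
have xI i : (i <= m)%N -> u <= x i <= 1.
  by move=> im; rewrite (le_trans x0 (xle _ _ _ im))// (le_trans (xle _ _ im _)).
have key k : (k <= m)%N -> k%:R * d <= L ^+ M * (x k - x 0%N).
  elim: k => [|k IH] km; first by rewrite subrr mulr0 mul0r.
  have [z [w [hz hw hd]]] := (xi k km).2.
  have /andP[k1 k2] := xI k (ltnW km); have /andP[k3 k4] := xI k.+1 km.
  have zI : u <= z <= 1 by move: hz => /andP[h1 h2]; rewrite (le_trans k1 h1) (le_trans h2 k4).
  have wI : u <= w <= 1 by move: hw => /andP[h1 h2]; rewrite (le_trans k1 h1) (le_trans h2 k4).
  have := iter_quad_dist a0 a2 M (itvN a0 a2 zI) (itvN a0 a2 wI).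
  move=> /(le_trans hd) h.
  have h2 : L ^+ M * `|z - w| <= L ^+ M * (x k.+1 - x k).
    rewrite ler_pM2l ?exprn_gt0// ler_norml.
    by move: hz hw => /andP[z1 z2] /andP[w1 w2]; apply/andP; split; lra.
  have := lerD (IH (ltnW km)) (le_trans h h2).
  rewrite -mulrDr -[k.+1]addn1 natrD mulrDl mul1r => h3; apply: (le_trans h3).
  by rewrite addrC addrA subrK addn1.
have B0 : 0 <= L ^+ M * (1 - u) / d.
  by rewrite divr_ge0 ?mulr_ge0 ?exprn_ge0 ?(ltW d0) ?(ltW L0)//; lra.
rewrite /big_bound truncn_ge_nat// ler_pdivlMr//; apply: (le_trans (key m (leqnn _))).
by rewrite ler_pM2l ?exprn_gt0//; apply: lerB.
Qed.

Lemma big_chain_bound M d m : 0 < d -> chain (big M d) u 1 m -> (m <= big_bound M d)%N.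
Proof.
move=> d0 [x [x0 xm xi]]; apply: osc_chain_bound => //; exists x; split=> // i im.
by have [h1 h2] := xi i im; split => //; exact: h2.
Qed.

Definition lam (M : nat) (d t : R) : nat := label (big M d) u (big_bound M d) t.

Lemma lam_le M d s t : 0 < d -> u <= s -> s <= t -> t <= 1 -> (lam M d s <= lam M d t)%N.
Proof. by move=> d0; apply: label_le => m; exact: big_chain_bound. Qed.

Lemma lam_bound M d t : 0 < d -> u <= t <= 1 -> (lam M d t <= big_bound M d)%N.
Proof. by move=> d0 /andP[? ?]; apply: (label_le_bound (hi := 1)) => // m; exact: big_chain_bound. Qed.

Lemma lam_small M d s t : 0 < d -> u <= s <= 1 -> u <= t <= 1 -> lam M d s = lam M d t ->
  exists2 n, (M <= n)%N & small n d s t.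
Proof.
move=> d0; wlog st : s t / s <= t => [H|/andP[us s1] /andP[ut t1] e].
  have [st|/ltW ts] := leP s t; first exact: H.
  by move=> hs ht /esym/(H _ _ ts ht hs)[n Mn sm]; exists n => //; exact: small_sym.
apply: not_big => //.
by apply: (@label_eqN _ _ u 1 (big_bound M d) (@big_mono M d) _ s t) => // m; exact: big_chain_bound.
Qed.

Lemma small_lam M d n s t : 0 < d -> u <= s <= 1 -> u <= t <= 1 -> (M <= n)%N -> small n d s t ->
  (lam M d t <= (lam M d s).+1)%N.
Proof.
move=> d0 /andP[us s1] /andP[ut t1] Mn sm; have [st|/ltW ts] := leP s t.
  apply: (@label_leSN _ _ u 1 _ (@big_mono M d)) => //; first by move=> m; exact: big_chain_bound.
  exact: (big_small st Mn sm).
by rewrite leqW// lam_le.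
Qed.

(** With a common itinerary the iterates are monotone up to time r, so if the image of the interval
    is small at time n, the interval is small at time n + r. *)
Lemma lam_itin M d r s t : 0 < d -> u <= s <= 1 -> u <= t <= 1 ->
  itin a r s = itin a r t -> lam M d (iter r q s) = lam M d (iter r q t) ->
  (lam M d t <= (lam M d s).+1)%N.
Proof.
move=> d0 hs ht it e.
have [n Mn sm] := lam_small d0 (iter_quad_itv a0 a2 r hs) (iter_quad_itv a0 a2 r ht) e.
by apply: (@small_lam M d (n + r)) => //; [apply: (leq_trans Mn); exact: leq_addr|exact: small_itin].
Qed.

(* A chain of big intervals covered by the values of a path cannot be longer
   than the number of pieces on which the path has a short zeroth coordinate. *)
Lemma displacement (f f' : X -> X) (d : R) : 0 < d -> homotopic f f' -> exists J : nat,
  forall y M M', (M' <= M)%N ->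
    (lam M' d (coord (f y) M) <= lam M' d (coord (f' y) M) + J)%N /\
    (lam M' d (coord (f' y) M) <= lam M' d (coord (f y) M) + J)%N.
Proof.
move=> d0 [K [K0 K1 Kc]]; have [e e0 he] := Kc 0%N d d0.
pose N := (Num.truncn e^-1).+1; have N0 : 0 < N%:R :> R by [].
have Ne : N%:R^-1 < e by rewrite invf_plt ?posrE//; exact: truncnS_gt.
(* In a time of length 1 / N the zeroth coordinate moves by less than d; one more unit is the loss
   in [label_split]. *)
exists N.+1; move=> y M M' MM.
have Kuc m (v w : R) e1 : 0 <= v -> v <= w -> w <= 1 -> 0 < e1 ->
    exists2 d1, 0 < d1 & forall x z, v <= x <= w -> v <= z <= w ->
    `|x - z| < d1 -> `|coord (K y x) m - coord (K y z) m| < e1.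
  move=> v0 vw w1 e10; have [d1 d10 h1] := Kc m e1 e10; exists d1 => // x z /andP[x1 x2] /andP[z1 z2].
  by apply: h1; [rewrite (le_trans v0 x1) (le_trans x2 w1)|rewrite (le_trans v0 z1) (le_trans z2 w1)].
have noch s t m : s <= t -> btw (coord (K y 0) M) s (coord (K y 1) M) ->
    btw (coord (K y 0) M) t (coord (K y 1) M) -> chain (big M' d) s t m -> (m <= N)%N.
  move=> st hs ht [x [x0 xm xi]]; rewrite leqNgt; apply/negP => Nm.
  have xle := chain_nth_le (fun i h => (xi i h).1).
  have xI j : (j <= m)%N -> exists2 tau, 0 <= tau <= 1 & coord (K y tau) M = x j.
    move=> jm; have sx : s <= x j by apply: le_trans x0 _; exact: xle.
    have xt : x j <= t by apply: le_trans xm; exact: xle.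
    apply: (@ivt_unif R (fun tau => coord (K y tau) M) 0 1) => //.
      by move=> e1; exact: Kuc.
    exact: btw_mid hs ht sx xt.
  have /choice[tau htau] : forall j, exists tau : R, (j <= m)%N -> 0 <= tau <= 1 /\ coord (K y tau) M = x j.
    move=> j; have [jm|_] := leqP j m; last by exists 0.
    by have [tau h1 h2] := xI j jm; exists tau.
  have tauN j : (j <= m)%N -> (Num.truncn (N%:R * tau j) <= N)%N.
    move=> jm; have [/andP[h1 h2] _] := htau j jm; rewrite truncn_le_nat.
    by apply: (@le_lt_trans _ _ N%:R); [rewrite ler_piMr|rewrite ltr_nat].
  (* Two points of the chain are reached within 1 / N of each other in time. The path covers the
     interval between them meanwhile, and its zeroth coordinate, the M-th image under q, moves by
     less than d. As M' <= M this contradicts bigness. *)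
  have [i [j [ij jm eij]]] := @pigeonhole_nat (fun j => Num.truncn (N%:R * tau j)) m N Nm tauN.
  have im : (i <= m)%N by rewrite ltnW// (leq_trans ij).
  have [/andP[i0 i1] xi'] := htau i im; have [/andP[j0 j1] xj] := htau j jm.
  have dist : `|tau i - tau j| < e.
    apply: lt_trans Ne; rewrite -(ltr_pM2l N0) divff ?gt_eqF//.
    rewrite -[X in X * `|_|](gtr0_norm N0) -normrM mulrBr.
    have a1 : 0 <= N%:R * tau i by rewrite mulr_ge0.
    have a3 : 0 <= N%:R * tau j by rewrite mulr_ge0.
    have := truncn_le (N%:R * tau i); have := truncn_le (N%:R * tau j).
    have := truncnS_gt (N%:R * tau i); have := truncnS_gt (N%:R * tau j).
    rewrite eij a1 a3 -addn1 natrD ltr_norml.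
    exact: floor_close.
  have cover z : x i <= z <= x j -> exists tz, btw (tau i) tz (tau j) /\ coord (K y tz) M = z.
    move=> hz; have [ltau|ltau] := leP (tau i) (tau j).
      have [||tz htz <-] := @ivt_unif R (fun v => coord (K y v) M) _ _ z ltau.
      - by move=> e1; exact: Kuc.
      - by rewrite /btw /= xi' xj hz.
      - by exists tz; rewrite /btw htz.
    have [||tz htz <-] := @ivt_unif R (fun v => coord (K y v) M) _ _ z (ltW ltau).
    - by move=> e1; apply: Kuc => //; exact: ltW.
    - by rewrite /btw /= xi' xj hz orbT.
    - by exists tz; rewrite /btw htz orbT.
  have [z [w [/andP[z1 z2] /andP[w1 w2] hd]]] := (xi i (leq_trans ij jm)).2 M MM.
  have xij : x i.+1 <= x j by apply: xle.
  have [tz [htz cz]] : exists tz, btw (tau i) tz (tau j) /\ coord (K y tz) M = z.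
    by apply: cover; rewrite z1 (le_trans z2).
  have [tw [htw cw]] : exists tz, btw (tau i) tz (tau j) /\ coord (K y tz) M = w.
    by apply: cover; rewrite w1 (le_trans w2).
  move: hd; rewrite -cz -cw -[M]add0n !coord_iter; apply/negP; rewrite -ltNge.
  have bI v : btw (tau i) v (tau j) -> 0 <= v <= 1.
    by move=> /orP[/andP[h1 h2]|/andP[h1 h2]]; rewrite ?(le_trans i0 h1) ?(le_trans j0 h1) ?(le_trans h2).
  apply: he; [exact: bI|exact: bI|].
  apply: le_lt_trans dist.
  exact: btw_dist_le.
have cb m : chain (big M' d) u 1 m -> (m <= big_bound M' d)%N by exact: big_chain_bound.
have main s t : s <= t -> u <= s <= 1 -> u <= t <= 1 -> btw (coord (K y 0) M) s (coord (K y 1) M) ->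
    btw (coord (K y 0) M) t (coord (K y 1) M) -> (lam M' d t <= lam M' d s + N.+1)%N.
  move=> st /andP[us s1] /andP[ut t1] hs ht.
  have := label_split cb us st t1 => /(noch s t _ st hs ht).
  by rewrite leq_subLR addSnnS.
have I0 : btw (coord (K y 0) M) (coord (K y 0) M) (coord (K y 1) M).
  by rewrite /btw !lexx andbT /= le_total.
have I1 : btw (coord (K y 0) M) (coord (K y 1) M) (coord (K y 1) M).
  by rewrite /btw !lexx andbT /= le_total.
rewrite -K0 -K1; have [st|/ltW st] := leP (coord (K y 0) M) (coord (K y 1) M); split.
- by apply: leq_trans (leq_addr _ _); apply: lam_le => //; have /andP[] := coord_itv (K y 0) M; have /andP[] := coord_itv (K y 1) M.
- by apply: main; rewrite ?coord_itv.
- by apply: main; rewrite ?coord_itv.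
- by apply: leq_trans (leq_addr _ _); apply: lam_le => //; have /andP[] := coord_itv (K y 0) M; have /andP[] := coord_itv (K y 1) M.
Qed.

(** J is the same at all depths, so that displacements add up to J per step while the index of the
    coordinate grows by r. *)
Lemma lam_iter (ha : 0 <= a <= 2) (g : X -> X) (r : nat) (d : R) : 0 < d ->
  homotopic g (shift_pow ha (- r%:Z)) -> exists J : nat, forall k y M c,
    (lam M d (coord (iter k g y) (M + c)) <= lam M d (coord y (M + c + r * k)) + J * k)%N /\
    (lam M d (coord y (M + c + r * k)) <= lam M d (coord (iter k g y) (M + c)) + J * k)%N.
Proof.
move=> d0 hg; have [J hJ] := displacement d0 hg; exists J.
elim=> [|k IH] y M c; first by rewrite !muln0 !addn0.
have := hJ (iter k g y) (M + c)%N M (leq_addr _ _).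
rewrite coord_unshift_pow -iterS => -[h1 h2].
have [] := IH y M (c + r)%N.
have -> : (M + (c + r) + r * k = M + c + r * k.+1)%N by rewrite mulnS !addnA.
rewrite addnA => h3 h4; split.
  by rewrite (mulnS J) (addnC J) addnA (leq_trans h1)// leq_add2r.
by rewrite (mulnS J) addnA (leq_trans h4)// leq_add2r.
Qed.

End Big.

(** * Coding of orbits by labels and itineraries *)

Section Coding.
Context {R : realType}.
Variable a : R.
Hypotheses (a0 : 0 < a) (a2 : a <= 2) (b0 : 0 < lap_rate a).
Local Notation q := (quad a).
Local Notation u := (left_fix a).
Local Notation X := (invlim a).
Local Notation coord := Defs.coord.
Local Notation L := (quad_lip a).
Local Notation beta := (expR (lap_rate a)).
Local Notation lb := (left_branch a).
Variable Lam : R -> R.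
Hypothesis sc : semiconj a Lam.

Lemma at_most_range (A : eqType) (f : A -> nat) (P : A -> Prop) (w : nat) :
  (forall x y, P x -> P y -> (f x <= f y + w)%N) ->
  at_most (fun x y => f x <> f y) P w.+1.
Proof.
move=> fw E uE EP sep.
have /= := @monotone_count R A P (fun x => (f x)%:R) 1 1 (fun _ x => (f x)%:R) (fun _ => w%:R) E.
rewrite big_ord1 mulr1 ler_nat => h.
have {h} : ((size E).-1 <= w)%N.
  apply: h => //.
  - move=> x y xE yE xy; exists 0%N => //; apply: natr_dist_ge1; exact/eqP/sep.
  - by move=> k x y z _ _ _ _ h1 h2; rewrite /btw h1 h2.
  - move=> k x y _ Px Py; have := fw x y Px Py; have := fw y x Py Px.
    rewrite -!(ler_nat R) !natrD ler_norml => ? ?; apply/andP; split; lra.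
by case: (size E).
Qed.

Lemma semiconj0 : Lam 0 = beta^-1.
Proof.
have [mono Lu L1 Lq _] := sc; have be0 : 0 < beta by exact: expR_gt0.
have u1 := left_fix_leN1 a0 a2.
have := Lq 0; rewrite quad0 L1 /tent => h; have {h}h := h ltac:(by apply/andP; split; lra).
have : beta * `|Lam 0 - beta^-1| = 0 by lra.
move/eqP; rewrite mulf_eq0 gt_eqF//= normr_eq0 subr_eq0 => /eqP//.
Qed.

Lemma semiconj_left_branch n t : u <= t <= 1 -> Lam (iter n lb t) = beta ^- n * Lam t.
Proof.
move=> ht; have [mono Lu L1 Lq _] := sc; have be0 : 0 < beta by exact: expR_gt0.
elim: n => [|n IH]; first by rewrite expr0 invr1 mul1r.
have hn := iter_left_branch_itv a0 a2 n ht.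
have /andP[h1 h2] := left_branch_itv a0 a2 hn.
have hle : Lam (lb (iter n lb t)) <= beta^-1 by rewrite -semiconj0; apply: mono.
have := Lq _ (left_branch_itv1 a0 a2 hn).
rewrite left_branchK//; last by have /andP[] := hn.
rewrite IH /tent ler0_norm ?subr_le0// mulrN mulrBr mulfV ?gt_eqF// => h.
have {}h : beta ^- n * Lam t = beta * Lam (lb (iter n lb t)) by rewrite h opprK addrC subrK.
by rewrite iterS exprS invfM -mulrA h mulKf// gt_eqF.
Qed.

Lemma semiconj_neg x : u <= x <= 1 -> Lam x < beta^-1 -> x < 0.
Proof.
move=> /andP[ux x1] h; rewrite ltNge; apply/negP => x0; move: h; apply/negP.
rewrite -leNgt -semiconj0; have [mono _ _ _ _] := sc; apply: mono => //.
by have := left_fix_leN1 a0 a2; lra.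
Qed.

Variable ha : 0 <= a <= 2.
Variables (g : X -> X) (r : nat).
Hypotheses (gc : ctrl g) (ginj : injective g) (gh : homotopic g (shift_pow ha (- r%:Z))).

Lemma semiconj_iter : exists C l : R, [/\ 0 <= C, 0 < l, l < 1 & forall k y m,
  `|Lam (coord (iter k g y) m) - Lam (coord y (m + r * k))| <= k%:R * C * l ^+ m].
Proof.
have [C [l [C0 l0 l1 hC]]] := homotopic_contract b0 sc gh.
exists C, l; split=> //; elim=> [|k IH] y m; first by rewrite muln0 addn0 subrr normr0 !mul0r.
have h1 := hC (iter k g y) m; rewrite coord_unshift_pow -iterS in h1.
have := IH y (m + r)%N; rewrite -addnA -mulnS => h2.
apply: le_trans (ler_distD (Lam (coord (iter k g y) (m + r))) _ _) _.
have -> : k.+1%:R * C * l ^+ m = C * l ^+ m + k%:R * C * l ^+ m by rewrite -addn1 natrD; ring.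
apply: lerD => //; apply: (le_trans h2).
by apply: ler_wpM2l; [rewrite mulr_ge0|apply: ler_wiXn2l; rewrite ?ltW// leq_addr].
Qed.

(** [Lam] is contracted along the left branch, hence close to 0 on the deep coordinates of A t, and
    [semiconj_iter] carries this over to N iterates of g. A value below 1/beta forces a negative
    coordinate, so these iterates too are determined by one deep coordinate. *)
Lemma section_neg (N M : nat) (A : R -> X) :
  (forall t, u <= t <= 1 -> coord (A t) M = t /\ forall n, coord (A t) (M + n) = iter n lb t) ->
  exists M1 : nat, forall m k t, (M1 <= m)%N -> (k < N)%N -> u <= t <= 1 ->
    coord (iter k g (A t)) m < 0.
Proof.
move=> hA; have [C [l [C0 l0 l1 hC]]] := semiconj_iter.
have be1 := beta_gt1 b0; have be0 : 0 < beta by exact: expR_gt0.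
have lV : 1 < l^-1 by rewrite invf_gt1.
have e0 : 0 < beta^-1 / 2 by rewrite divr_gt0// invr_gt0.
have [m1 hm1] := expn_large lV (N%:R * C / (beta^-1 / 2)).
have [n1 hn1] := expn_large be1 (beta^-1 / 2)^-1.
exists (maxn m1 (M + n1)) => m k t; rewrite geq_max => /andP[m1m Mm] kN ht.
have := hC k (A t) m.
have [i im] : exists i, (m + r * k = M + (n1 + i))%N.
  by exists (m + r * k - (M + n1))%N; rewrite addnA subnKC// (leq_trans Mm)// leq_addr.
rewrite im (hA t ht).2 semiconj_left_branch// => h.
apply: semiconj_neg; first exact: coord_itv.
have h1 : k%:R * C * l ^+ m < beta^-1 / 2.
  apply: (@le_lt_trans _ _ (N%:R * C * l ^+ m1)).
    apply: ler_pM; rewrite ?mulr_ge0 ?exprn_ge0 ?(ltW l0)//.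
      by rewrite ler_wpM2r// ler_nat ltnW.
    by apply: ler_wiXn2l; rewrite ?ltW.
  by rewrite -ltr_pdivlMr ?exprn_gt0// -exprVn [ltRHS]mulrC -ltr_pdivrMr.
have h2 : beta ^- (n1 + i) * Lam t < beta^-1 / 2.
  apply: (@le_lt_trans _ _ (beta ^- n1)).
    have /andP[L0 L1] := semiconj_itv a0 a2 sc ht.
    have p0 : 0 <= beta ^- (n1 + i) by rewrite invr_ge0 exprn_ge0// ltW.
    rewrite -[leRHS]mulr1; apply: ler_pM => //.
    by rewrite lef_pV2 ?posrE ?exprn_gt0// ler_weXn2l ?leq_addr// ltW.
  by rewrite invf_plt ?posrE// exprn_gt0.
move: h; rewrite ler_norml => /andP[_]; move: h1 h2.
by move: (Lam _) (_ * Lam t) (_ * l ^+ m) => x y z; move: (beta^-1) => v; lra.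
Qed.

Lemma coord_neg_inj (x y : X) M : coord x M = coord y M ->
  (forall m, (M < m)%N -> coord x m <= 0 /\ coord y m <= 0) -> x = y.
Proof.
move=> e neg; apply: invlim_eq.
have up k : coord x (M + k) = coord y (M + k).
  elim: k => [|k IH]; first by rewrite addn0.
  have [x0 y0] := neg (M + k).+1 ltac:(by rewrite ltnS leq_addr).
  rewrite !addnS; move: IH; rewrite -(coord_orbit x) -(coord_orbit y) => /eqP.
  case: (ltgtP (coord x (M + k).+1) (coord y (M + k).+1)) => // h.
    by rewrite lt_eqF// quad_sincr.
  by rewrite gt_eqF// quad_sincr.
move=> m; have [mM|/ltnW mM] := leqP m M.
  by rewrite -(coord_iterV x mM) -(coord_iterV y mM) e.
by rewrite -(subnKC mM).
Qed.

Lemma itin_neg n t : u <= t <= 1 -> itin a n (iter n lb t) = nseq n false.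
Proof.
move=> ht; elim: n => // n IH; rewrite itinS.
have hn := iter_left_branch_itv a0 a2 n ht.
have /andP[_ h] := left_branch_itv a0 a2 hn.
rewrite iterS ltNge h /= left_branchK ?IH//; by have /andP[] := hn.
Qed.

Lemma iter_left_branchK n t : u <= t <= 1 -> iter n q (iter n lb t) = t.
Proof.
move=> ht; elim: n => // n IH; rewrite iterSr iterS left_branchK//.
by have /andP[] := iter_left_branch_itv a0 a2 n ht.
Qed.

Variables (d : R) (J : nat).
Hypothesis d0 : 0 < d.
Hypothesis hJ : forall k y M c,
    (lam a M d (coord (iter k g y) (M + c)) <= lam a M d (coord y (M + c + r * k)) + J * k)%N /\
    (lam a M d (coord y (M + c + r * k)) <= lam a M d (coord (iter k g y) (M + c)) + J * k)%N.

(** The displacement bound leads to coordinates of A t and A t' obtained from t and t' by i left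
    branches. Such a pullback of a contracted interval is contracted i steps later, so the two
    labels differ by at most one; each comparison costs J k. *)
Lemma inner_range (M M' k : nat) (A : R -> X) t t' : (M <= M')%N ->
  (forall t, u <= t <= 1 -> coord (A t) M = t /\ forall n, coord (A t) (M + n) = iter n lb t) ->
  u <= t <= 1 -> u <= t' <= 1 -> lam a M d t = lam a M d t' ->
  (lam a M' d (coord (iter k g (A t)) M') <= lam a M' d (coord (iter k g (A t')) M') + (J * k).*2.+1)%N.
Proof.
move=> MM hA ht ht' e.
have [h1 _] := hJ k (A t) M' 0; have [_ h2] := hJ k (A t') M' 0.
move: h1 h2; rewrite addn0.
have [i im] : exists i, (M' + r * k = M + i)%N.
  by exists (M' + r * k - M)%N; rewrite subnKC// (leq_trans MM)// leq_addr.
rewrite im (hA t ht).2 (hA t' ht').2 => h1 h2.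
have [n Mn sm] := lam_small a0 a2 d0 ht ht' e.
have it : itin a i (iter i lb t') = itin a i (iter i lb t) by rewrite !itin_neg.
have sm' : small a (n + i) d (iter i lb t') (iter i lb t).
  by apply: small_itin => //; rewrite !iter_left_branchK//; exact: small_sym.
have Mi : (M' <= n + i)%N.
  by rewrite (leq_trans (leq_addr (r * k) M'))// im leq_add2r.
have h3 := small_lam a0 a2 d0 (iter_left_branch_itv a0 a2 i ht') (iter_left_branch_itv a0 a2 i ht) Mi sm'.
apply: (leq_trans h1); rewrite -addnn -addnS addnCA addnC leq_add2l.
by apply: (leq_trans h3); rewrite addnS ltnS.
Qed.

(* Time is cut into blocks of length N, and the code records at the beginning of
   each block the label of the M-th coordinate of the orbit of g. Within a block
   the orbit is replaced by that of the leftmost backward orbit with this M-th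
   coordinate: it depends monotonically on the coordinate, which bounds the number
   of sequences of labels [Lab] that occur. *)
Lemma coding (N M1 : nat) (delta : R) : (0 < N)%N -> 0 < delta -> exists M' K : nat, (M1 <= M')%N /\
  forall (Lab : R -> nat) (V : nat),
  (forall s t, u <= s -> s <= t -> t <= 1 -> (Lab s <= Lab t)%N) ->
  (forall s t, u <= s -> s <= t -> t <= 1 ->
     (Lab t <= Lab s + V * (lam a M' d t - lam a M' d s).+1)%N) ->
  forall B, exists code : X -> seq (nat * seq nat),
    at_most (fun y y' => code y <> code y') (fun=> True)
      (K.+1 * (N * (V * (J * N).*2.+2)).+1 *
        (ell a (r * N) * (J * N).*2.+2 * (N * (V * (J * N).*2.+2)).+1) ^ B)%N /\
    forall y y', code y = code y' -> forall i, (i < N * B.+1)%N -> exists w w' : X,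
      [/\ `|coord w M1 - coord (iter i g y) M1| < delta,
        `|coord w' M1 - coord (iter i g y') M1| < delta &
        Lab (coord w M') = Lab (coord w' M')].
Proof.
move=> N0 delta0.
have /choice[Mk hMk] : forall k : nat, exists M : nat, exists2 eta : R, 0 < eta & forall x y : X,
    `|coord x M - coord y M| < eta -> `|coord (iter k g x) M1 - coord (iter k g y) M1| < delta.
  by move=> k; exact: (ctrl_iter k gc M1 delta0).
(* The coordinate of index M determines, within delta, the coordinate of index M1 for the N times of
   a block. *)
pose M := (\max_(k < N) Mk k)%N.
have MkM k : (k < N)%N -> (Mk k <= M)%N.
  by move=> kN; exact: (leq_bigmax_cond (F := fun k : 'I_N => Mk k) (Ordinal kN)).
have [A hA] := section_ex a0 a2 M.
have [M2 hM2] := section_neg N hA.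
(* Beyond M2 the coordinates of the N images of the section are negative, so their coordinate of
   index M' determines them. *)
pose M' := maxn (maxn M1 M2) M.
have MM : (M <= M')%N by rewrite leq_maxr.
exists M', (big_bound a M d); split; first by rewrite /M' !leq_max leqnn.
move=> Lab V Lmono Lran B.
pose phi k t := coord (iter k g (A t)) M'.
have phiI k t : u <= phi k t <= 1 by exact: coord_itv.
(* A continuous injective function on an interval is monotone; injectivity of g enters here. *)
have phi_mono k s t v : (k < N)%N -> u <= s -> s <= t -> t <= v -> v <= 1 ->
    btw (phi k s) (phi k t) (phi k v).
  move=> kN us st tv v1.
  have sI : s \in `[u, 1] by rewrite in_itv/= us (le_trans st (le_trans tv v1)).
  have tI : t \in `[u, 1] by rewrite in_itv/= (le_trans us st) (le_trans tv v1).
  have vI : v \in `[u, 1] by rewrite in_itv/= v1 (le_trans us (le_trans st tv)).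
  have pc : {within [set` `[u, 1]], continuous (phi k)}.
    apply/subspace_continuousP => x; rewrite /= in_itv/= => hx.
    apply/cvgrPdist_lt => e e0; have [Mx [eta eta0 hx']] := ctrl_iter k gc M' e0.
    have L0 : 0 < L by apply: lt_le_trans (quad_lip_ge1 a0).
    have eL : 0 < eta / L ^+ M by rewrite divr_gt0// exprn_gt0.
    have [dd dd0 hdd] := iter_left_branch_unif a0 a2 Mx eL.
    exists dd => //= y yx; rewrite /= in_itv/= => hy; apply: hx'.
    rewrite -(coord_iter (A x) Mx M) -(coord_iter (A y) Mx M).
    apply: (le_lt_trans (iter_quad_dist a0 a2 M (itvN a0 a2 (coord_itv _ _)) (itvN a0 a2 (coord_itv _ _)))).
    by rewrite addnC (hA x hx).2 (hA y hy).2 mulrC -ltr_pdivlMr ?exprn_gt0//; apply: hdd.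
  have pinj : {in `[u, 1] &, injective (phi k)}.
    move=> x y; rewrite !in_itv/= => hx hy e.
    have {e}e : iter k g (A x) = iter k g (A y).
      apply: (coord_neg_inj e) => m Mm.
      have M2m : (M2 <= m)%N by rewrite (leq_trans _ (ltnW Mm))// /M' !leq_max leqnn orbT.
      by split; apply: ltW; apply: hM2.
    have {}e : A x = A y by elim: (k) e => // k' IH /ginj/IH.
    by rewrite -(hA x hx).1 e (hA y hy).1.
  have [inc|dec] := itv_continuous_inj_mono pc pinj.
    by rewrite /btw !(le_mono_in inc)// st tv.
  by rewrite /btw !(le_nmono_in dec)// st tv orbT.
pose mu k t := Lab (phi k t).
have mu_mono k s t v : (k < N)%N -> u <= s -> s <= t -> t <= v -> v <= 1 ->
    btw (mu k s)%:R (mu k t)%:R ((mu k v)%:R : R).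
  move=> kN us st tv v1; have := phi_mono k s t v kN us st tv v1; rewrite /btw /mu.
  have I x : (u <= phi k x) && (phi k x <= 1) := phiI k x.
  have /andP[? ?] := I s; have /andP[? ?] := I t; have /andP[? ?] := I v.
  by move=> /orP[/andP[? ?]|/andP[? ?]]; apply/orP; [left|right]; rewrite !ler_nat !Lmono.
(* The range of [Lab] at one time of a block, given the initial label: 2 J N + 2 units, each worth
   V. *)
pose W := (V * (J * N).*2.+2)%N.
have mu_ran k t t' : (k < N)%N -> u <= t <= 1 -> u <= t' <= 1 -> lam a M d t = lam a M d t' ->
    (mu k t <= mu k t' + W)%N.
  move=> kN ht ht' e; have := inner_range k MM hA ht ht' e; rewrite -/(phi k t) -/(phi k t') => h.
  have /andP[p1 p2] := phiI k t; have /andP[p3 p4] := phiI k t'.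
  have [pp|/ltW pp] := leP (phi k t) (phi k t').
    by apply: leq_trans (Lmono _ _ p1 pp p4) _; rewrite leq_addr.
  apply: leq_trans (Lran _ _ p3 pp p2) _; rewrite leq_add2l leq_mul2l; apply/orP; right.
  rewrite ltnS leq_subLR (leq_trans h)// leq_add2l ltnS leq_double leq_mul2l.
  by rewrite (ltnW kN) orbT.
pose t_ j (y : X) := coord (iter (N * j) g y) M.
have tI j y : u <= t_ j y <= 1 by exact: coord_itv.
pose inner j y := [seq mu k (t_ j y) | k <- iota 0 N].
pose blk j y := (lam a M d (t_ j y), inner j y).
pose code B y := [seq blk j y | j <- iota 0 B].
have inner_count j l : at_most (fun y y' => inner j y <> inner j y')
    (fun y => True /\ lam a M d (t_ j y) = l) (N * W).+1.
  move=> E uE EP sep.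
  have /= := @monotone_count R X (fun y => True /\ lam a M d (t_ j y) = l) (t_ j) N 1
    (fun k y => (mu k (t_ j y))%:R) (fun=> W%:R) E.
  rewrite sumr_const card_ord mulr1 -(mulr_natr W%:R) -natrM ler_nat => h.
  have {h} : ((size E).-1 <= W * N)%N.
    apply: h => //.
    - move=> x y xE yE xy; apply: contrapT => nk; apply: (sep x y xE yE xy).
      apply/eq_in_map => k; rewrite mem_iota add0n => /andP[_ kN].
      apply: contrapT => hk; apply: nk; exists k => //; apply: natr_dist_ge1; exact/eqP.
    - move=> k x y z kN _ _ _ xy yz; apply: mu_mono => //.
        by have /andP[] := tI j x.
      by have /andP[] := tI j z.
    - move=> k x y kN [_ hx] [_ hy].
      have h1 : (mu k (t_ j x) <= mu k (t_ j y) + W)%N by apply: mu_ran => //; rewrite ?tI// hx hy.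
      have h2 : (mu k (t_ j y) <= mu k (t_ j x) + W)%N by apply: mu_ran => //; rewrite ?tI// hx hy.
      by move: h1 h2; rewrite -!(ler_nat R) !natrD ler_norml => ? ?; apply/andP; split; lra.
  by rewrite mulnC; case: (size E).
have blk_count j (P : X -> Prop) c : at_most (fun y y' => lam a M d (t_ j y) <> lam a M d (t_ j y')) P c ->
    at_most (fun y y' => blk j y <> blk j y') P (c * (N * W).+1).
  move=> H; have H2 := @at_most_fiber _ _ (fun y => lam a M d (t_ j y)) (fun y y' => inner j y <> inner j y') P c (N * W).+1 H.
  apply: at_mostW (H2 _) _ _ _ => //.
    by move=> l; apply: at_mostW (inner_count j l) _ _ _ => // x [_ ->].
  by move=> x y _ _ _ nb e e'; apply: nb; rewrite /blk e e'.
(* The first block costs all labels. A later one costs the itinerary of length r N from depth M + r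
   N to depth M, then 2 J N + 2 possible labels, then the sequences inside the block. *)
have code_count B' : at_most (fun y y' => code B'.+1 y <> code B'.+1 y') (fun=> True)
    ((big_bound a M d).+1 * (N * W).+1 * (ell a (r * N) * (J * N).*2.+2 * (N * W).+1) ^ B').
  have codeS j y : code j.+1 y = rcons (code j y) (blk j y).
    by rewrite /code -[j.+1]addn1 iotaD map_cat cats1.
  elim: B' => [|B' IH].
    rewrite expn0 muln1; have H : at_most (fun y y' => lam a M d (t_ 0%N y) <> lam a M d (t_ 0%N y')) (fun=> True) (big_bound a M d).+1.
      apply: at_most_range => x y _ _; apply: leq_trans (leq_addl _ _).
      exact: lam_bound.
    apply: at_mostW (blk_count 0%N _ _ H) _ _ _ => // x y _ _ _ ne e; apply: ne.
    by rewrite !codeS e.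
  rewrite expnSr mulnA.
  set c1 := (ell a (r * N) * (J * N).*2.+2 * (N * W).+1)%N.
  have H := @at_most_fiber _ _ (code B'.+1) (fun y y' => blk B'.+1 y <> blk B'.+1 y') (fun=> True) _ c1 IH.
  apply: at_mostW (H _) _ _ _ => //; last first.
    by move=> x y _ _ _ ne e e'; apply: ne; rewrite (codeS B'.+1) (codeS B'.+1 y) e e'.
  move=> v; apply: blk_count.
  pose z y := iter (N * B') g y.
  pose it y := itin a (r * N) (coord (z y) (M + r * N)).
  have same_lab x y : code B'.+1 x = code B'.+1 y -> lam a M d (coord (z x) M) = lam a M d (coord (z y) M).
    by rewrite !codeS => /eqP; rewrite eqseq_rcons => /andP[_ /eqP[]].
  pose P y := True /\ code B'.+1 y = v.
  have itc : at_most (fun y y' => it y <> it y') P (ell a (r * N)).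
    move=> E uE EP sep; rewrite -(size_map (fun y => coord (z y) (M + r * N))).
    apply: (itin_count a0 a2 (n := (r * N)%N)).
    - rewrite map_inj_in_uniq// => x y xE yE e; apply/eqP/negPn/negP => xy.
      by apply: (sep x y xE yE xy); rewrite /it e.
    - by move=> _ /mapP[x _ ->]; exact: coord_itv.
    - move=> _ _ /mapP[x xE ->] /mapP[y yE ->] ne; apply: sep => //.
      by apply: contra_neq ne => ->.
  (* The new label is within J N of that of the earlier coordinate at depth M + r N, which the
     itinerary and the previous label determine up to one. *)
  have fib w : at_most (fun y y' => lam a M d (t_ B'.+1 y) <> lam a M d (t_ B'.+1 y'))
      (fun y => P y /\ it y = w) (J * N).*2.+2.
    apply: at_most_range => x y [[_ cx] ix] [[_ cy] iy].
    have lz : lam a M d (coord (z x) M) = lam a M d (coord (z y) M) by apply: same_lab; rewrite cx cy.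
    have tS y' : t_ B'.+1 y' = coord (iter N g (z y')) M by rewrite /t_ /z -iterD mulnS.
    have [h1 _] := hJ N (z x) M 0; have [_ h2] := hJ N (z y) M 0.
    rewrite !addn0 -!tS in h1 h2.
    have h3 := lam_itin a0 a2 d0 (coord_itv (z y) (M + r * N)) (coord_itv (z x) (M + r * N)).
    have {}h3 := h3 M (r * N)%N; rewrite !coord_iter in h3.
    have {}h3 := h3 (etrans iy (esym ix)) (esym lz).
    apply: (leq_trans h1); rewrite -addnn -addnS addnCA addnC leq_add2l.
    by apply: (leq_trans h3); rewrite addnS ltnS.
  have key := @at_most_fiber _ _ it (fun y y' => lam a M d (t_ B'.+1 y) <> lam a M d (t_ B'.+1 y')) P _ _ itc fib.
  by apply: at_mostW key _ _ _.
exists (code B.+1); split; first exact: code_count.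
move=> y y' e i iN.
have iB : (i %/ N < B.+1)%N by rewrite ltn_divLR// mulnC.
have kN : (i %% N < N)%N by rewrite ltn_mod.
have ei : i = (i %% N + N * (i %/ N))%N by rewrite addnC mulnC -divn_eq.
have app z : `|coord (iter (i %% N)%N g (A (t_ (i %/ N)%N z))) M1 - coord (iter i g z) M1| < delta.
  rewrite [in X in _ - X]ei iterD; have [eta eta0] := hMk (i %% N)%N; apply.
  have cM : coord (A (t_ (i %/ N)%N z)) M = coord (iter (N * (i %/ N))%N g z) M by rewrite (hA _ _).1.
  by rewrite -(coord_iterV (A _) (MkM _ kN)) -(coord_iterV (iter _ g z) (MkM _ kN)) cM subrr normr0.
exists (iter (i %% N)%N g (A (t_ (i %/ N)%N y))), (iter (i %% N)%N g (A (t_ (i %/ N)%N y'))); split => //.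
have : nth (blk 0%N y) (code B.+1 y) (i %/ N)%N = nth (blk 0%N y) (code B.+1 y') (i %/ N)%N by rewrite e.
rewrite !(nth_map 0%N) ?size_iota// nth_iota// add0n => -[_ /eqP].
move=> /eqP/eq_in_map/(_ (i %% N)%N); apply.
by rewrite mem_iota add0n.
Qed.

End Coding.

(** * Intervals contracted by the quadratic map *)

Section NullIntervals.
Context {R : realType}.
Variable a : R.
Hypotheses (a0 : 0 < a) (a2 : a <= 2).
Local Notation q := (quad a).
Local Notation u := (left_fix a).
Local Notation X := (invlim a).
Local Notation coord := Defs.coord.
Local Notation L := (quad_lip a).

Definition zero (s t : R) : Prop := forall d, 0 < d -> exists n, small a n d s t.

(** Such intervals arise as limits, and the approximating intervals cover only the interior of a
    limit. *)
Definition open_zero (x y : R) : Prop := forall s t,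
  x < s < y \/ y < s < x -> x < t < y \/ y < t < x -> zero s t.

(** No contracted interval issued from the turning point contains a point that comes back to it. As
    q is even, this one-sided form also rules out such points in an open contracted interval around
    0. *)
Definition no_fold : Prop := forall k s n, 0 < k -> k <= - u -> zero 0 k -> 0 <= s <= k -> (0 < n)%N ->
  iter n q s <> 0.

Lemma btw_trans (x y z w v : R) : btw x y v -> btw x w v -> btw y z w -> btw x z v.
Proof.
rewrite /btw => /orP[/andP[h1 h2]|/andP[h1 h2]] /orP[/andP[h3 h4]|/andP[h3 h4]] /orP[/andP[h5 h6]|/andP[h5 h6]];
apply/orP; solve [left; apply/andP; split; lra | right; apply/andP; split; lra].
Qed.

Lemma small_sub n d s t s' t' : btw s s' t -> btw s t' t -> small a n d s t -> small a n d s' t'.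
Proof. by move=> hs ht sm x y hx hy; apply: sm; [apply: btw_trans hx|apply: btw_trans hy]. Qed.

Lemma zero_sub s t s' t' : btw s s' t -> btw s t' t -> zero s t -> zero s' t'.
Proof. by move=> hs ht z d d0; have [n sm] := z d d0; exists n; exact: small_sub sm. Qed.

Lemma iter_quadN n x : (0 < n)%N -> iter n q (- x) = iter n q x.
Proof. by case: n => // n _; rewrite !iterSr quadN. Qed.

Lemma btwN (x y z : R) : btw (- x) (- y) (- z) = btw x y z.
Proof. by rewrite /btw !lerN2 orbC andbC [X in _ || X]andbC. Qed.

Lemma small_opp n d s t : small a n d s t -> small a n d (- s) (- t).
Proof.
move=> sm x y; rewrite -[x]opprK -[y]opprK !btwN => /sm h /h.
case: n {sm h} => [|n]; first by rewrite /= !opprK addrC distrC.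
by rewrite !iter_quadN.
Qed.

Lemma zero_opp s t : zero s t -> zero (- s) (- t).
Proof. by move=> z d d0; have [n sm] := z d d0; exists n; exact: small_opp. Qed.

Lemma no_fold_interior x y s n : no_fold -> open_zero x y -> u <= x -> y <= - u -> x < 0 -> 0 < y ->
  x < s -> s < y -> (0 < n)%N -> iter n q s <> 0.
Proof.
move=> nf oz ux yu x0 y0 xs sy n0; have z0 : x < 0 < y \/ y < 0 < x by left; rewrite x0.
have zs : x < s < y \/ y < s < x by left; rewrite xs.
have [s0|s0|s0] := ltgtP s 0.
- rewrite -iter_quadN//; apply: (nf (- s)) => //; rewrite ?oppr_gt0// ?lexx ?andbT ?oppr_ge0 ?ltW//.
    by rewrite ltrN2 (le_lt_trans ux).
  by rewrite -oppr0; apply: zero_opp; apply: oz.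
- by apply: (nf s) => //; rewrite ?lexx ?ltW//; [exact: lt_le_trans yu|apply: oz].
- have y2 : y / 2 < y by rewrite [ltRHS]splitr ltrDl divr_gt0.
  apply: (nf (y / 2)) => //; rewrite ?divr_gt0// ?s0 ?lexx ?divr_ge0 ?ltW//.
    exact: lt_le_trans yu.
  apply: oz => //; left; apply/andP; split; first by apply: (lt_trans x0); rewrite divr_gt0.
  exact: y2.
Qed.

Lemma btw_quad_inv x y z : (x <= 0 /\ y <= 0 /\ z <= 0) \/ (0 <= x /\ 0 <= y /\ 0 <= z) ->
  btw (q x) (q y) (q z) -> btw x y z.
Proof.
have inc v w : v <= 0 -> w <= 0 -> q v <= q w -> v <= w.
  by move=> v0 w0; apply: contraTT; rewrite -!ltNge => /quad_sincr h; apply: h.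
have dec v w : 0 <= v -> 0 <= w -> q v <= q w -> w <= v.
  by move=> v0 w0; apply: contraTT; rewrite -!ltNge => /quad_sdecr h; apply: h.
move=> [[x0 [y0 z0]]|[x0 [y0 z0]]] /orP[/andP[h1 h2]|/andP[h1 h2]]; apply/orP.
- by left; apply/andP; split; apply: inc.
- by right; apply/andP; split; apply: inc.
- by right; apply/andP; split; apply: dec.
- by left; apply/andP; split; apply: dec.
Qed.

Section Arc.
Variables (x y : X) (m0 : nat).
Hypothesis side : forall m, (m0 < m)%N -> (coord x m <= 0 /\ coord y m <= 0) \/
  (0 <= coord x m /\ 0 <= coord y m).

(** Since x and y are on one side at all depths beyond m0, this is an arc parametrised by the
    coordinate of index m0: [in_arc_inj] and [in_arc_ex] give bijectivity, [in_arc_unif] continuity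
    of the inverse. *)
Definition in_arc (z : X) : Prop := forall m, (m0 <= m)%N -> btw (coord x m) (coord z m) (coord y m).

(** The inverse branches of q are Hoelder of exponent 1/2 up to the turning point, so closeness
    lifts to the next depth. *)
Lemma sqr_dist_side v w : (v <= 0 /\ w <= 0) \/ (0 <= v /\ 0 <= w) ->
  a * `|v - w| ^+ 2 <= `|q v - q w|.
Proof.
move=> s; rewrite quad_sub normrM (gtr0_norm a0) ler_pM2l// normrM (distrC w) expr2.
apply: ler_wpM2l => //; case: s => -[h1 h2].
  have -> : `|w + v| = - (w + v) by rewrite ler0_norm//; lra.
  by rewrite ler_norml; apply/andP; split; lra.
have -> : `|w + v| = w + v by rewrite ger0_norm//; lra.
by rewrite ler_norml; apply/andP; split; lra.
Qed.

Lemma in_arc_side z z' m : in_arc z -> in_arc z' -> (m0 < m)%N ->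
  (coord z m <= 0 /\ coord z' m <= 0) \/ (0 <= coord z m /\ 0 <= coord z' m).
Proof.
move=> hz hz' mm; have := side mm; have := hz m (ltnW mm); have := hz' m (ltnW mm).
have le z1 : btw (coord x m) z1 (coord y m) -> coord x m <= 0 -> coord y m <= 0 -> z1 <= 0.
  by move=> /orP[/andP[? h]|/andP[? h]] ? ?; apply: (le_trans h).
have ge z1 : btw (coord x m) z1 (coord y m) -> 0 <= coord x m -> 0 <= coord y m -> 0 <= z1.
  by move=> /orP[/andP[h ?]|/andP[h ?]] ? ?; apply: le_trans h.
by move=> h1 h2 [[x0 y0]|[x0 y0]]; [left|right]; split; [apply: le h2 x0 y0|apply: le h1 x0 y0|apply: ge h2 x0 y0|apply: ge h1 x0 y0].
Qed.

Lemma in_arc_unif M e : 0 < e -> exists2 d, 0 < d & forall z z', in_arc z -> in_arc z' ->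
  `|coord z m0 - coord z' m0| < d -> `|coord z M - coord z' M| < e.
Proof.
have up n e' : 0 < e' -> exists2 d, 0 < d & forall z z', in_arc z -> in_arc z' ->
    `|coord z m0 - coord z' m0| < d -> `|coord z (m0 + n) - coord z' (m0 + n)| < e'.
  elim: n e' => [|n IH] e' e0'; first by exists e' => // z z'; rewrite addn0.
  have [|d d0 hd] := IH (a * e' ^+ 2); first by rewrite mulr_gt0// exprn_gt0.
  exists d => // z z' hz hz' zz; have := hd z z' hz hz' zz.
  have := sqr_dist_side (in_arc_side hz hz' (m := (m0 + n).+1) ltac:(by rewrite ltnS leq_addr)).
  rewrite !coord_orbit addnS => h1 h2; have := le_lt_trans h1 h2.
  by rewrite ltr_pM2l// ltr_pXn2r ?nnegrE// ltW.
move=> e0; have L0 : 0 < L by apply: lt_le_trans (quad_lip_ge1 a0).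
have [|d d0 hd] := up M (e / L ^+ m0); first by rewrite divr_gt0// exprn_gt0.
exists d => // z z' hz hz' zz; have := hd z z' hz hz' zz.
rewrite ltr_pdivlMr ?exprn_gt0// mulrC; apply: le_lt_trans.
by have := coord_lip a0 a2 z z' (leq_addl m0 M); rewrite addnK.
Qed.

Lemma in_arc_inj z z' : in_arc z -> in_arc z' -> coord z m0 = coord z' m0 -> z = z'.
Proof.
move=> hz hz' e; apply: invlim_eq => M; apply/eqP; rewrite -subr_eq0 -normr_le0.
apply/ler_addgt0Pr => e1 e10; rewrite add0r ltW//.
have [d d0 hd] := in_arc_unif M e10; apply: hd => //.
by rewrite e subrr normr0.
Qed.

Lemma in_arc_ex v : btw (coord x m0) v (coord y m0) -> exists2 z, in_arc z & coord z m0 = v.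
Proof.
move=> hv.
have /choice[F hF] : forall p : nat * R, exists w, btw (coord x (m0 + p.1)) p.2 (coord y (m0 + p.1)) ->
    btw (coord x (m0 + p.1).+1) w (coord y (m0 + p.1).+1) /\ q w = p.2.
  move=> [n c] /=; have [h|h] := boolP (btw (coord x (m0 + n)) c (coord y (m0 + n))); last by exists 0.
  have [|w hw e] := @iter_quad_ivt R a 1 (coord x (m0 + n).+1) (coord y (m0 + n).+1) c.
    by rewrite /= !coord_orbit.
  by exists w.
pose c := fix c n := if n is n'.+1 then F (n', c n') else v.
have cb n : btw (coord x (m0 + n)) (c n) (coord y (m0 + n)).
  elim: n => [|n IH]; first by rewrite addn0.
  by rewrite addnS; have [h _] := hF (n, c n) IH.
have cq n : q (c n.+1) = c n by have [_ h] := hF (n, c n) (cb n).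
have cI n : u <= c n <= 1.
  have /andP[x1 x2] := coord_itv x (m0 + n); have /andP[y1 y2] := coord_itv y (m0 + n).
  move: (cb n) => /orP[/andP[h1 h2]|/andP[h1 h2]].
    by rewrite (le_trans x1 h1) (le_trans h2 y2).
  by rewrite (le_trans y1 h1) (le_trans h2 x2).
pose z k := if (k <= m0)%N then iter (m0 - k) q v else c (k - m0)%N.
have zI k : u <= z k <= 1.
  by rewrite /z; case: ifP => _; [exact: (iter_quad_itv a0 a2 _ (cI 0%N))|exact: cI].
have zo k : q (z k.+1) = z k.
  rewrite /z; have [km|km] := leqP k.+1 m0; first by rewrite (ltnW km) -iterS subnSK.
  rewrite subSn// cq; have [km'|//] := leqP k m0.
  by have -> : k = m0; [apply/eqP; rewrite eqn_leq km'|rewrite subnn].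
exists (Invlim zI zo) => [m mm|] /=; last by rewrite /z leqnn subnn.
have zc : z m = c (m - m0)%N.
  rewrite /z; case: leqP => // mm'; have -> : m = m0 by apply/eqP; rewrite eqn_leq mm'.
  by rewrite subnn.
by rewrite zc; have := cb (m - m0)%N; rewrite subnKC.
Qed.

End Arc.

(* In an arc between B and C every coordinate of the image takes all values
   between those of the images of B and C, so that a point whose image lies in
   the arc between these images was already in the arc. *)
Lemma arc_image (f : X -> X) (A B C : X) (m0 m1 : nat) : ctrl f -> injective f ->
  (forall m, (m0 < m)%N -> (coord B m <= 0 /\ coord C m <= 0) \/ (0 <= coord B m /\ 0 <= coord C m)) ->
  (forall m, (m1 <= m)%N -> btw (coord (f B) m) (coord (f A) m) (coord (f C) m)) ->
  btw (coord B m0) (coord A m0) (coord C m0).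
Proof.
move=> fc finj side hm.
wlog BC : B C side hm / coord B m0 <= coord C m0 => [H|].
  have [BC|/ltW CB] := leP (coord B m0) (coord C m0); first exact: H.
  rewrite btw_sym; apply: H => // m mm; last by rewrite btw_sym; exact: hm.
  by case: (side m mm) => -[? ?]; [left|right].
have /choice[E hE] : forall v, exists z, btw (coord B m0) v (coord C m0) ->
    in_arc B C m0 z /\ coord z m0 = v.
  move=> v; have [h|h] := boolP (btw (coord B m0) v (coord C m0)); last by exists B.
  by have [z hz e] := in_arc_ex h; exists z.
have bE v : coord B m0 <= v <= coord C m0 -> btw (coord B m0) v (coord C m0) by rewrite /btw => ->.
have Euc k e : 0 < e -> exists2 d, 0 < d & forall v w, coord B m0 <= v <= coord C m0 ->
    coord B m0 <= w <= coord C m0 -> `|v - w| < d -> `|coord (f (E v)) k - coord (f (E w)) k| < e.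
  move=> e0; have [M [eta eta0 hM]] := fc k e e0; have [d d0 hd] := in_arc_unif side M eta0.
  exists d => // v w /bE hv /bE hw vw; apply: hM.
  by have [h1 h2] := hE v hv; have [h3 h4] := hE w hw; apply: hd => //; rewrite h2 h4.
have arcB : in_arc B C m0 B by move=> m _; rewrite /btw lexx andbT /= le_total.
have arcC : in_arc B C m0 C by move=> m _; rewrite /btw lexx andbT /= le_total.
have BB : coord B m0 <= coord B m0 <= coord C m0 by rewrite lexx.
have CC : coord B m0 <= coord C m0 <= coord C m0 by rewrite lexx BC.
have EB : E (coord B m0) = B by have [h1 h2] := hE _ (bE _ BB); exact: (in_arc_inj side).
have EC : E (coord C m0) = C by have [h1 h2] := hE _ (bE _ CC); exact: (in_arc_inj side).
(* For every j some parameter gives an image that agrees with f A at index m1 + j, hence at all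
   smaller ones. A limit w of these parameters satisfies f (E w) = f A, and f is injective. *)
have /choice[v hv] : forall j, exists v, coord B m0 <= v <= coord C m0 /\
    coord (f (E v)) (m1 + j) = coord (f A) (m1 + j).
  move=> j; have [||v h1 h2] := @ivt_unif R (fun v => coord (f (E v)) (m1 + j)) _ _ (coord (f A) (m1 + j)) BC.
  - exact: Euc.
  - by rewrite /= EB EC; apply: hm; exact: leq_addr.
  - by exists v.
have [U UU Uoo] := nat_ultra; have PU := @ultra_proper _ U UU.
have [w hw Uw] := ultra_limit UU (fun j => (hv j).1).
suff : E w = A by move=> <-; rewrite (hE w (bE w hw)).2; exact: bE.
apply: finj; apply: invlim_eq => k; apply/eqP; rewrite -subr_eq0 -normr_le0.
apply/ler_addgt0Pr => e e0; rewrite add0r ltW//.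
have [d d0 hd] := Euc k e e0.
have [j [/= j1 j2]] := filter_ex (filterI (Uw d d0) (Uoo k)).
have kj : (k <= m1 + j)%N by rewrite (leq_trans j2)// leq_addl.
have <- : coord (f (E (v j))) k = coord (f A) k.
  by rewrite -(coord_iterV (f A) kj) -(coord_iterV (f (E (v j))) kj) (hv j).2.
by rewrite distrC; apply: hd => //; exact: (hv j).1.
Qed.

End NullIntervals.

(** * Families of points with contracted coordinates *)

Section NullFamily.
Context {R : realType}.
Variable a : R.
Hypotheses (a0 : 0 < a) (a2 : a <= 2).
Local Notation q := (quad a).
Local Notation u := (left_fix a).
Local Notation X := (invlim a).
Local Notation coord := Defs.coord.

Lemma btwxx (x y : R) : btw x x y.
Proof. by rewrite /btw lexx andbT /= le_total. Qed.

Lemma btw_case (x y z : R) : [\/ btw x y z, btw y x z | btw x z y].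
Proof.
rewrite /btw; have [xy|/ltW yx] := leP x y; have [yz|/ltW zy] := leP y z; have [xz|/ltW zx] := leP x z;
  by [constructor 1; rewrite ?xy ?yz ?yx ?zy ?orbT|constructor 2; rewrite ?yx ?xz ?xy ?zx ?orbT|
      constructor 3; rewrite ?xz ?zy ?zx ?yz ?orbT].
Qed.

Section Family.
Variables (c : nat) (z : 'I_c.+1 -> X).
Hypothesis nf : no_fold a.
Hypothesis oz : forall p p' m, open_zero a (coord (z p) m) (coord (z p') m).

Definition folds (m : nat) := exists p p', coord (z p) m < 0 /\ 0 < coord (z p') m.

(** With folds at two depths, the hull of the coordinates at depth m2 would have in its interior 0
    and a point that returns to 0 after m2 - m1 steps, against [no_fold]. *)
Lemma fold_unique m1 m2 : (m1 < m2)%N -> folds m1 -> ~ folds m2.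
Proof.
move=> mm [p1 [p1' [hp hp']]] [p2 [p2' [h2 h2']]].
pose x := coord (z [arg min_(p < ord0) coord (z p) m2]%O) m2.
pose y := coord (z [arg max_(p > ord0) coord (z p) m2]%O) m2.
have xm p : x <= coord (z p) m2.
  by rewrite /x; case: arg_minP => // i _ h; exact: h.
have ym p : coord (z p) m2 <= y.
  by rewrite /y; case: arg_maxP => // i _ h; exact: h.
have e p : iter (m2 - m1) q (coord (z p) m2) = coord (z p) m1 by rewrite coord_iterV// ltnW.
have [|w hw w0] := @iter_quad_ivt R a (m2 - m1) (coord (z p1) m2) (coord (z p1') m2) 0.
  by rewrite !e /btw (ltW hp) (ltW hp').
have n1 : w != coord (z p1) m2 by apply/eqP => ew; move: hp; rewrite -e -ew w0 ltxx.
have n2 : w != coord (z p1') m2 by apply/eqP => ew; move: hp'; rewrite -e -ew w0 ltxx.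
have [xw wy] : x < w /\ w < y.
  move: hw => /orP[/andP[h3 h4]|/andP[h3 h4]]; split.
  - by apply: (le_lt_trans (xm p1)); rewrite lt_neqAle eq_sym n1.
  - by apply: (lt_le_trans _ (ym p1')); rewrite lt_neqAle n2.
  - by apply: (le_lt_trans (xm p1')); rewrite lt_neqAle eq_sym n2.
  - by apply: (lt_le_trans _ (ym p1)); rewrite lt_neqAle n1.
have x0 : x < 0 by apply: le_lt_trans h2.
have y0 : 0 < y by apply: lt_le_trans (ym p2').
have oxy : open_zero a x y by exact: oz.
have n0 : (0 < m2 - m1)%N by rewrite subn_gt0.
have ux : u <= x by have /andP[] := coord_itv (z [arg min_(p < ord0) coord (z p) m2]%O) m2.
have yu : y <= - u.
  by have /andP[_ h] := itvN a0 a2 (coord_itv (z [arg max_(p > ord0) coord (z p) m2]%O) m2).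
exact: (no_fold_interior nf oxy ux yu x0 y0 xw wy n0 w0).
Qed.

Lemma family_fold : exists m0, forall m, m <> m0 ->
  (forall p, coord (z p) m <= 0) \/ (forall p, 0 <= coord (z p) m).
Proof.
have nofold m : ~ folds m -> (forall p, coord (z p) m <= 0) \/ (forall p, 0 <= coord (z p) m).
  move=> nm; have [h|/existsNP[p' hp']] := pselect (forall p, coord (z p) m <= 0); first by left.
  right=> p; rewrite leNgt; apply/negP => hp; apply: nm; exists p, p'; split => //.
  by rewrite ltNge; exact/negP.
have [[m1 h1]|h] := pselect (exists m, folds m); last first.
  by exists 0%N => m _; apply: nofold => hm; apply: h; exists m.
exists m1 => m mm1; apply: nofold => hm; have [lt|gt|//] := ltngtP m m1.
  exact: (fold_unique lt hm h1).
exact: (fold_unique gt h1 hm).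
Qed.

Variable m0 : nat.
Hypothesis sgn : forall m, m <> m0 ->
  (forall p, coord (z p) m <= 0) \/ (forall p, 0 <= coord (z p) m).

Lemma family_btw_up p p' p'' m : (m0 <= m)%N -> btw (coord (z p) m0) (coord (z p') m0) (coord (z p'') m0) ->
  btw (coord (z p) m) (coord (z p') m) (coord (z p'') m).
Proof.
move=> mm h; rewrite -(subnKC mm); elim: (m - m0)%N => [|n IH]; first by rewrite addn0.
rewrite addnS; apply: (btw_quad_inv a0); last by rewrite !coord_orbit.
have [|s|s] := sgn (m := (m0 + n).+1); last by right.
  by move=> e; have := leq_addr n m0; rewrite -ltnS e ltnn.
by left.
Qed.

Lemma family_btw_down p p' p'' m m' : (m < m0)%N -> (m' <= m)%N ->
  btw (coord (z p) m) (coord (z p') m) (coord (z p'') m) ->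
  btw (coord (z p) m') (coord (z p') m') (coord (z p'') m').
Proof.
move=> mm m'm; rewrite -(subnKC m'm); have : (m' + (m - m') < m0)%N by rewrite subnKC.
elim: (m - m')%N => [|n IH] mn; first by rewrite addn0.
rewrite addnS => h; apply: IH; first by apply: leq_ltn_trans mn; rewrite leq_add2l.
rewrite -(coord_orbit (z p) (m' + n)) -(coord_orbit (z p') (m' + n)) -(coord_orbit (z p'') (m' + n)); move: h.
have [|s|s] := sgn (m := (m' + n).+1); first by move=> e; move: mn; rewrite addnS e ltnn.
  by move=> /orP[/andP[h1 h2]|/andP[h1 h2]]; apply/orP; [left|right]; rewrite !(quad_incr a0).
by move=> /orP[/andP[h1 h2]|/andP[h1 h2]]; apply/orP; [right|left]; rewrite !(quad_decr a0).
Qed.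

(* Along the family ordered by the coordinate of index m0, the coordinate of index
   M is unimodal; it is split at the member closest to the fold. *)
Lemma family_split (M : nat) : exists i1 i2 : 'I_c.+1 -> 'I_c.+1,
  (forall p p' p'', btw (coord (z p) m0) (coord (z p') m0) (coord (z p'') m0) ->
    btw (coord (z (i1 p)) M) (coord (z (i1 p')) M) (coord (z (i1 p'')) M) /\
    btw (coord (z (i2 p)) M) (coord (z (i2 p')) M) (coord (z (i2 p'')) M)) /\
  (forall p p', `|coord (z p) M - coord (z p') M| <=
    `|coord (z (i1 p)) M - coord (z (i1 p')) M| + `|coord (z (i2 p)) M - coord (z (i2 p')) M|).
Proof.
have [mM|Mm] := leqP m0 M.
  exists id, id; split=> [p p' p'' h|p p']; last by rewrite lerDl.
  by split; exact: family_btw_up.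
have [m em] : exists m, m0 = m.+1 by exists m0.-1; rewrite prednK// (leq_ltn_trans _ Mm).
pose v p := coord (z p) m0; pose p0 := [arg min_(p < ord0) `|v p|]%O.
have p0P p : `|v p0| <= `|v p| by rewrite /p0; case: arg_minP => // i _ h; exact: h.
have qv p : coord (z p) m = q (v p) by rewrite /v em coord_orbit.
have qp0 p : q (v p) <= q (v p0) by rewrite -quad_norm -(quad_norm a (v p0)); apply: (quad_decr a0).
pose i1 p := if v p <= 0 then p else p0.
pose i2 p := if v p <= 0 then p0 else p.
have mono1 p p' : v p <= v p' -> coord (z (i1 p)) m <= coord (z (i1 p')) m.
  rewrite /i1 => vv; have [hp|hp] := leP (v p) 0; have [hp'|hp'] := leP (v p') 0; rewrite !qv//.
    exact: (quad_incr a0).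
  by have := lt_le_trans hp (le_trans vv hp'); rewrite ltxx.
have mono2 p p' : v p <= v p' -> coord (z (i2 p')) m <= coord (z (i2 p)) m.
  rewrite /i2 => vv; have [hp|hp] := leP (v p) 0; have [hp'|hp'] := leP (v p') 0; rewrite !qv//.
    by have := lt_le_trans hp (le_trans vv hp'); rewrite ltxx.
  by apply: (quad_decr a0) => //; exact: ltW.
have mm : (m < m0)%N by rewrite em.
have Mm' : (M <= m)%N by rewrite -ltnS -em.
exists i1, i2; split=> [p p' p'' h|p p'].
  split; apply: (family_btw_down mm Mm'); case/orP: h => /andP[h1 h2].
  - by apply/orP; left; rewrite !mono1.
  - by apply/orP; right; rewrite !mono1.
  - by apply/orP; right; rewrite !mono2.
  - by apply/orP; left; rewrite !mono2.
rewrite /i1 /i2; have [hp|hp] := leP (v p) 0; have [hp'|hp'] := leP (v p') 0.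
- by rewrite lerDl.
- exact: ler_distD.
- by rewrite [leRHS]addrC; exact: ler_distD.
- by rewrite lerDr.
Qed.

End Family.

(** The points lie on one arc, and by [arc_image] each iterate of g keeps or reverses their order.
    With [family_split] this makes 2 N monotone observables of range 1 - u, one of which jumps by
    eps / 2 between any two points. *)
Lemma family_count (g : X -> X) (c N M : nat) (l : 'I_c.+1 -> X) (eps : R) :
  ctrl g -> injective g -> no_fold a -> (0 < N)%N ->
  (forall i p p' m, (i < N)%N -> open_zero a (coord (iter i g (l p)) m) (coord (iter i g (l p')) m)) ->
  (forall p p', p != p' -> exists2 i, (i < N)%N &
    eps <= `|coord (iter i g (l p)) M - coord (iter i g (l p')) M|) ->
  c%:R * (eps / 2) <= N.*2%:R * (1 - u).
Proof.
move=> gc ginj nf N0 oz sep.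
have u1 := left_fix_leN1 a0 a2.
have /choice[m_ hm] : forall i, exists m0, (i < N)%N -> forall m, m <> m0 ->
    (forall p, coord (iter i g (l p)) m <= 0) \/ (forall p, 0 <= coord (iter i g (l p)) m).
  move=> i; have [iN|_] := ltnP i N; last by exists 0%N.
  have [m0 h] := @family_fold c (fun p => iter i g (l p)) nf (fun p p' m => oz i p p' m iN).
  by exists m0.
have /choice[I hI] : forall i, exists I : bool -> 'I_c.+1 -> 'I_c.+1, (i < N)%N ->
    (forall b p p' p'', btw (coord (iter i g (l p)) (m_ i)) (coord (iter i g (l p')) (m_ i)) (coord (iter i g (l p'')) (m_ i)) ->
    btw (coord (iter i g (l (I b p))) M) (coord (iter i g (l (I b p'))) M) (coord (iter i g (l (I b p''))) M)) /\
    (forall p p', `|coord (iter i g (l p)) M - coord (iter i g (l p')) M| <=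
      `|coord (iter i g (l (I false p))) M - coord (iter i g (l (I false p'))) M| +
      `|coord (iter i g (l (I true p))) M - coord (iter i g (l (I true p'))) M|).
  move=> i; have [iN|_] := ltnP i N; last by exists (fun _ => id).
  have [i1 [i2 [h1 h2]]] := @family_split c (fun p => iter i g (l p)) (m_ i) (hm i iN) M.
  exists (fun b => if b then i2 else i1) => _; split => // b p p' p'' /h1[].
  by case: b.
have iinj i : injective (iter i g) by elim: i => //= i IH x y /ginj/IH.
pose key p := coord (l p) (m_ 0%N).
have side m p p' : (m_ 0%N < m)%N -> (coord (l p) m <= 0 /\ coord (l p') m <= 0) \/
    (0 <= coord (l p) m /\ 0 <= coord (l p') m).
  move=> mm; have [|s|s] := hm 0%N N0 m; last by right; split; exact: (s _).
    by move=> e; move: mm; rewrite e ltnn.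
  by left; split; exact: (s _).
have key_inj p p' : key p = key p' -> l p = l p'.
  move=> e; apply: (in_arc_inj a0 a2 (fun m h => side m p p' h)) => // m _; first exact: btwxx.
  by rewrite btw_sym; exact: btwxx.
have order i p p' p'' : (i < N)%N -> key p <= key p' -> key p' <= key p'' ->
    btw (coord (iter i g (l p)) (m_ i)) (coord (iter i g (l p')) (m_ i)) (coord (iter i g (l p'')) (m_ i)).
  move=> iN k1 k2.
  have up := @family_btw_up c (fun p => iter i g (l p)) (m_ i) (hm i iN).
  (* If the wrong point is in the middle after i steps, [arc_image] puts it in the middle for the
     key as well; two keys are then equal and two points coincide. *)
  have [//|h|h] := btw_case (coord (iter i g (l p)) (m_ i)) (coord (iter i g (l p')) (m_ i)) (coord (iter i g (l p'')) (m_ i)).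
  - have := arc_image a0 a2 (m0 := m_ 0%N) (m1 := m_ i) (A := l p) (B := l p') (C := l p'') (ctrl_iter i gc) (@iinj i)
      (fun m h => side m p' p'' h) (fun m mm => up p' p p'' m mm h).
    rewrite -/(key p) -/(key p') -/(key p'') => kb.
    have /key_inj -> : key p = key p'.
      by apply: le_anti; rewrite k1 /=; case/orP: kb => /andP[h1 h2] //; exact: (le_trans k2).
    exact: btwxx.
  - have := arc_image a0 a2 (m0 := m_ 0%N) (m1 := m_ i) (A := l p'') (B := l p) (C := l p') (ctrl_iter i gc) (@iinj i)
      (fun m h => side m p p' h) (fun m mm => up p p'' p' m mm h).
    rewrite -/(key p) -/(key p') -/(key p'') => kb.
    have /key_inj -> : key p' = key p''.
      by apply: le_anti; rewrite k2 /=; case/orP: kb => /andP[h1 h2] //; exact: (le_trans h2).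
    by rewrite btw_sym; exact: btwxx.
(* The index k stands for the time [k./2] and, by its parity, for a part of the split. *)
have := @monotone_count R 'I_c.+1 (fun=> True) key N.*2 (eps / 2)
  (fun k p => coord (iter k./2 g (l (I k./2 (odd k) p))) M) (fun=> 1 - u) (enum 'I_c.+1).
rewrite size_enum_ord sumr_const card_ord -(mulr_natl (1 - u)) /=; apply => //.
- by move=> k _; lra.
- exact: enum_uniq.
- move=> p p' _ _ pp; have [i iN hi] := sep p p' pp; have [_ h] := hI i iN.
  have := le_trans hi (h p p'); rewrite {1}(splitr eps) => h2.
  have [h3|h3] := leP (eps / 2) `|coord (iter i g (l (I i false p))) M - coord (iter i g (l (I i false p'))) M|.
    by exists i.*2; rewrite ?ltn_double// doubleK odd_double.
  exists i.*2.+1; first by rewrite ltn_Sdouble.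
  rewrite -[i.*2.+1]/(true + i.*2)%N half_bit_double oddD odd_double /=.
  by move: h2 h3; move: `|_| `|_| (eps / 2) => x y e; lra.
- move=> k p p' p'' kN _ _ _ k1 k2; have iN : (k./2 < N)%N by rewrite ltn_half_double.
  by have [h _] := hI _ iN; apply: h; exact: order.
- by move=> k p p' _ _ _; exact: coord_width.
Qed.

End NullFamily.

Section NullRelated.
Context {R : realType}.
Variable a : R.
Hypotheses (a0 : 0 < a) (a2 : a <= 2).
Local Notation u := (left_fix a).
Local Notation X := (invlim a).
Local Notation coord := Defs.coord.
Local Notation L := (quad_lip a).

Lemma ultra_forall (U : set_system nat) (P : nat -> nat -> Prop) n : UltraFilter U ->
  (forall i, (i < n)%N -> U [set j | P i j]) -> U [set j | forall i, (i < n)%N -> P i j].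
Proof.
move=> UU; elim: n => [|n IH] h.
  by apply: (@filterS _ U _ setT) => [j _ //|]; exact: filterT.
have h1 : U [set j | forall i, (i < n)%N -> P i j] by apply: IH => i /ltnW; exact: h.
apply: filterS (filterI h1 (h n (leqnn _))) => j [/= h2 h3] i.
by rewrite ltnS leq_eqVlt => /orP[/eqP -> //|]; exact: h2.
Qed.

Lemma strict_near (x s y : R) : x < s < y \/ y < s < x -> exists2 e, 0 < e &
  forall x' y', `|x' - x| < e -> `|y' - y| < e -> btw x' s y'.
Proof.
move=> h; exists (Num.min `|s - x| `|s - y|).
  by rewrite lt_min !normr_gt0 !subr_eq0; case: h => /andP[h1 h2]; rewrite ?(gt_eqF h1) ?(lt_eqF h1) ?(gt_eqF h2) ?(lt_eqF h2).
move=> x' y'; rewrite !lt_min !ltr_norml => /andP[/andP[h1 h2] /andP[h3 h4]] /andP[/andP[h5 h6] /andP[h7 h8]].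
case: h => /andP[hx hy]; apply/orP; [left|right]; apply/andP; split; apply: ltW.
- by move: h2; rewrite gtr0_norm ?subr_gt0//; lra.
- by move: h7; rewrite ltr0_norm ?subr_lt0//; lra.
- by move: h8; rewrite gtr0_norm ?subr_gt0//; lra.
- by move: h1; rewrite ltr0_norm ?subr_lt0//; lra.
Qed.

Lemma small_le n (d d' s t : R) : d <= d' -> small a n d s t -> small a n d' s t.
Proof. by move=> dd sm x y hx hy; apply: lt_le_trans dd; exact: sm. Qed.

Definition separated_at (g : X -> X) (N M : nat) (eps : R) (y y' : X) : Prop :=
  exists2 i, (i < N)%N & eps <= `|coord (iter i g y) M - coord (iter i g y') M|.

(** What equal codes give: up to delta, the coordinates at each time of a block span intervals that
    q makes shorter than d. *)
Definition null_related (g : X -> X) (N M : nat) (delta d : R) (y y' : X) : Prop :=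
  forall i, (i < N)%N -> exists w w' : X, [/\ `|coord w M - coord (iter i g y) M| < delta,
    `|coord w' M - coord (iter i g y') M| < delta &
    forall m, (m <= M)%N -> exists n, small a n d (coord w m) (coord w' m)].

(** By compactness: counterexamples with d and delta tending to 0 have as limit c + 1 points, still
    separated, whose coordinates span contracted open intervals. This contradicts [family_count], c
    being larger than its bound. *)
Lemma null_related_count (g : X -> X) (N M : nat) (eps : R) : ctrl g -> injective g -> no_fold a ->
  (0 < N)%N -> 0 < eps ->
  exists d delta M1, [/\ 0 < d, 0 < delta & forall E : seq X, uniq E ->
    (forall y y', y \in E -> y' \in E -> y != y' -> separated_at g N M eps y y') ->
    (forall y y', y \in E -> y' \in E -> y != y' -> null_related g N M1 delta d y y') ->
    (size E <= (Num.truncn (N.*2%:R * (1 - u) / (eps / 2))).+1)%N].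
Proof.
move=> gc ginj nf N0 eps0; set c := (Num.truncn _).+1.
have L1 := quad_lip_ge1 a0; have L0 : 0 < L by apply: lt_le_trans L1.
apply: contrapT => nh.
(* The factor L^j turns closeness at index j into closeness at all smaller indices. *)
pose d_ (j : nat) : R := j.+1%:R^-1; pose delta_ (j : nat) : R := d_ j / L ^+ j.
have d_0 j : 0 < d_ j by rewrite invr_gt0.
have hj (j : nat) : exists y : 'I_c.+1 -> X, forall p p', p != p' ->
    separated_at g N M eps (y p) (y p') /\ null_related g N j (delta_ j) (d_ j) (y p) (y p').
  apply: contrapT => nj; apply: nh; exists (d_ j), (delta_ j), j; split => //.
    by rewrite divr_gt0// exprn_gt0.
  move=> E uE sep rel; rewrite leqNgt; apply/negP => cE; apply: nj.
  case: E => [//|x0 E0] in uE sep rel cE *; set E := x0 :: E0 in uE sep rel cE.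
  exists (fun p => nth x0 E p) => p p' pp.
  have pE (r : 'I_c.+1) : (r < size E)%N by apply: leq_trans (ltn_ord r) cE.
  have ne : nth x0 E p != nth x0 E p' by rewrite nth_uniq.
  by split; [apply: sep|apply: rel]; rewrite ?mem_nth.
have {hj nh}/choice[y hy] := hj.
have [U UU Uoo] := nat_ultra; have PU := @ultra_proper _ U UU.
have /choice[l hl] : forall p : 'I_c.+1, exists l : X, forall m e, 0 < e ->
    U [set j | `|coord (y j p) m - coord l m| < e].
  by move=> p; exact: (ultra_coord a0 a2 (fun j => y j p) UU).
have lim i p m e : 0 < e -> U [set j | `|coord (iter i g (y j p)) m - coord (iter i g (l p)) m| < e].
  move=> e0; have [Mi [eta eta0 hM]] := ctrl_iter i gc m e0.
  by apply: filterS (hl p Mi eta eta0) => j /=; exact: hM.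
have := @family_count R a a0 a2 g c N M l eps gc ginj nf N0.
have hsep p p' : p != p' -> exists2 i, (i < N)%N &
    eps <= `|coord (iter i g (l p)) M - coord (iter i g (l p')) M|.
  move=> pp; apply: contrapT => ns.
  have hs i : (i < N)%N -> U [set j | `|coord (iter i g (y j p)) M - coord (iter i g (y j p')) M| < eps].
    move=> iN; set s := `|coord (iter i g (l p)) M - coord (iter i g (l p')) M|.
    have seps : s < eps by rewrite ltNge; apply/negP => h; apply: ns; exists i.
    have e0 : 0 < (eps - s) / 2 by rewrite divr_gt0// subr_gt0.
    apply: filterS (filterI (lim i p M _ e0) (lim i p' M _ e0)) => j [/= h1 h2].
    apply: le_lt_trans (ler_distD (coord (iter i g (l p)) M) _ _) _.
    have h3 := ler_distD (coord (iter i g (l p')) M) (coord (iter i g (l p)) M) (coord (iter i g (y j p')) M).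
    rewrite -/s (distrC (coord (iter i g (l p')) M)) in h3.
    apply: le_lt_trans (lerD (lexx _) h3) _.
    by move: h1 h2; move: `|_| `|_| => A B; lra.
  have [j hj] := filter_ex (ultra_forall UU hs).
  have [[i iN] + _] := hy j p p' pp; apply/negP; rewrite -ltNge; exact: hj.
have hoz i p p' m : (i < N)%N -> open_zero a (coord (iter i g (l p)) m) (coord (iter i g (l p')) m).
  move=> iN; have [->|pp] := eqVneq p p'.
    by move=> s t [|] /andP[h1 /(lt_trans h1)]; rewrite ltxx.
  move=> s t /strict_near[e1 e10 h1] /strict_near[e2 e20 h2] d d0.
  pose e := Num.min e1 e2; have e0 : 0 < e by rewrite lt_min e10.
  have eh : 0 < e / 2 by rewrite divr_gt0.
  have [k hk] : exists k : nat, k.+1%:R^-1 < Num.min d (e / 2).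
    have m0 : 0 < Num.min d (e / 2) by rewrite lt_min d0.
    by exists (Num.truncn (Num.min d (e / 2))^-1); rewrite invf_plt ?posrE//; exact: truncnS_gt.
  have [j [/= [[hj1 hj2] hj3] hj4]] := filter_ex (filterI (filterI (filterI (lim i p m _ eh) (lim i p' m _ eh)) (Uoo m)) (Uoo k)).
  have [_ /(_ i iN)[w [w' [hw hw' sm]]]] := hy j p p' pp.
  have [n {}sm] := sm m hj3.
  have dj : d_ j < Num.min d (e / 2).
    by apply: le_lt_trans hk; rewrite lef_pV2 ?posrE// ler_nat ltnS.
  move: dj; rewrite lt_min => /andP[dj1 dj2].
  have close (v v' : X) x : `|coord v j - coord v' j| < delta_ j -> `|coord v' m - x| < e / 2 -> `|coord v m - x| < e.
    move=> hv hx; apply: le_lt_trans (ler_distD (coord v' m) _ _) _; rewrite (splitr e); apply: ltrD => //.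
    apply: le_lt_trans (coord_lip a0 a2 v v' hj3) _; apply: lt_trans dj2.
    apply: (@le_lt_trans _ _ (L ^+ j * `|coord v j - coord v' j|)).
      by rewrite ler_wpM2r// ler_weXn2l// leq_subr.
    by rewrite mulrC -ltr_pdivlMr// exprn_gt0.
  have c1 := close _ _ _ hw hj1; have c2 := close _ _ _ hw' hj2.
  exists n; apply: (small_le (ltW dj1)); move: c1 c2; rewrite !lt_min => /andP[c1 c1'] /andP[c2 c2'].
  by apply: small_sub sm; [exact: h1|exact: h2].
move=> /(_ hoz hsep); apply/negP; rewrite -ltNge -ltr_pdivrMr ?divr_gt0//.
exact: truncnS_gt.
Qed.

End NullRelated.

Lemma btw_excl (R : realType) (x y w : R) : ~~ btw 0 x y -> btw 0 x w -> btw x y w -> btw y x w.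
Proof.
rewrite /btw negb_or !negb_and -!ltNge => /andP[h1 h2] /orP[/andP[h3 h4]|/andP[h3 h4]] /orP[/andP[h5 h6]|/andP[h5 h6]];
apply/orP; move: h1 h2 => /orP[h1|h1] /orP[h2|h2];
solve [left; apply/andP; split; lra | right; apply/andP; split; lra | exfalso; lra].
Qed.

Lemma btw_excl2 (R : realType) (x y w : R) : ~~ btw 0 x y -> btw 0 x w -> btw y w x -> btw y x w.
Proof.
rewrite /btw negb_or !negb_and -!ltNge => /andP[h1 h2] /orP[/andP[h3 h4]|/andP[h3 h4]] /orP[/andP[h5 h6]|/andP[h5 h6]];
apply/orP; move: h1 h2 => /orP[h1|h1] /orP[h2|h2];
solve [left; apply/andP; split; lra | right; apply/andP; split; lra | exfalso; lra].
Qed.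

(** * The trap around a returning turning point *)

Section Trap.
Context {R : realType}.
Variable a : R.
Hypotheses (a0 : 0 < a) (a2 : a <= 2).
Local Notation q := (quad a).
Local Notation u := (left_fix a).
Local Notation L := (quad_lip a).

Lemma iter_quad_distN n (x y : R) : `|iter n q (- x) - iter n q (- y)| = `|iter n q x - iter n q y|.
Proof.
case: n => [|n]; last by rewrite !iter_quadN.
by rewrite /= opprK addrC distrC.
Qed.

Lemma norm_itv (x k : R) : 0 <= k -> k <= - u -> `|x| <= k -> u <= x <= - u.
Proof. by move=> k0 ku; rewrite ler_norml => /andP[? ?]; apply/andP; split; lra. Qed.

Lemma iter_quad_itvN n v : u <= v <= - u -> u <= iter n q v <= - u.
Proof. by move=> hv; elim: n => //= n IH; apply: itvN => //; exact: quad_itvN. Qed.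

Lemma small_later n m d s t : u <= s <= - u -> u <= t <= - u -> (n <= m)%N ->
  small a n d s t -> small a m (L ^+ (m - n) * d) s t.
Proof.
move=> hs ht nm sm x y hx hy.
have L0 : 0 < L by apply: lt_le_trans (quad_lip_ge1 a0).
have I v : btw s v t -> u <= v <= - u.
  move: hs ht => /andP[h1 h2] /andP[h3 h4].
  by move=> /orP[/andP[h5 h6]|/andP[h5 h6]]; [rewrite (le_trans h1 h5) (le_trans h6)|rewrite (le_trans h3 h5) (le_trans h6)].
rewrite -(subnK nm) !iterD addnK.
apply: le_lt_trans (iter_quad_dist a0 a2 _ (iter_quad_itvN n (I _ hx)) (iter_quad_itvN n (I _ hy))) _.
by rewrite ltr_pM2l ?exprn_gt0//; exact: sm.
Qed.

Variables (s0 : R) (p : nat).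
Hypotheses (p0 : (0 < p)%N) (s00 : 0 <= s0) (ps0 : iter p q s0 = 0).

Definition trap (k : R) := [/\ 0 < k, s0 <= k, k <= - u & zero a 0 k].

Lemma trap_small k e : trap k -> 0 < e -> exists j, small a (p * j.+1) e 0 k.
Proof.
move=> [k0 sk ku zk] e0.
have L1 := quad_lip_ge1 a0; have L0 : 0 < L by apply: lt_le_trans L1.
have [n sm] := zk (e / L ^+ p) (divr_gt0 e0 (exprn_gt0 p L0)).
have u1 := left_fix_leN1 a0 a2.
exists (n %/ p)%N; have nm : (n <= p * (n %/ p).+1)%N by rewrite mulnC ltnW// ltn_ceil.
have I0 : u <= (0 : R) <= - u by apply/andP; split; lra.
have Ik : u <= k <= - u by rewrite ku andbT; lra.
apply: small_le (small_later I0 Ik nm sm).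
apply: (@le_trans _ _ (L ^+ p * (e / L ^+ p))); last first.
  by rewrite mulrC divfK// gt_eqF// exprn_gt0.
apply: ler_wpM2r; first by rewrite divr_ge0 ?exprn_ge0 ?ltW.
rewrite ler_weXn2l// leq_subLR mulnS mulnC addnC leq_add2r; exact: leq_trunc_div.
Qed.

(** Otherwise the image of [0, k] under q^p contains 0, the image of s0, and a point of modulus
    greater than k, hence a copy of [0, k] up to sign. As q is even this repeats, and the images at
    times p j never get shorter than k. *)
Lemma trap_invariant k x : trap k -> `|x| <= k -> `|iter p q x| <= k.
Proof.
move=> tk xk; have [k0 sk ku zk] := tk; rewrite leNgt; apply/negP => kv.
have ev : iter p q x = iter p q `|x|.
  by case: (leP 0 x) => h; [rewrite ger0_norm|rewrite ltr0_norm// iter_quadN].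
set x' := `|x| in xk ev; have x'0 : 0 <= x' by exact: normr_ge0.
rewrite ev in kv; set v := iter p q x' in kv.
have [sg [hsg pre]] : exists sg : R, (sg = 1 \/ sg = -1) /\
    forall w, 0 <= w <= k -> exists2 y, 0 <= y <= k & iter p q y = sg * w.
  have ivt w : btw 0 w v -> exists2 y, 0 <= y <= k & iter p q y = w.
    move=> hw; have [|y hy ye] := @iter_quad_ivt R a p s0 x' w; first by rewrite ps0.
    exists y => //.
    by case/orP: hy => /andP[h1 h2]; [rewrite (le_trans s00 h1) (le_trans h2)|rewrite (le_trans x'0 h1) (le_trans h2)].
  have [v0|v0] := leP 0 v.
    exists 1; split; [by left|move=> w /andP[w0 wk]]; apply: ivt; rewrite mul1r /btw w0 /=.
    by apply/orP; left; rewrite (le_trans wk)// ltW//; move: kv; rewrite ger0_norm.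
  exists (-1); split; [by right|move=> w /andP[w0 wk]]; apply: ivt.
  rewrite mulN1r /btw oppr_le0 w0 andbT; apply/orP; right.
  by rewrite lerNr (le_trans wk)// ltW//; move: kv; rewrite ltr0_norm.
have far j : exists x1 x2, [/\ 0 <= x1 <= k, 0 <= x2 <= k &
    k <= `|iter (p * j) q x1 - iter (p * j) q x2|].
  elim: j => [|j [x1 [x2 [h1 h2 h12]]]].
    by exists k, 0; rewrite muln0 /= subr0 ger0_norm ?lexx ?(ltW k0).
  have [y1 i1 e1] := pre x1 h1; have [y2 i2 e2] := pre x2 h2.
  exists y1, y2; split => //; rewrite mulnSr !iterD e1 e2.
  by case: hsg => ->; rewrite ?mul1r// !mulN1r iter_quad_distN.
have [j sm] := trap_small tk k0; have [x1 [x2 [h1 h2]]] := far j.+1.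
by apply/negP; rewrite -ltNge; apply: sm; rewrite /btw ?h1 ?h2.
Qed.

Lemma trap_shrink k e : trap k -> 0 < e -> exists n0, forall n x y, (n0 <= n)%N ->
  `|x| <= k -> `|y| <= k -> `|iter n q x - iter n q y| < e.
Proof.
move=> tk e0; have [k0 sk ku zk] := tk.
have L1 := quad_lip_ge1 a0; have L0 : 0 < L by apply: lt_le_trans L1.
have [j sm] := trap_small tk (divr_gt0 e0 (exprn_gt0 p L0)).
exists (p * j.+1)%N => n x y nj xk yk.
have inv i v : `|v| <= k -> `|iter (p * i) q v| <= k.
  move=> vk; elim: i => [|i IH]; first by rewrite muln0.
  by rewrite mulnS iterD; exact: trap_invariant.
pose i := ((n - p * j.+1) %/ p)%N; pose r := ((n - p * j.+1) %% p)%N.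
have en : n = (r + (p * j.+1 + p * i))%N.
  by rewrite addnCA (addnC r) (mulnC p i) -divn_eq subnKC.
have m0 : (0 < p * j.+1)%N by rewrite muln_gt0 p0.
have core v : `|v| <= k -> exists2 w, 0 <= w <= k & iter (p * j.+1 + p * i) q v = iter (p * j.+1) q w.
  move=> vk; exists `|iter (p * i) q v|; first by rewrite normr_ge0 inv.
  rewrite iterD; case: (leP 0 (iter (p * i) q v)) => h; first by rewrite ger0_norm.
  by rewrite ltr0_norm// iter_quadN.
have [x' hx ex] := core x xk; have [y' hy ey] := core y yk.
have I v : 0 <= v <= k -> u <= v <= - u.
  by move=> /andP[v0 vk]; apply: norm_itv (ltW k0) ku _; rewrite ger0_norm.
rewrite en 2!(iterD r) ex ey.
apply: le_lt_trans (iter_quad_dist a0 a2 _ (iter_quad_itvN _ (I _ hx)) (iter_quad_itvN _ (I _ hy))) _.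
have h : `|iter (p * j.+1) q x' - iter (p * j.+1) q y'| < e / L ^+ p by apply: sm; rewrite /btw ?hx ?hy.
apply: (@lt_le_trans _ _ (L ^+ r * (e / L ^+ p))); first by rewrite ltr_pM2l// exprn_gt0.
rewrite mulrA ler_pdivrMr ?exprn_gt0// mulrC ler_pM2l// ler_weXn2l// ltnW// ltn_mod//.
Qed.

Local Notation crit i := (iter i q 0).

Lemma crit_itv i : u <= crit i <= - u.
Proof.
by apply: iter_quad_itvN; have := left_fix_leN1 a0 a2; move=> ?; apply/andP; split; lra.
Qed.

Lemma crit_norm_itv i : `|crit i| <= - u.
Proof. by have /andP[h1 h2] := crit_itv i; rewrite ler_norml opprK h1. Qed.

Lemma zero_norm x : zero a 0 x -> zero a 0 `|x|.
Proof.
by case: (leP 0 x) => h; [rewrite ger0_norm|rewrite ltr0_norm// -{2}oppr0 => /zero_opp].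
Qed.

Lemma zero_max k k' : zero a 0 k -> zero a 0 k' -> zero a 0 (Num.max k k').
Proof. by case: leP. Qed.

Lemma zero_trap k x : trap k -> `|x| <= k -> zero a 0 x.
Proof.
move=> [k0 sk ku zk] xk; have z : zero a 0 `|x|.
  by apply: zero_sub zk; [exact: btwxx|rewrite /btw normr_ge0 xk].
case: (leP 0 x) z => h; first by rewrite ger0_norm.
by rewrite ltr0_norm// => /zero_opp; rewrite opprK oppr0.
Qed.

Hypothesis trap0 : exists k, trap k.

(** By invariance under q^p it suffices to enlarge the trap by the first suitable point of the
    critical orbit in each residue class modulo p. *)
Lemma trap_critical : exists2 k, trap k & forall i, zero a 0 (crit i) -> `|crit i| <= k.
Proof.
have [k0 tk0] := trap0.
have key m : exists2 k, trap k & forall i, zero a 0 (crit i) -> (i %% p < m)%N -> `|crit i| <= k.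
  elim: m => [|m [k tk hk]]; first by exists k0.
  have [[i0 zi0 im0]|nz] := pselect (exists2 i, zero a 0 (crit i) & (i %% p = m)%N); last first.
    exists k => // i zi; rewrite ltnS leq_eqVlt => /orP[/eqP im|]; last exact: hk.
    by exfalso; apply: nz; exists i.
  have ex : exists i, `[< zero a 0 (crit i) /\ (i %% p = m)%N >] by exists i0; apply/asboolP.
  case: (ex_minnP ex) => i1 /asboolP[zi1 im1] min1.
  have [kk0 sk ku zk] := tk.
  have tk' : trap (Num.max k `|crit i1|).
    split; [by rewrite lt_max kk0|by rewrite le_max sk|by rewrite ge_max ku crit_norm_itv|].
    by apply: zero_max => //; exact: zero_norm.
  exists (Num.max k `|crit i1|) => // i zi; rewrite ltnS leq_eqVlt => /orP[/eqP im|im]; last first.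
    by rewrite le_max hk.
  have i1i : (i1 <= i)%N by apply: min1; apply/asboolP.
  have [j ->] : exists j, i = (p * j + i1)%N.
    exists ((i - i1) %/ p)%N; rewrite mulnC divnK ?subnK//.
    by rewrite -eqn_mod_dvd// im im1.
  elim: j => [|j IH]; first by rewrite muln0 le_max lexx orbT.
  by rewrite mulnS -addnA iterD; exact: trap_invariant.
have [k tk hk] := key p; by exists k => // i zi; apply: hk => //; rewrite ltn_mod.
Qed.

Lemma min_pos (P : nat -> R -> Prop) n : (forall i d d', 0 < d' -> d' <= d -> P i d -> P i d') ->
  (forall i, (i < n)%N -> exists2 d, 0 < d & P i d) ->
  exists2 d, 0 < d & forall i, (i < n)%N -> P i d.
Proof.
move=> mono; elim: n => [|n IH] h; first by exists 1.
have [d d0 hd] := IH (fun i h' => h i (ltnW h')); have [e e0 he] := h n (leqnn _).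
have m0 : 0 < Num.min d e by rewrite lt_min d0.
exists (Num.min d e) => // i; rewrite ltnS leq_eqVlt => /orP[/eqP -> |/hd hi].
  by apply: mono he => //; rewrite ge_min lexx orbT.
by apply: mono hi => //; rewrite ge_min lexx.
Qed.

Lemma zero_gap i : ~ zero a 0 (crit i) -> exists2 d, 0 < d & forall n, ~ small a n d 0 (crit i).
Proof.
move=> nz; apply: contrapT => h; apply: nz => d d0; apply: contrapT => hn; apply: h.
by exists d => // n sm; apply: hn; exists n.
Qed.

(** A gap uniform in i. In a residue class modulo p that contains a contracted case, all later
    points of the class are in the trap. In another class, with residue m, [crit i] is asymptotic to
    [crit m], because [crit (p * j)] is in the trap, and the gap of [crit m] serves for all. *)
Lemma crit_gap : exists2 d, 0 < d & forall i r, small a r d 0 (crit i) -> zero a 0 (crit i).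
Proof.
have [k tk hk] := trap_critical; have [k0 sk ku zk] := tk.
have L1 := quad_lip_ge1 a0; have L0 : 0 < L by apply: lt_le_trans L1.
suff [d d0 hd] : exists2 d, 0 < d & forall m, (m < p)%N -> forall i r, (i %% p = m)%N ->
    small a r d 0 (crit i) -> zero a 0 (crit i).
  by exists d => // i r; apply: (hd (i %% p)%N); rewrite ?ltn_mod.
apply: (@min_pos (fun m d => forall i r, (i %% p = m)%N -> small a r d 0 (crit i) -> zero a 0 (crit i))).
  by move=> m d d' _ dd h i r im sm; apply: (h i r im); exact: small_le sm.
move=> m mp; have [[i0 zi0 im0]|nz] := pselect (exists2 i, zero a 0 (crit i) & (i %% p = m)%N).
  have [d d0 hd] : exists2 d, 0 < d & forall i, (i < i0)%N -> forall r, small a r d 0 (crit i) -> zero a 0 (crit i).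
    apply: (@min_pos (fun i d => forall r, small a r d 0 (crit i) -> zero a 0 (crit i))).
      by move=> i d d' _ dd h r sm; apply: (h r); exact: small_le sm.
    move=> i _; have [z|/zero_gap[d d0 hd]] := pselect (zero a 0 (crit i)); first by exists 1.
    by exists d => // r /hd.
  exists d => // i r im sm; have [ii|ii] := ltnP i i0; first exact: hd sm.
  apply: (zero_trap tk).
  have [j ->] : exists j, i = (p * j + i0)%N.
    exists ((i - i0) %/ p)%N; rewrite mulnC divnK ?subnK//.
    by rewrite -eqn_mod_dvd// im im0.
  elim: j => [|j IH]; first by rewrite muln0; exact: hk.
  by rewrite mulnS -addnA iterD; exact: trap_invariant.
have [|d d0 hd] := @zero_gap m; first by move=> z; apply: nz; exists m => //; rewrite modn_small.
have d40 : 0 < d / 4 by rewrite divr_gt0.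
have [r1 hr1] := trap_shrink tk d40.
(* The factor L^r1 lets a smallness that occurs before r1 last until r1, when the trap has shrunk
   below d / 4. *)
exists (d / 4 / L ^+ r1); first by rewrite divr_gt0// exprn_gt0.
move=> i r im sm; exfalso.
have [r' r1r' {}sm] : exists2 r', (r1 <= r')%N & small a r' (d / 4) 0 (crit i).
  have Lr : 1 <= L ^+ r1 by rewrite exprn_ege1.
  have [rr|rr] := leqP r1 r.
    exists r => //; apply: small_le sm; rewrite ler_pdivrMr ?exprn_gt0// ler_peMr// ltW//.
  exists r1 => //; apply: small_le (small_later (crit_itv 0) (crit_itv i) (ltnW rr) sm).
  rewrite mulrA ler_pdivrMr ?exprn_gt0// mulrC ler_pM2l// ler_weXn2l// leq_subr//.
have [j ij] : exists j, i = (m + p * j)%N.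
  by exists (i %/ p)%N; rewrite {1}(divn_eq i p) addnC mulnC im.
have ck : `|crit (p * j)| <= k.
  by elim: (j) => [|j' IH]; [rewrite muln0 normr0 ltW|rewrite mulnS iterD; exact: trap_invariant].
have k0' : `|0 : R| <= k by rewrite normr0 ltW.
(* A point between 0 and [crit m] is either between 0 and [crit i], or between [crit i] and
   [crit m], and then it is the image of a point of the trap. *)
have near0 x : btw 0 x (crit m) -> `|iter r' q x - iter r' q 0| < d / 2.
  move=> hx; have i0c : `|iter r' q (crit i) - iter r' q 0| < d / 4.
    by apply: sm; [rewrite btw_sym; exact: btwxx|exact: btwxx].
  have d42 : d / 4 + d / 4 = d / 2 by lra.
  have [h|h] := boolP (btw 0 x (crit i)).
    apply: (@lt_trans _ _ (d / 4)); first by apply: sm => //; exact: btwxx.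
    by rewrite -d42 ltrDl.
  have hx' : btw (crit i) x (crit m).
    have [h1|h1|h1] := btw_case (crit i) x (crit m) => //.
      by move: h hx h1; rewrite /btw; exact: btw_excl.
    by move: h hx h1; rewrite /btw; exact: btw_excl2.
  have [|w hw we] := @iter_quad_ivt R a m (crit (p * j)) 0 x.
    by rewrite -iterD -ij.
  have wk : `|w| <= k.
    by apply: le_trans ck; case/orP: hw => /andP[h1 h2];
       [rewrite (ler0_norm h2) ler0_norm ?(le_trans h1)// lerN2|rewrite (ger0_norm h1) ger0_norm ?(le_trans h1)].
  apply: le_lt_trans (ler_distD (iter r' q (crit i)) _ _) _; rewrite -d42; apply: ltrD => //.
  have -> : iter r' q x = iter (r' + m) q w by rewrite iterD we.
  have -> : iter r' q (crit i) = iter (r' + m) q (crit (p * j)) by rewrite ij !iterD.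
  apply: hr1 => //.
  by rewrite (leq_trans r1r')// leq_addr.
apply: (hd r') => x y hx hy; apply: le_lt_trans (ler_distD (iter r' q 0) _ _) _.
by rewrite (splitr d); apply: ltrD; [exact: near0|rewrite distrC; exact: near0].
Qed.

Lemma trap_fixpoint k : trap k -> exists2 z, `|z| <= k & iter p q z = z.
Proof.
move=> tk; have [k0 sk ku zk] := tk.
have inv x : `|x| <= k -> `|iter p q x| <= k by exact: trap_invariant.
have kk : - k <= k by lra.
have [||z hz hz0] := @IVT R (fun x => iter p q x - x) (- k) k 0 kk.
- apply: continuous_subspaceT => x; apply: cvgB; first exact: continuous_iter_quad.
  exact: cvg_id.
- have := inv (- k); have := inv k; rewrite normrN gtr0_norm// lexx.
  move=> /(_ isT); rewrite ler_norml => /andP[h1 h2] /(_ isT); rewrite ler_norml => /andP[h3 h4].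
  by rewrite ge_min le_max; apply/andP; split; apply/orP; [right|left]; lra.
- exists z; last by apply/eqP; rewrite -subr_eq0 hz0.
  by move: hz; rewrite in_itv/= ler_norml.
Qed.

(** The points 0, z and [crit i] of the trap are asymptotic. At a large multiple of p, the image of
    [crit i] is close to z; being also an image of 0 at a time i later, it is close to
    [iter i q z]. *)
Lemma trap_fixpoint_crit k z i : trap k -> `|z| <= k -> iter p q z = z -> `|crit i| <= k ->
  iter i q z = z.
Proof.
move=> tk zk pz ik; apply/eqP; rewrite -subr_eq0 -normr_le0; apply/ler_addgt0Pr => e e0.
have [k0 _ _ _] := tk; rewrite add0r.
have e20 : 0 < e / 2 by rewrite divr_gt0.
have [n0 hn] := trap_shrink tk e20.
have pzj j : iter (p * j) q z = z by elim: j => [|j IH]; rewrite ?muln0// mulnS iterD IH.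
have pn : (n0 <= p * n0)%N by rewrite leq_pmull.
have h1 : `|iter (p * n0) q (crit i) - iter (p * n0) q z| < e / 2 by apply: hn.
have h2 : `|iter (p * n0 + i) q z - iter (p * n0 + i) q 0| < e / 2.
  by apply: hn; rewrite ?(leq_trans pn) ?leq_addr// normr0 ltW.
rewrite -[X in _ - X](pzj n0) -[X in iter i q X](pzj n0) -iterD addnC iterD.
rewrite -iterD; apply: ltW; rewrite (splitr e).
apply: le_lt_trans (ler_distD (iter (p * n0 + i) q 0) _ _) _; apply: ltrD => //.
by rewrite iterD.
Qed.

Lemma trap_facts : exists k z d, [/\ 0 < k, `|z| <= k, 0 < d,
  forall e, 0 < e -> exists n0, forall n x y, (n0 <= n)%N ->
    `|x| <= k -> `|y| <= k -> `|iter n q x - iter n q y| < e &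
  forall i r, small a r d 0 (crit i) -> `|crit i| <= k /\ iter i q z = z].
Proof.
have [k tk hk] := trap_critical; have [z zk pz] := trap_fixpoint tk.
have [d d0 hd] := crit_gap; have [k0 _ _ _] := tk.
exists k, z, d; split=> // [e|i r /hd/hk ik]; first exact: trap_shrink.
by split=> //; exact: trap_fixpoint_crit tk zk pz ik.
Qed.

End Trap.

(** * Large oscillations on contracted intervals *)

Section FoldCount.
Context {R : realType}.
Variable a : R.
Hypotheses (a0 : 0 < a) (a2 : a <= 2).
Local Notation q := (quad a).
Local Notation u := (left_fix a).
Local Notation L := (quad_lip a).
Local Notation crit i := (iter i q 0).

Lemma btw_step (x y z w : R) : btw x y z -> btw x z w -> btw y z w.
Proof.
rewrite /btw => /orP[/andP[h1 h2]|/andP[h1 h2]] /orP[/andP[h3 h4]|/andP[h3 h4]];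
apply/orP; solve [left; apply/andP; split; lra | right; apply/andP; split; lra].
Qed.

Lemma btw_step2 (x y z w : R) : btw x y z -> btw x z w -> btw x y w.
Proof. by move=> h1 h2; apply: btw_trans h1; [exact: btwxx|exact: h2]. Qed.

Lemma btw_rev (x y z w : R) : btw x y z -> btw x z w -> btw w z y.
Proof. by move=> h1 h2; rewrite btw_sym; exact: btw_step h2. Qed.

Definition mono_seq (s t : R) (x : nat -> R) (l : nat) : Prop :=
  (forall j, (j < l)%N -> btw s (x j) (x j.+1)) /\ btw s (x l) t.

Lemma mono_seq_btw s t x l j : mono_seq s t x l -> (j <= l)%N -> btw s (x j) t.
Proof.
move=> [h1 h2] jl; rewrite -(subKn jl); elim: (l - j)%N => [|k IH]; first by rewrite subn0.
have [lk|kl] := leqP l k; first by move: IH; rewrite (eqP (_ : l - k == 0)%N) ?subn_eq0// (eqP (_ : l - k.+1 == 0)%N)// subn_eq0 ltnW.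
apply: btw_step2 IH; have := h1 (l - k.+1)%N; rewrite subnSK//; apply.
exact: leq_subr.
Qed.

Lemma mono_seq_first s t x l j : mono_seq s t x l -> (j <= l)%N -> btw s (x 0%N) (x j).
Proof.
move=> [h1 h2]; elim: j => [|j IH] jl; first by rewrite btw_sym; exact: btwxx.
by apply: btw_step2 (IH (ltnW jl)) (h1 j jl).
Qed.

Lemma mono_seq_rev s t x l : mono_seq s t x l -> mono_seq t s (fun j => x (l - j)%N) l.
Proof.
move=> h; split=> [j jl|]; last by rewrite subnn btw_sym; exact: (mono_seq_btw h).
have jl' : (l - j.+1 < l)%N by rewrite ltn_subrL (leq_ltn_trans _ jl).
have := h.1 _ jl'; rewrite subnSK// => h1; apply: btw_rev h1 _.
by apply: (mono_seq_btw h); exact: leq_subr.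
Qed.

Lemma btw_itv (s t x : R) : u <= s <= 1 -> u <= t <= 1 -> btw s x t -> u <= x <= 1.
Proof.
move=> /andP[h1 h2] /andP[h3 h4] /orP[/andP[h5 h6]|/andP[h5 h6]].
  by rewrite (le_trans h1 h5) (le_trans h6).
by rewrite (le_trans h3 h5) (le_trans h6).
Qed.

Lemma jumps_lip (s t : R) x l r r0 eps : u <= s <= 1 -> u <= t <= 1 -> mono_seq s t x l -> (r <= r0)%N ->
  (forall j, (j < l)%N -> eps <= `|iter r q (x j.+1) - iter r q (x j)|) ->
  l%:R * eps <= L ^+ r0 * (1 - u).
Proof.
move=> hs ht h rr jumps.
have L1 := quad_lip_ge1 a0; have L0 : 0 < L by apply: lt_le_trans L1.
have xI j : (j <= l)%N -> u <= x j <= 1 by move=> jl; apply: btw_itv hs ht (mono_seq_btw h jl).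
apply: (@le_trans _ _ (L ^+ r * \sum_(j < l) `|x j.+1 - x j|)).
  rewrite mulr_sumr mulr_natl -[X in _ *+ X]card_ord -sumr_const; apply: ler_sum => j _.
  apply: (le_trans (jumps j (ltn_ord j))).
  by apply: iter_quad_dist => //; apply: itvN => //; apply: xI => //; exact: ltnW.
rewrite (btw_sum (v := x)); last first.
  by move=> i il; apply: btw_step (mono_seq_first h (ltnW il)) (h.1 i il).
apply: ler_pM; rewrite ?exprn_ge0 ?(ltW L0)//; first by rewrite ler_weXn2l.
have /andP[? ?] := xI l (leqnn _); have /andP[? ?] := xI 0%N (leq0n _).
by rewrite ler_norml; apply/andP; split; lra.
Qed.

Definition one_side (s t : R) := (s <= 0 /\ t <= 0) \/ (0 <= s /\ 0 <= t).

Lemma btw_quad_side (s t x y : R) : one_side s t -> btw s x t -> btw s y t -> btw s x y ->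
  btw (q s) (q x) (q y).
Proof.
move=> st hx hy; have [sx|sx] : (s <= 0 /\ x <= 0 /\ y <= 0) \/ (0 <= s /\ 0 <= x /\ 0 <= y).
- case: st => -[s0 t0]; [left|right]; (split=> //; split).
  + by case/orP: hx => /andP[h1 h2]; [exact: le_trans t0|exact: le_trans s0].
  + by case/orP: hy => /andP[h1 h2]; [exact: le_trans t0|exact: le_trans s0].
  + by case/orP: hx => /andP[h1 h2]; [exact: le_trans h1|exact: le_trans h1].
  + by case/orP: hy => /andP[h1 h2]; [exact: le_trans h1|exact: le_trans h1].
- case: sx => s0 [x0 y0] /orP[/andP[h1 h2]|/andP[h1 h2]]; apply/orP; [left|right];
  by apply/andP; split; apply: (quad_incr a0).
- case: sx => s0 [x0 y0] /orP[/andP[h1 h2]|/andP[h1 h2]]; apply/orP; [right|left];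
  by apply/andP; split; apply: (quad_decr a0).
Qed.

Lemma mono_seq_quad s t x l : one_side s t -> mono_seq s t x l ->
  mono_seq (q s) (q t) (fun j => q (x j)) l.
Proof.
move=> st h; split=> [j jl|].
  by apply: btw_quad_side st _ _ (h.1 j jl); apply: (mono_seq_btw h) => //; exact: ltnW.
by apply: btw_quad_side st _ _ h.2; [exact: h.2|rewrite btw_sym; exact: btwxx].
Qed.

Lemma side_case (s t : R) : [\/ one_side s t, s < 0 < t | t < 0 < s].
Proof.
rewrite /one_side; have [s0|s0] := leP s 0; have [t0|t0] := leP t 0.
- by constructor 1; left.
- have [->|sn] := eqVneq s 0; first by constructor 1; right; rewrite lexx ltW.
  by constructor 2; rewrite andbT lt_neqAle sn s0.
- have [->|tn] := eqVneq t 0; first by constructor 1; right; rewrite lexx ltW.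
  by constructor 3; rewrite andbT lt_neqAle tn t0.
- by constructor 1; right; rewrite !ltW.
Qed.

Variables (k z d : R).
Hypotheses (k0 : 0 < k) (zk : `|z| <= k)
  (shrink : forall e, 0 < e -> exists n0, forall n x y, (n0 <= n)%N ->
    `|x| <= k -> `|y| <= k -> `|iter n q x - iter n q y| < e)
  (critical : forall i r, small a r d 0 (crit i) -> `|crit i| <= k /\ iter i q z = z).

(* At a fold the part of the interval on the side of the critical orbit lies in
   the trap, so that all the jumps take place on the other side; the image of the
   fold is then again a critical value. *)
Lemma fold_count_crit eps : 0 < eps -> exists2 B, 1 - u <= B & forall r i be x l, u <= be <= 1 ->
  (exists2 n, (r <= n)%N & small a n d (crit i) be) -> mono_seq (crit i) be x l ->
  (forall j, (j < l)%N -> eps <= `|iter r q (x j.+1) - iter r q (x j)|) ->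
  eps / 2 <= `|iter r q (x 0%N) - iter (r + i) q z| -> l%:R * eps <= B.
Proof.
move=> eps0; have u1 := left_fix_leN1 a0 a2.
have L1 := quad_lip_ge1 a0; have L0 : 0 < L by apply: lt_le_trans L1.
have eps20 : 0 < eps / 2 by rewrite divr_gt0.
have [r0 hr0] := shrink eps20.
have zI : u <= (0 : R) <= 1 by apply/andP; split; lra.
exists (L ^+ r0 * (1 - u)).
  by rewrite ler_peMl ?exprn_ege1//; lra.
elim=> [|r IH] i be x l hbe [n rn sm] ms jumps far.
  exact: jumps_lip (iter_quad_itv a0 a2 i zI) hbe ms (leq0n _) jumps.
have [rr|rr] := leqP r.+1 r0.
  exact: jumps_lip (iter_quad_itv a0 a2 i zI) hbe ms rr jumps.
(* One step of q on a one-sided interval issued from the critical orbit. The index i' is i, or 0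
   after a cut at the turning point; in that case [iter i q z = z] preserves the condition on z. *)
have go i' : one_side (crit i') be -> mono_seq (crit i') be x l ->
    small a n d (crit i') be -> iter (r + i').+1 q z = iter (r + i).+1 q z -> l%:R * eps <= L ^+ r0 * (1 - u).
  move=> si ms' sm' ez; apply: (IH i'.+1 (q be) (fun j => q (x j)) l).
  - exact: quad_itvu.
  - have n0 : (0 < n)%N by apply: leq_ltn_trans rn.
    exists (n - 1)%N; first by rewrite leq_subRL.
    exact: (@small_push _ _ n 1 d (crit i') be).
  - exact: mono_seq_quad.
  - by move=> j jl; rewrite -!iterSr; exact: jumps.
  - by rewrite -iterSr addnS ez.
have [si|/andP[s0 t0]|/andP[t0 s0]] := side_case (crit i) be; first exact: (go i si ms sm erefl).
- have sub0 : btw (crit i) 0 be by rewrite /btw (ltW s0) (ltW t0).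
  have [ik iz] := critical (i := i) (r := n) (small_sub sub0 (btwxx _ _) sm).
  (* Otherwise the first point is in the trap, and after r0 steps within eps / 2 of the orbit of
     z. *)
  have x0pos : 0 < x 0%N.
    rewrite ltNge; apply/negP => x0; move: far; apply/negP; rewrite -ltNge iterD iz.
    apply: hr0 => //; first exact: ltnW.
    have /orP[/andP[h1 h2]|/andP[h1 h2]] := mono_seq_btw ms (leq0n l).
      by rewrite ler0_norm// (le_trans _ ik)// ltr0_norm// lerN2.
    by move: (lt_trans t0 (le_lt_trans h1 (le_lt_trans h2 s0))); rewrite ltxx.
  have pos j : (j <= l)%N -> 0 < x j.
    move=> jl; have /orP[/andP[h1 h2]|/andP[h1 h2]] := mono_seq_first ms jl; first exact: lt_le_trans h2.
    by move: (lt_trans x0pos (le_lt_trans h2 s0)); rewrite ltxx.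
  apply: (go 0%N).
  + by right; rewrite /= lexx ltW.
  + split=> [j jl|]; last first.
      have /orP[/andP[h1 h2]|/andP[h1 h2]] := ms.2.
        by rewrite /btw /= h2 andbT ltW//; exact: pos.
      by move: (lt_trans t0 (le_lt_trans h1 (le_lt_trans h2 s0))); rewrite ltxx.
    have /orP[/andP[h1 h2]|/andP[h1 h2]] := ms.1 j jl; first by rewrite /btw /= h2 andbT ltW// pos// ltnW.
    by move: (lt_trans (pos j (ltnW jl)) (le_lt_trans h2 s0)); rewrite ltxx.
  + by apply: small_sub sm => //; rewrite btw_sym; exact: btwxx.
  + by rewrite addn0 -addSn iterD iz.
- have sub0 : btw (crit i) 0 be by rewrite /btw (ltW s0) (ltW t0) orbT.
  have [ik iz] := critical (i := i) (r := n) (small_sub sub0 (btwxx _ _) sm).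
  have x0neg : x 0%N < 0.
    rewrite ltNge; apply/negP => x0; move: far; apply/negP; rewrite -ltNge iterD iz.
    apply: hr0 => //; first exact: ltnW.
    have /orP[/andP[h1 h2]|/andP[h1 h2]] := mono_seq_btw ms (leq0n l).
      by move: (lt_trans s0 (le_lt_trans h1 (le_lt_trans h2 t0))); rewrite ltxx.
    by rewrite ger0_norm// (le_trans h2)// (le_trans _ ik)// ger0_norm// ltW.
  have neg j : (j <= l)%N -> x j < 0.
    move=> jl; have /orP[/andP[h1 h2]|/andP[h1 h2]] := mono_seq_first ms jl; last exact: le_lt_trans x0neg.
    by move: (lt_trans s0 (le_lt_trans h1 x0neg)); rewrite ltxx.
  apply: (go 0%N).
  + by left; rewrite /= lexx ltW.
  + split=> [j jl|]; last first.
      have /orP[/andP[h1 h2]|/andP[h1 h2]] := ms.2.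
        by move: (lt_trans s0 (le_lt_trans h1 (le_lt_trans h2 t0))); rewrite ltxx.
      by rewrite /btw /= h1 orbC /= ltW//; exact: neg.
    have /orP[/andP[h1 h2]|/andP[h1 h2]] := ms.1 j jl; last by rewrite /btw /= h1 orbC /= ltW// neg// ltnW.
    by move: (lt_trans s0 (le_lt_trans h1 (neg j (ltnW jl)))); rewrite ltxx.
  + by apply: small_sub sm => //; rewrite btw_sym; exact: btwxx.
  + by rewrite addn0 -addSn iterD iz.
Qed.

(** The interval is pushed forward until 0 is inside and cut there into two intervals starting at 0.
    In each, dropping at most one jump makes the first point far from the orbit of z, as
    [fold_count_crit] requires; the jump across 0 adds eps. *)
Lemma fold_count eps : 0 < eps -> exists B : R, forall n m s t x l, u <= s <= 1 -> u <= t <= 1 ->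
  (n <= m)%N -> small a m d s t -> mono_seq s t x l ->
  (forall j, (j < l)%N -> eps <= `|iter n q (x j.+1) - iter n q (x j)|) -> l%:R * eps <= B.
Proof.
move=> eps0; have [B1 B1u hB1] := fold_count_crit eps0.
have u1 := left_fix_leN1 a0 a2.
have half n m be y l : u <= be <= 1 -> (n <= m)%N -> small a m d 0 be -> mono_seq 0 be y l ->
    (forall j, (j < l)%N -> eps <= `|iter n q (y j.+1) - iter n q (y j)|) -> l%:R * eps <= B1 + eps.
  move=> hbe nm sm ms jumps; case: l => [|l] in ms jumps *; first by rewrite mul0r; lra.
  have hs : exists2 m', (n <= m')%N & small a m' d (crit 0) be by exists m.
  have [h|h] := leP (eps / 2) `|iter n q (y 0%N) - iter (n + 0) q z|.
    by have := hB1 n 0%N be y l.+1 hbe hs ms jumps h; lra.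
  have ms' : mono_seq (crit 0) be (fun j => y j.+1) l.
    by split=> [j jl|]; [exact: (ms.1 j.+1)|exact: ms.2].
  have far : eps / 2 <= `|iter n q (y 1%N) - iter (n + 0) q z|.
    have := ler_distD (iter (n + 0) q z) (iter n q (y 1%N)) (iter n q (y 0%N)).
    have := jumps 0%N isT; rewrite (distrC (iter (n + 0) q z)).
    move: h; move: `|_| `|_| `|_| => A B C; lra.
  have := hB1 n 0%N be _ l hbe hs ms' (fun j jl => jumps j.+1 jl) far.
  by rewrite -addn1 natrD mulrDl mul1r lerD2r.
have fold n m s t x l : u <= s <= 1 -> u <= t <= 1 -> (n <= m)%N -> small a m d s t -> s < 0 < t ->
    mono_seq s t x l -> (forall j, (j < l)%N -> eps <= `|iter n q (x j.+1) - iter n q (x j)|) ->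
    l%:R * eps <= 2 * (B1 + eps) + eps.
  move=> hs ht nm sm /andP[s0 t0] ms jumps.
  have inc j : (j < l)%N -> x j <= x j.+1.
    move=> jl; have /orP[/andP[_ //]|/andP[h1 h2]] := ms.1 j jl.
    have /orP[/andP[h3 h4]|/andP[h3 h4]] := mono_seq_btw ms (ltnW jl).
      have /orP[/andP[h5 h6]|/andP[h5 h6]] := mono_seq_btw ms jl; first exact: (le_trans h2).
      by have := lt_trans s0 t0; rewrite ltNge (le_trans h5 h6).
    by have := lt_trans s0 t0; rewrite ltNge (le_trans h3 h4).
  have inc' := chain_nth_le inc.
  have xb j : (j <= l)%N -> s <= x j /\ x j <= t.
    move=> jl; have /orP[/andP[h3 h4]|/andP[h3 h4]] := mono_seq_btw ms jl; first by [].
    by have := lt_trans s0 t0; rewrite ltNge (le_trans h3 h4).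
  have sub0 : btw s 0 t by rewrite /btw (ltW s0) (ltW t0).
  have smt : small a m d 0 t by apply: small_sub sm => //; rewrite btw_sym; exact: btwxx.
  have sms : small a m d 0 s by apply: small_sub sm => //; exact: btwxx.
  have right c : (c <= l)%N -> 0 <= x c -> (l - c)%:R * eps <= B1 + eps.
    move=> cl c0; apply: (half n m t (fun j => x (c + j)%N) (l - c)%N) => //; last first.
      by move=> j jl; rewrite addnS; apply: jumps; rewrite -ltn_subRL.
    have pos j : (c <= j)%N -> (j <= l)%N -> 0 <= x j by move=> cj jl; apply: (le_trans c0); exact: inc'.
    split=> [j jl|]; last by rewrite subnKC// /btw pos// (xb l _).2.
    have cj : (c + j < l)%N by rewrite -ltn_subRL.
    by rewrite addnS /btw pos ?leq_addr// ?(ltnW cj)// inc.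
  have left c : (c <= l)%N -> x c <= 0 -> c%:R * eps <= B1 + eps.
    move=> cl c0; apply: (half n m s (fun j => x (c - j)%N) c) => //; last first.
      move=> j jc; rewrite distrC -(subnSK jc); apply: jumps.
      by apply: leq_trans cl; rewrite subnSK// leq_subr.
    have neg j : (j <= c)%N -> x j <= 0 by move=> jc; apply: le_trans c0; exact: inc'.
    split=> [j jc|]; last by rewrite subnn /btw neg// (xb 0%N _).1// orbT.
    rewrite /btw -(subnSK jc) (neg _ _) ?inc ?orbT//; last by rewrite subnSK// leq_subr.
    by apply: leq_trans cl; rewrite subnSK// leq_subr.
  have [h|h] := leP (x l) 0; first by have := left l (leqnn _) h; lra.
  have ex : exists c, (c <= l)%N && (0 < x c) by exists l; rewrite leqnn h.
  case: (ex_minnP ex) => c /andP[cl xc] cmin.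
  have h1 := right c cl (ltW xc).
  case: c => [|c] in cl xc cmin h1 *; first by rewrite subn0 in h1; lra.
  have xc' : x c <= 0.
    rewrite leNgt; apply/negP => h2; have := cmin c; rewrite (ltnW cl) h2 => /(_ isT).
    by rewrite ltnn.
  have h2 := left c (ltnW cl) xc'.
  have -> : l%:R * eps = (l - c.+1)%:R * eps + (c%:R * eps + eps).
    by rewrite natrB// -[c.+1]addn1 natrD; ring.
  by lra.
exists (2 * (B1 + eps) + eps); elim=> [|n IH] m s t x l hs ht nm sm ms jumps.
  have := jumps_lip hs ht ms (leqnn 0) jumps; rewrite expr0 mul1r; lra.
have [st|st|st] := side_case s t.
- have m0 : (0 < m)%N by apply: leq_ltn_trans nm.
  apply: (IH (m - 1)%N (q s) (q t) (fun j => q (x j))).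
  + exact: quad_itvu.
  + exact: quad_itvu.
  + by rewrite leq_subRL.
  + exact: (@small_push _ _ m 1 d s t).
  + exact: mono_seq_quad.
  + by move=> j jl; rewrite -!iterSr; exact: jumps.
- exact: fold hs ht nm sm st ms jumps.
- apply: (fold n.+1 m t s (fun j => x (l - j)%N)) => //.
  + exact: small_sym.
  + exact: mono_seq_rev.
  + move=> j jl; rewrite distrC -(subnSK jl); apply: jumps.
    by rewrite subnSK// leq_subr.
Qed.

Lemma osc_chain_count eps : 0 < eps -> exists C : nat, forall n m s t l, u <= s -> t <= 1 ->
  (n <= m)%N -> small a m d s t -> chain (osc a n eps) s t l -> (l <= C)%N.
Proof.
move=> eps0; have eps20 : 0 < eps / 2 by rewrite divr_gt0.
have [B hB] := fold_count eps20; exists (Num.truncn (B / (eps / 2))).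
move=> n m s t l us t1 nm sm [x [x0 xl xi]].
have xle := chain_nth_le (fun i h => (xi i h).1).
have st : s <= t by apply: (le_trans x0); apply: le_trans xl; exact: xle.
(* Of two points of an interval that are eps apart after n steps, one is at least eps / 2 away from
   the point chosen before. *)
have /choice[F hF] : forall p : nat * R, exists w, (p.1 < l)%N ->
    x p.1 <= w <= x p.1.+1 /\ eps / 2 <= `|iter n q w - iter n q p.2|.
  move=> [i v] /=; have [il|_] := ltnP i l; last by exists 0.
  have [_ [y1 [y2 [h1 h2 h]]]] := xi i il.
  have [h3|h3] := leP (eps / 2) `|iter n q y1 - iter n q v|; first by exists y1.
  exists y2 => _; split => //.
  have := ler_distD (iter n q v) (iter n q y1) (iter n q y2).
  rewrite (distrC (iter n q v)); move: h h3; move: `|_| `|_| `|_| => X1 X2 X3; lra.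
pose w := fix w i := if i is i'.+1 then F (i', w i') else x 0%N.
have wb i : (i < l)%N -> x i <= w i.+1 <= x i.+1 by move=> il; have [] := hF (i, w i) il.
have wx i : (i <= l)%N -> w i <= x i.
  by case: i => [|i] il //; have /andP[] := wb i il.
have w0 i : (i <= l)%N -> x 0%N <= w i.
  case: i => [|i] il //; have /andP[h _] := wb i il; apply: le_trans h; apply: xle => //.
  exact: ltnW.
have sw i : (i <= l)%N -> s <= w i by move=> il; apply: (le_trans x0); exact: w0.
have ww i : (i < l)%N -> w i <= w i.+1.
  by move=> il; have /andP[h _] := wb i il; apply: le_trans h; apply: wx; exact: ltnW.
have h : l%:R * (eps / 2) <= B.
  apply: (hB n m s t w l); rewrite ?us ?(le_trans st)//=; try by rewrite (le_trans us).
    split=> [j jl|]; first by rewrite /btw sw ?ww// ltnW.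
    by rewrite /btw sw//= (le_trans (wx l _)).
  by move=> j jl; have [] := hF (j, w j) jl.
rewrite truncn_ge_nat; first by rewrite ler_pdivlMr.
by rewrite divr_ge0 ?(ltW eps20)//; apply: le_trans h; rewrite mulr_ge0// ltW.
Qed.

(** Points of a fine chain with the same [lam] span an interval contracted at a time past n, so
    there are at most C + 1 of them; the number of groups is at most the increment of [lam] plus
    one. Thus [coding] applies to the finer label. *)
Lemma label_osc_range eps : 0 < d -> 0 < eps -> exists V : nat, forall n m s t, (n <= m)%N ->
  u <= s -> s <= t -> t <= 1 ->
  (label (osc a n eps) u (big_bound a n eps) t <=
   label (osc a n eps) u (big_bound a n eps) s + V * (lam a m d t - lam a m d s).+1)%N.
Proof.
move=> d0 eps0; have [C hC] := osc_chain_count eps0; exists C.+2 => n m s t nm us st t1.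
have cb l : chain (osc a n eps) u 1 l -> (l <= big_bound a n eps)%N by exact: osc_chain_bound.
set ls := label _ _ _ s; set lt := label _ _ _ t; set rho := (lam a m d t - lam a m d s)%N.
suff h : (lt - ls.+1 <= rho.+1 * C.+1)%N.
  rewrite -leq_subLR mulnC mulnS; move: h; rewrite subnS.
  by case: (lt - ls)%N => [|e]//= h; rewrite -add1n leq_add.
have [x [x0 xl xi]] := label_split cb us st t1.
have xle := chain_nth_le (fun i h => (xi i h).1).
set l := (_ - _)%N in x0 xl xi xle *.
have xI j : (j <= l)%N -> u <= x j /\ x j <= 1.
  move=> jl; split; first by apply: (le_trans us); apply: (le_trans x0); exact: xle.
  by apply: le_trans t1; apply: le_trans xl; exact: xle.
have H1 : at_most (fun i j => lam a m d (x i) <> lam a m d (x j)) (fun j => (j <= l)%N) rho.+1.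
  apply: (@at_most_range R) => i j il jl.
  have [hi1 hi2] := xI i il; have [hj1 hj2] := xI j jl.
  have h1 : (lam a m d (x i) <= lam a m d t)%N.
    by apply: (lam_le a0 a2) => //; apply: le_trans xl; exact: xle.
  have h2 : (lam a m d s <= lam a m d (x j))%N.
    by apply: (lam_le a0 a2) => //; apply: (le_trans x0); exact: xle.
  by apply: (leq_trans h1); rewrite -leq_subLR; apply: leq_sub2l.
have H2 v : at_most (fun i j => i <> j) (fun j => (j <= l)%N /\ lam a m d (x j) = v) C.+1.
  apply: (@at_most_range R) => i j [il vi] [jl vj]; have [ij|ji] := leqP i j.
    by rewrite (leq_trans ij)// leq_addr.
  rewrite -leq_subLR; have [hi1 hi2] := xI i il; have [hj1 hj2] := xI j jl.
  have bi : u <= x i <= 1 by rewrite hi1.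
  have bj : u <= x j <= 1 by rewrite hj1.
  have [n' mn' sm] := lam_small a0 a2 d0 bj bi (etrans vj (esym vi)).
  apply: (hC n n' (x j) (x i)) => //; first exact: leq_trans mn'.
  exists (fun k => x (j + k)%N); rewrite addn0 subnKC ?(ltnW ji)//; split=> // k' kl.
  by rewrite addnS; apply: xi; rewrite (leq_trans _ il)// -ltn_subRL.
have := @at_most_fiber _ _ (fun j => lam a m d (x j)) (fun i j => i <> j) (fun j => (j <= l)%N) _ _ H1 H2.
move=> /(_ (iota 0 l.+1) (iota_uniq _ _)); rewrite size_iota => h.
apply: ltnW; apply: h.
- by move=> j; rewrite mem_iota ltnS.
- by move=> i j _ _ ij _; apply/eqP.
Qed.

End FoldCount.

(** * Entropy of homeomorphisms homotopic to a shift *)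

Section CodeGrowth.
Context {R : realType}.

Lemma expR_large (C eta : R) : 0 < eta -> exists N0 : nat, forall N, (N0 <= N)%N -> C <= expR (N%:R * eta).
Proof.
move=> eta0; exists (Num.truncn (C / eta)).+1 => N NN.
apply: le_trans (expR_ge1Dx _); rewrite -[C]add0r lerD//.
rewrite -ler_pdivrMr//; apply: le_trans (ltW (truncnS_gt _)) _.
by rewrite ler_nat.
Qed.

(** N precedes K, which depends on N in the coding. *)
Lemma count_growth (a : R) (r V J : nat) (eta : R) : 0 < a -> a <= 2 -> 0 < eta -> exists2 N : nat, (0 < N)%N &
  forall K : nat, exists2 A : R, 0 < A & forall n : nat,
  (K.+1 * (N * (V * (J * N).*2.+2)).+1 *
   (ell a (r * N) * (J * N).*2.+2 * (N * (V * (J * N).*2.+2)).+1) ^ (n %/ N))%:R <=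
  A * expR (n%:R * (r%:R * lap_rate a + eta)).
Proof.
(* Five shares of eta: one for the laps, one for [Q N], two for [P N], one for the constant C. *)
move=> a0 a2 eta0; pose e := eta / 5; have e0 : 0 < e by rewrite divr_gt0.
have e1 : 0 < e / r.+1%:R by rewrite divr_gt0.
have [A0 A00 hA0] := ell_upper a0 a2 e1.
have [A1 A10 hA1] := @affine_expR R (J%:R *+ 2) 2 e ltac:(by rewrite mulrn_wge0) ltac:(by []) e0.
have [A2 A20 hA2] := @affine_expR R 1 1 e ler01 ltr01 e0.
pose Q N := (J * N).*2.+2; pose P N := (N * (V * Q N)).+1.
have hQ N : (Q N)%:R <= A1 * expR (N%:R * e).
  by apply: le_trans (hA1 N); rewrite /Q -addn2 natrD -muln2 !natrM lerD2r mulrAC [J%:R * 2]mulr_natr.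
have hP N : (P N)%:R <= V.+1%:R * (A1 * expR (N%:R * e)) * (A2 * expR (N%:R * e)).
  apply: (@le_trans _ _ ((V.+1 * Q N * N.+1)%:R)).
    rewrite ler_nat /P mulnS -add1n; apply: leq_add; first by rewrite muln_gt0.
    by rewrite mulnC leq_mul2r leq_mul2r leqnSn !orbT.
  rewrite !natrM; apply: ler_pM => //.
    by rewrite ler_wpM2l.
  by apply: le_trans (hA2 N); rewrite mul1r -[N.+1]addn1 natrD.
pose C := A0 * A1 * (V.+1%:R * A1 * A2).
have [N0 hN0] := expR_large C e0.
pose N := N0.+1; exists N => // K.
have C0 : 0 < C by rewrite !mulr_gt0.
have r0 := lap_rate_ge0 a.
set x := (_ * Q N * P N)%N.
have hx : x%:R <= expR (N%:R * (r%:R * lap_rate a + eta)).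
  rewrite !natrM.
  have h1 : (ell a (r * N))%:R <= A0 * expR (N%:R * (r%:R * lap_rate a + e)).
    apply: le_trans (hA0 _) _; rewrite ler_wpM2l ?(ltW A00)// ler_expR natrM [r%:R * _]mulrC -mulrA.
    by rewrite ler_wpM2l// mulrDr lerD2l mulrCA ger_pMr// ler_pdivrMr ?mul1r ?ler_nat//.
  have h2 := hQ N; have h3 := hP N; have h4 := hN0 N (leqnSn _).
  apply: (@le_trans _ _ (A0 * expR (N%:R * (r%:R * lap_rate a + e)) * (A1 * expR (N%:R * e)) *
     (V.+1%:R * (A1 * expR (N%:R * e)) * (A2 * expR (N%:R * e))))).
    by apply: ler_pM => //; apply: ler_pM.
  have -> : N%:R * (r%:R * lap_rate a + eta) =
    N%:R * (r%:R * lap_rate a + e) + N%:R * e + N%:R * e + N%:R * e + N%:R * e by rewrite /e; field.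
  rewrite !expRD; move: h4; rewrite /C; set X := expR (N%:R * e); set Y := expR _ => h4.
  have -> : A0 * Y * (A1 * X) * (V.+1%:R * (A1 * X) * (A2 * X)) =
    Y * X * X * X * (A0 * A1 * (V.+1%:R * A1 * A2)) by ring.
  by rewrite ler_wpM2l// !mulr_ge0// expR_ge0.
exists (K.+1 * P N)%:R => [|n]; first by rewrite ltr0n muln_gt0.
rewrite natrM ler_wpM2l// natrX.
apply: le_trans (_ : expR (N%:R * (r%:R * lap_rate a + eta)) ^+ (n %/ N) <= _).
  by rewrite lerXn2r// nnegrE ?expR_ge0.
rewrite -expRM_natl ler_expR mulrA ler_wpM2r//; last by rewrite -natrM ler_nat leq_divM.
by rewrite addr_ge0 ?mulr_ge0// ltW.
Qed.

End CodeGrowth.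

Section UpperBound.
Context {R : realType}.
Variable a : R.
Hypotheses (a0 : 0 < a) (a2 : a <= 2) (b0 : 0 < lap_rate a).
Local Notation q := (quad a).
Local Notation u := (left_fix a).
Local Notation X := (invlim a).
Local Notation coord := Defs.coord.
Variable ha : 0 <= a <= 2.
Variables (g : X -> X) (r : nat).
Hypotheses (gc : ctrl g) (ginj : injective g) (gh : homotopic g (shift_pow ha (- r%:Z))).

(** M' precedes [Lab], since the finer label is defined from M'. *)
Lemma coding_growth (d : R) (M1 V : nat) (delta eta : R) : 0 < d -> 0 < delta -> 0 < eta ->
  exists M' : nat, exists2 A : R, 0 < A & (M1 <= M')%N /\
  forall Lab : R -> nat,
  (forall s t, u <= s -> s <= t -> t <= 1 -> (Lab s <= Lab t)%N) ->
  (forall s t, u <= s -> s <= t -> t <= 1 ->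
     (Lab t <= Lab s + V * (lam a M' d t - lam a M' d s).+1)%N) ->
  forall n, exists (code : X -> seq (nat * seq nat)) (c : nat),
    [/\ at_most (fun y y' => code y <> code y') (fun=> True) c,
      c%:R <= A * expR (n%:R * (r%:R * lap_rate a + eta)) &
      forall y y', code y = code y' -> forall i, (i < n)%N -> exists w w' : X,
      [/\ `|coord w M1 - coord (iter i g y) M1| < delta,
        `|coord w' M1 - coord (iter i g y') M1| < delta &
        Lab (coord w M') = Lab (coord w' M')]].
Proof.
move=> d0 delta0 eta0.
have [Lam sc] := semiconjugacy a0 a2 b0.
have [J hJ] := lam_iter a0 a2 d0 gh.
have [N N0 hN] := count_growth r V J a0 a2 eta0.
have [M' [K [MM h]]] := coding a0 a2 b0 sc gc ginj gh d0 hJ M1 N0 delta0.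
have [A A0 hA] := hN K.
exists M', A => //; split=> // Lab Lmono Lrange n.
have [code [h1 h2]] := h Lab V Lmono Lrange (n %/ N)%N.
exists code, (K.+1 * (N * (V * (J * N).*2.+2)).+1 *
   (ell a (r * N) * (J * N).*2.+2 * (N * (V * (J * N).*2.+2)).+1) ^ (n %/ N))%N; split=> //.
move=> y y' yy i iN; apply: h2 => //; apply: (leq_trans iN).
by rewrite mulnC ltnW// ltn_ceil.
Qed.

(** The label measures the oscillation of the iterate of order M' - M2, so equal labels at index M'
    bound the distance at index M2: equal codes exclude separation. *)
Lemma entropy_le_fold : ~ no_fold a -> (htop g setT <= (r%:R * lap_rate a)%:E)%E.
Proof.
move=> nf.
have [k [s0 [p [k0 ku zk /andP[s00 sk] [p0 ps0]]]]] : exists (k s : R) (n : nat),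
    [/\ 0 < k, k <= - u, zero a 0 k, 0 <= s <= k & (0 < n)%N /\ iter n q s = 0].
  apply: contrapT => h; apply: nf => k s n k0 ku zk sk n0 e; apply: h.
  by exists k, s, n; split.
have [k' [z [d [k'0 zk' d0 shr crt]]]] :=
  trap_facts a0 a2 p0 s00 ps0 (ex_intro _ k (And4 k0 sk ku zk)).
apply: htop_le => e eta e0 eta0.
have [M2 [eta2 eta20 hM2]] := coord_close a0 a2 e0.
have e20 : 0 < eta2 / 2 by rewrite divr_gt0.
have e40 : 0 < eta2 / 4 by rewrite divr_gt0.
have [V hV] := label_osc_range a0 a2 zk' shr crt d0 e20.
have [M' [A A0 [MM h]]] := coding_growth M2 V d0 e40 eta0.
pose n' := (M' - M2)%N.
have cb l : chain (osc a n' (eta2 / 2)) u 1 l -> (l <= big_bound a n' (eta2 / 2))%N.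
  exact: osc_chain_bound.
pose Lab := label (osc a n' (eta2 / 2)) u (big_bound a n' (eta2 / 2)).
have om : forall s t s' t', s' <= s -> t <= t' -> osc a n' (eta2 / 2) s t -> osc a n' (eta2 / 2) s' t'.
  by move=> s t s' t'; exact: osc_mono.
have close s t : u <= s <= 1 -> u <= t <= 1 -> Lab s = Lab t ->
    `|iter n' q s - iter n' q t| < eta2 / 2.
  wlog st : s t / s <= t => [H|/andP[us s1] /andP[ut t1] e1].
    have [st|/ltW ts] := leP s t; first exact: H.
    by move=> hs ht /esym e1; rewrite distrC; exact: H.
  rewrite ltNge; apply/negP => h1.
  apply: (label_eqN om cb us st t1 e1); exists s, t.
  by rewrite !lexx st.
exists A => // n E uE _ sep.
have [code [c [h1 h2 h3]]] := h Lab (label_le cb) (fun s t => hV n' M' s t (leq_subr _ _)) n.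
apply: le_trans h2; rewrite ler_nat; apply: h1 => // x y xE yE xy cxy.
have [i il] := sep x y xE yE xy; rewrite ltNge => /negP; apply; apply: ltW.
have [w [w' [hw hw' /close]]] := h3 x y cxy i il.
move=> /(_ (coord_itv _ _) (coord_itv _ _)).
rewrite !coord_iterV// => hc; apply: hM2; move: hw hw' hc.
move: (coord _ _) (coord _ _) (coord _ _) (coord _ _) => x1 x2 x3 x4; clear.
by rewrite !ltr_norml ler_norml => /andP[? ?] /andP[? ?] /andP[? ?]; apply/andP; split; lra.
Qed.

(** Equal codes give null-related points, at most c separated ones per block. As c is linear in N,
    its power costs at most e^(n eta / 2), up to a constant. This N is chosen independently of the
    block length inside the coding. *)
Lemma entropy_le_no_fold : no_fold a -> (htop g setT <= (r%:R * lap_rate a)%:E)%E.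
Proof.
move=> nf; apply: htop_le => e eta e0 eta0.
have [M2 [eta2 eta20 hM2]] := coord_close a0 a2 e0.
have e20 : 0 < eta2 / 2 by rewrite divr_gt0.
have eta'0 : 0 < eta / 2 by rewrite divr_gt0.
have eta4 : 0 < eta / 4 by rewrite divr_gt0.
have u1 := left_fix_leN1 a0 a2.
have [B B0 hB] := @affine_expR R (2 * (1 - u) / (eta2 / 2 / 2)) 1 (eta / 4)
  ltac:(by rewrite divr_ge0// ?mulr_ge0//; lra) ltr01 eta4.
have [N0 hN0] := expR_large B eta4.
pose N := N0.+1; pose c := (Num.truncn (N.*2%:R * (1 - u) / (eta2 / 2 / 2))).+1.
have cN : c%:R <= expR (N%:R * (eta / 2)).
  have -> : N%:R * (eta / 2) = N%:R * (eta / 4) + N%:R * (eta / 4) by field.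
  rewrite expRD; apply: (@le_trans _ _ (B * expR (N%:R * (eta / 4)))); last first.
    by rewrite ler_wpM2r ?expR_ge0// hN0.
  apply: le_trans (hB N); rewrite /c -addn1 natrD lerD2r.
  have h : 0 <= N.*2%:R * (1 - u) / (eta2 / 2 / 2).
    by rewrite divr_ge0 ?mulr_ge0//; lra.
  apply: (@le_trans _ _ (N.*2%:R * (1 - u) / (eta2 / 2 / 2))); first by rewrite truncn_le.
  rewrite -muln2 natrM; rewrite le_eqVlt; apply/orP; left; apply/eqP; field.
  by rewrite gt_eqF.
have [d [delta [M1 [d0 delta0 hcount]]]] :=
  null_related_count a0 a2 M2 gc ginj nf (ltn0Sn N0) e20.
have [M' [A A0 [MM h]]] := coding_growth M1 1 d0 delta0 eta'0.
exists (A * expR (N%:R * (r%:R * lap_rate a + eta))); first by rewrite mulr_gt0 ?expR_gt0.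
move=> n E uE _ sep; pose n1 := (N * (n %/ N).+1)%N.
have nn1 : (n <= n1)%N by rewrite /n1 mulnC ltnW// ltn_ceil.
have n1n : (n1 <= N + n)%N by rewrite /n1 mulnS leq_add2l mulnC leq_divM.
have lab_range s t : u <= s -> s <= t -> t <= 1 ->
    (lam a M' d t <= lam a M' d s + 1 * (lam a M' d t - lam a M' d s).+1)%N.
  by move=> _ _ _; rewrite mul1n addnS leqW// -leq_subLR.
have [code [c1 [h1 h2 h3]]] := h (lam a M' d) (fun s t us st t1 => lam_le a0 a2 M' d0 us st t1) lab_range n1.
(* Half of eta2 is used so that no third point is close to both members of a pair separated by
   eta2. *)
pose rel2 j x y := separated_at g N M2 (eta2 / 2) (iter (N * j) g x) (iter (N * j) g y).
have fib v : at_most (fun x y => exists2 j, (j < (n %/ N).+1)%N & forall z, rel2 j x z \/ rel2 j y z)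
    (fun x => True /\ code x = v) (c ^ (n %/ N).+1).
  apply: at_most_join.
  - by move=> j x y [i iN hi]; exists i => //; rewrite distrC.
  - by move=> j x [i iN]; rewrite subrr normr0 leNgt e20.
  move=> j jl F uF Fv Fs; rewrite -(size_map (iter (N * j) g)); apply: hcount.
  - by rewrite map_inj_uniq//; elim: (N * j)%N => [|i IH] //= x y /ginj/IH.
  - move=> _ _ /mapP[y yF ->] /mapP[y' yF' ->] yy; apply: Fs => //.
    by apply: contra_neq yy => ->.
  - move=> _ _ /mapP[y yF ->] /mapP[y' yF' ->] _ i iN.
    have cyy : code y = code y' by rewrite (Fv y yF).2 (Fv y' yF').2.
    have [|w [w' [hw hw' hl]]] := h3 y y' cyy (i + N * j)%N.
      by rewrite (@leq_trans (N * j.+1))// ?leq_mul2l ?jl ?orbT// mulnS ltn_add2r.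
    exists w, w'; rewrite -!iterD; split=> // m mM.
    have [n2 Mn2 sm] := lam_small a0 a2 d0 (coord_itv w M') (coord_itv w' M') hl.
    have mM' := leq_trans mM MM.
    exists (n2 - (M' - m))%N; rewrite -(coord_iterV w mM') -(coord_iterV w' mM').
    by apply: small_push => //; apply: leq_trans (leq_subr _ _) Mn2.
have hE := @at_most_fiber _ _ code _ (fun=> True) _ _ h1 fib E uE (fun _ _ => I).
apply: (@le_trans _ _ (c1 * c ^ (n %/ N).+1)%:R).
  rewrite ler_nat; apply: hE => x y xE yE xy _.
  have [i il] := sep x y xE yE xy => hi.
  have iN : (i = i %% N + N * (i %/ N))%N by rewrite addnC mulnC -divn_eq.
  exists (i %/ N)%N; first by rewrite ltnS leq_div2r// ltnW.
  have hs : eta2 < `|coord (iter i g x) M2 - coord (iter i g y) M2|.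
    by rewrite ltNge; apply/negP => /hM2; rewrite ltNge (ltW hi).
  move=> z; have [h4|h4] := leP (eta2 / 2) `|coord (iter i g x) M2 - coord (iter i g z) M2|.
    by left; exists (i %% N)%N; rewrite ?ltn_pmod// -!iterD -iN.
  right; exists (i %% N)%N; rewrite ?ltn_pmod// -!iterD -iN.
  have := ler_distD (coord (iter i g z) M2) (coord (iter i g x) M2) (coord (iter i g y) M2).
  rewrite (distrC (coord (iter i g z) M2)).
  by move: hs h4; move: `|_| `|_| `|_| => X1 X2 X3; lra.
rewrite natrM natrX.
have h5 : c%:R ^+ (n %/ N).+1 <= expR (n1%:R * (eta / 2)).
  rewrite /n1 mulnC natrM -mulrA expRM_natl.
  by apply: lerXn2r => //; rewrite nnegrE// expR_ge0.
apply: le_trans (ler_pM _ _ h2 h5) _ => //.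
have r0 := lap_rate_ge0 a.
rewrite -!mulrA ler_wpM2l ?(ltW A0)// -!expRD ler_expR -mulrDr -addrA -splitr -mulrDl -natrD.
by rewrite ler_wpM2r ?ler_nat// addr_ge0 ?mulr_ge0// ltW.
Qed.

Lemma entropy_le : (htop g setT <= (r%:R * lap_rate a)%:E)%E.
Proof.
have [|] := pselect (no_fold a); first exact: entropy_le_no_fold.
exact: entropy_le_fold.
Qed.

End UpperBound.

Section Inverse.
Context {R : realType} {T : metricType R}.

(** [iter n.-1 f] sends sets separated for f to sets separated for g, with time reversed. *)
Lemma htop_inv (f g : T -> T) : cancel f g -> cancel g f -> htop f setT = htop g setT.
Proof.
have le (f' g' : T -> T) n e : cancel f' g' ->
    (max_separated f' setT n e <= max_separated g' setT n e)%E.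
  move=> fK; have itK k x : iter k g' (iter k f' x) = x.
    by elim: k x => // k IH x; rewrite iterSr iterS fK IH.
  apply: ge_ereal_sup => _ [E [_ sE] <-].
  apply: ereal_sup_ubound; exists [fset iter n.-1 f' x | x in E]%fset; last first.
    by rewrite card_imfset//; exact: can_inj (itK n.-1).
  split=> // _ _ /imfsetP[x /= xE ->] /imfsetP[y /= yE ->] xy.
  have [k kn hk] := sE x y xE yE ltac:(by move=> exy; apply: xy; rewrite exy).
  have e1 : (n.-1 = (n.-1 - k) + k)%N by rewrite subnK// -ltnS (ltn_predK kn).
  exists (n.-1 - k)%N.
    by rewrite (leq_ltn_trans (leq_subr _ _))// ltn_predL (leq_ltn_trans _ kn).
  by rewrite e1 !iterD -e1 !itK.
move=> fg gf; rewrite /htop (_ : max_separated f setT = max_separated g setT)//.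
by apply/funext => n; apply/funext => e; apply/eqP; rewrite eq_le !le.
Qed.

Lemma htop_ge0 (f : T -> T) (x : T) : (0%:E <= htop f setT)%E.
Proof.
apply: htop_ge => eta eta0; exists 1, 1; split=> // n; exists [:: x]; split=> //.
  by move=> y z; rewrite !inE => /eqP-> /eqP->; rewrite eqxx.
by rewrite mul1r -[leRHS]expR0 ler_expR mulr_ge0_le0// sub0r oppr_le0 ltW.
Qed.

End Inverse.

Section Main.
Context {R : realType}.
Variable a : R.
Local Notation X := (invlim a).

(** For a = 0 the convention on the inverse of 0 makes the interval [0, 1], where the map is
    constant: points are separated at time 0 only. *)
Lemma quad_entropy_gt0 : 0 <= a -> (0 < quad_entropy a)%E -> 0 < a.
Proof.
rewrite le0r => /orP[/eqP->|//]; rewrite ltNge => /negP h; exfalso; apply: h.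
apply: htop_le => e eta e0 eta0.
exists (Num.truncn e^-1).+1%:R => // n E uE EK sep.
apply: (@le_trans _ _ (Num.truncn e^-1).+1%:R); last first.
  by rewrite ler_peMr// -[leLHS]expR0 ler_expR mulr_ge0// add0r ltW.
have itv x : x \in E -> 0 <= x <= 1.
  by move=> /EK; rewrite /= in_itv/= /left_fix mulr0 invr0 mul0r.
rewrite ler_nat; apply: (@at_most_range R _ (fun x : R => Num.truncn (x / e)) (fun x => x \in E)) => //.
  move=> x y /itv/andP[x0 x1] _; apply: (leq_trans _ (leq_addl _ _)).
  by apply: le_truncn; rewrite ler_pdivrMr// mulVf ?gt_eqF.
move=> x y xE yE xy txy; have [k _] := sep x y xE yE xy.
have /andP[x0 x1] := itv x xE; have /andP[y0 y1] := itv y yE.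
case: k => [|k]; last by rewrite /= /quad !mul0r mdistxx ltNge ltW.
have := truncn_itv (divr_ge0 x0 (ltW e0)); have := truncn_itv (divr_ge0 y0 (ltW e0)).
rewrite txy; move: (Num.truncn _) => m /andP[]; rewrite ler_pdivlMr// ltr_pdivrMr// => h1 h2.
move=> /andP[]; rewrite ler_pdivlMr// ltr_pdivrMr// => h3 h4.
have h : `|(x : R) - y| <= e.
  rewrite -natr1 !mulrDl !mul1r in h2 h4; rewrite ler_norml; apply/andP; split; lra.
by rewrite mdist_regular ltNge => /negP; apply.
Qed.

Hypotheses (a0 : 0 < a) (a2 : a <= 2) (b0 : 0 < lap_rate a).
Variable ha : 0 <= a <= 2.

Lemma htop_homotopic_shift (f g : X -> X) (n : nat) : continuous f -> continuous g ->
  cancel f g -> cancel g f -> homotopic f (shift_pow ha n) ->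
  htop f setT = (n%:R * lap_rate a)%:E.
Proof.
move=> fc gc fg gf fn; have [Lam sc] := semiconjugacy a0 a2 b0.
apply/eqP; rewrite eq_le; apply/andP; split.
  rewrite (htop_inv fg gf); apply: (entropy_le a0 a2 b0 (ha := ha)).
  - exact: continuous_ctrl.
  - exact: can_inj gf.
  - exact: (homotopic_inv a0 a2 gf fn).
(* For n = 0 the lower bound is nonnegativity, witnessed by the constant orbit at u. *)
case: n fn => [|n] fn; last first.
  by apply: (homotopic_shift_htop_ge a0 a2 b0 sc (ha := ha)) => //; exact: continuous_ctrl.
rewrite mul0r; apply: htop_ge0.
have ui : left_fix a <= left_fix a <= 1 by have := left_fix_leN1 a0 a2; lra.
exact: (@Invlim R a (fun=> left_fix a) (fun=> ui) (fun=> quad_u a0)).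
Qed.

End Main.

Theorem theorem1p2 (R : realType) (a : R) (ha : 0 <= a <= 2)
  (hpos : (0 < quad_entropy a)%E)
  (s : R) (hs : 1 < s)
  (hlog : (ln s)%:E = quad_entropy a)
  (h : invlim a -> invlim a) (hh : homeomorphism h)
  (k : int) (hk : isotopic R h (shift_pow ha k)) :
  htop h [set: invlim a] = (`|k|%:~R * ln s)%:E.
Proof.
have /andP[age0 a2] := ha; have a0 := quad_entropy_gt0 age0 hpos.
have b0 : 0 < lap_rate a by rewrite -lte_fin (lt_le_trans hpos)// quad_entropy_le.
have -> : ln s = lap_rate a by apply: EFin_inj; rewrite hlog (quad_entropyE a0 a2 b0).
have [hc [g [gc hg gh]]] := hh; have hk' := isotopic_homotopic a0 a2 hk.
case: k hk hk' => n _ hk; first exact: (htop_homotopic_shift a0 a2 b0 hc gc hg gh hk).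
rewrite (htop_inv hg gh) (htop_homotopic_shift a0 a2 b0 gc hc gh hg (n := n.+1)) //.
by have := homotopic_inv a0 a2 gh hk; rewrite NegzE opprK.
Qed.
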